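(* Let $(\varkappa_t)_{t\in\mathbb R}$ be the Gaussian process $$\varkappa_t=\frac1{\sqrt{2\pi}}e^{-\frac12t^2}\sum_{k=0}^\infty\mathbb E\big[Y_{\frac12}^k\big]\frac1{\sqrt{k!}}H_k(t)\cdot\zeta_k,$$ with $(\zeta_k)$ i.i.d. $N(0,1)$, let $\widehat\varkappa_\theta=\int_{\mathbb R}e^{i\theta t}\varkappa_t\,dt$, $\theta\in\mathbb R$, and let $U_\theta$, $V_\theta$ be the independent real Gaussian processes $U_\theta=\int_{\mathbb R}e^{i\theta t}\varkappa_t^{\mathrm{even}}dt$, $V_\theta=i\int_{\mathbb R}e^{i\theta t}\varkappa_t^{\mathrm{odd}}dt$, for which $\widehat\varkappa_\theta$ is distributed as $U_\theta+iV_\theta$. A strong representation of $U_\theta,V_\theta$ is $$U_\theta=\sum_{k=0}^\infty\frac{\mathrm{Poisson}\big(k;\frac12\theta^2\big)}{\sqrt{(2k-1+\delta_{k0})!!}}\,\mathbb E\big[Y_{\frac12}^{2k}\big](-\sqrt2)^k\,\zeta_{2k},$$ $$V_\theta=\theta\sum_{k=0}^\infty\frac{\mathrm{Poisson}\big(k;\frac12\theta^2\big)}{\sqrt{(2k+1)!!}}\cdot\mathbb E\big[Y_{\frac12}^{2k+1}\big](-\sqrt2)^k\,\zeta_{2k+1},$$ where $\mathrm{Poisson}(k;\lambda)=\frac{\lambda^k}{k!}e^{-\lambda}$, $k\in\mathbb N=\{0,1,2,\dots\}$. An inversion formula is $$\varkappa_t=\frac1{2\pi}\int_{\mathbb R}e^{-i\theta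 t}\,\widehat\varkappa_\theta\,d\theta,\qquad t\in\mathbb R.$$
   Context: $\nu_*^{[-1,1]}$ is a non-negative measure on $[-1,1]$. $Y_{\frac12}$ is a random variable distributed as the product of the points in a point process with probability generating functional $G[f]^{1/2}$, where $G[f]=\big(1+\int_{[-1,1]}(1-f(\xi))\,\nu_*^{[-1,1]}(d\xi)\big)^{-1}$ and the probability generating functional of a point process with points $(\xi_j)$ is $\mathbb E[\prod_jf(\xi_j)]$ for suitable functions $f$. The Hermite–Chebycheff polynomials $H_k$, orthogonal on the standard normal distribution, have generating function $\sum_{k\ge0}\frac{w^k}{k!}H_k(t)=e^{wt-\frac12w^2}$. The even and odd parts are $\varkappa_t^{\mathrm{even}}=\frac12(\varkappa_t+\varkappa_{-t})$ and $\varkappa_t^{\mathrm{odd}}=\frac12(\varkappa_t-\varkappa_{-t})$. $\delta_{k0}$ is the Kronecker delta and $n!!$ the double factorial, with $0!!=1$.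
   Formalization: The series for U and V carry an extra factor √(k!) in each term, without which they are false; they are driven by (−1)^k ζ_k in place of ζ_k, which mends the sign of V; the inversion integral is an improper integral in mean square, since the transform is not absolutely integrable. *)

(* Defs.v *)
From HB Require Import structures.
From mathcomp Require Import all_boot all_order all_algebra.
From mathcomp Require Import finmap.
From mathcomp Require Import all_classical all_reals all_analysis.
From mathcomp.real_closed Require Import complex.

Set Implicit Arguments.
Unset Strict Implicit.
Unset Printing Implicit Defensive.

Import Order.TTheory GRing.Theory Num.Theory.
Import numFieldNormedType.Exports.

Local Open Scope classical_set_scope.
Local Open Scope ring_scope.

Section special_functions.
Context {R : realType}.

Fixpoint dfact (n : nat) : nat :=
  match n with
  | 0 | 1 => 1
  | (m.+1 as p).+1 => p.+1 * dfact m
  end.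

(* The library's [poisson_pmf lambda] is the constant 1 when [lambda <= 0],
   whereas [lambda = 0] does occur below and must give the point mass at 0. *)
Definition poisson (k : nat) (lambda : R) : R :=
  lambda ^+ k / (k`!)%:R * expR (- lambda).

(* The generating function determines the sequence [H] uniquely. *)
Definition hermite_chebycheff (H : nat -> {poly R}) : Prop :=
  forall w t : R,
    (\sum_(k < n) w ^+ k / (k`!)%:R * (H k).[t]) @[n --> \oo]
      --> expR (w * t - w ^+ 2 / 2).

End special_functions.

Section complex_integrals.
Context {R : realType}.

Definition cis (x : R) : R[i] := (cos x +i* sin x)%C.

Definition normsq (z : R[i]) : R := complex.Re z ^+ 2 + complex.Im z ^+ 2.

Definition cintegral (D : set R) (f : R -> R[i]) : R[i] :=
  ((\int[lebesgue_measure]_(x in D) complex.Re (f x))%R +i*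
   (\int[lebesgue_measure]_(x in D) complex.Im (f x))%R)%C.

Definition fourier (f : R -> R) (theta : R) : R[i] :=
  cintegral setT (fun t => cis (theta * t) * ((f t)%:C)%C).

Definition even_part (f : R -> R) (t : R) : R := (f t + f (- t)) / 2.
Definition odd_part (f : R -> R) (t : R) : R := (f t - f (- t)) / 2.

End complex_integrals.

Section point_processes.
Context {R : realType} {d : measure_display} {T : measurableType d}.
Variable Q : probability T R.

(* A countable random family of points of [-1,1], listed with multiplicity:
   the points of the outcome [w] are the [xi j w] with [present j w]. *)
Record point_process (present : nat -> T -> bool) (xi : nat -> T -> R) : Prop := {
  present_measurable : forall j, measurable_fun setT (present j) ;
  point_measurable : forall j, measurable_fun setT (xi j) ;
  point_itv : forall j w, present j w -> xi j w \in `[-1, 1] }.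

Definition partial_product (present : nat -> T -> bool) (xi : nat -> T -> R)
    (f : R -> R) (n : nat) (w : T) : R :=
  \prod_(j < n | present j w) f (xi j w).

Definition pgfl (present : nat -> T -> bool) (xi : nat -> T -> R)
    (f : R -> R) : \bar R :=
  (\int[Q]_w (limn (fun n => partial_product present xi f n w))%:E)%E.

(* Functions with values in [0,1] are the usual domain of a probability
   generating functional: the infinite products converge, and the law of the
   point process is determined. *)
Definition has_pgfl (present : nat -> T -> bool) (xi : nat -> T -> R)
    (F : (R -> R) -> \bar R) : Prop :=
  forall f : R -> R, measurable_fun `[(-1 : R), 1]%classic f ->
    (forall x, x \in `[-1, 1] -> 0 <= f x <= 1) ->
    pgfl present xi f = F f.

Definition product_of_points (present : nat -> T -> bool) (xi : nat -> T -> R)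
    (Z : T -> R) : Prop :=
  {ae Q, forall w, partial_product present xi id n w @[n --> \oo] --> Z w}.

End point_processes.

(* A measure on [-1,1] is given by a Borel measure on the line, of which only
   the restriction to [-1,1] is used; it may be infinite, with
   [(+oo)^-1 = 0] in the extended reals. *)
Definition Gfun {R : realType} (nu : {measure set (measurableTypeR R) -> \bar R})
    (f : R -> R) : \bar R :=
  ((1 + \int[nu]_(x in `[(-1 : R)%R, 1%R]%classic) (1 - f x)%:E)^-1)%E.

Section gaussian.
Context {R : realType} {d : measure_display} {T : measurableType d}.
Variable P : probability T R.

Definition mutually_independent (z : nat -> T -> R) : Prop :=
  forall (J : {fset nat}) (A : nat -> set R), (forall k, measurable (A k)) ->
    P (\bigcap_(k in [set` J]) (z k @^-1` A k)) =
    (\prod_(k <- J) P (z k @^-1` A k))%E.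

Record iid_std_normal (z : nat -> T -> R) : Prop := {
  iid_measurable : forall k, measurable_fun setT (z k) ;
  iid_law : forall k (A : set R), measurable A ->
    P (z k @^-1` A) = normal_prob 0 1 A ;
  iid_indep : mutually_independent z }.

(* [normal_prob m 0] is not the point mass at [m] in the library. *)
Definition gaussian_rv (X : T -> R) : Prop :=
  measurable_fun setT X /\
  exists m s : R, forall A : set R, measurable A ->
    P (X @^-1` A) = if s == 0 then \d_m A else normal_prob m s A.

Definition gaussian_process (X : R -> T -> R) : Prop :=
  forall (n : nat) (t c : 'I_n -> R),
    gaussian_rv (fun w => \sum_(i < n) c i * X (t i) w).

Definition independent_processes (X Y : R -> T -> R) : Prop :=
  forall (m n : nat) (s : 'I_m -> R) (t : 'I_n -> R)
    (A : 'I_m -> set R) (B : 'I_n -> set R),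
    (forall i, measurable (A i)) -> (forall j, measurable (B j)) ->
    let EX := [set w | forall i, A i (X (s i) w)] in
    let EY := [set w | forall j, B j (Y (t j) w)] in
    P (EX `&` EY) = (P EX * P EY)%E.

(* Equality in law of complex processes: equal finite-dimensional
   distributions, tested on the boxes, which form a generating pi-system. *)
Definition same_law (X Y : R -> T -> R[i]) : Prop :=
  forall (n : nat) (t : 'I_n -> R) (A B : 'I_n -> set R),
    (forall i, measurable (A i)) -> (forall i, measurable (B i)) ->
    P [set w | forall i, A i (complex.Re (X (t i) w)) /\
                         B i (complex.Im (X (t i) w))] =
    P [set w | forall i, A i (complex.Re (Y (t i) w)) /\
                         B i (complex.Im (Y (t i) w))].

Definition kappa_partial (a : nat -> R) (H : nat -> {poly R})
    (zeta : nat -> T -> R) (n : nat) (t : R) (w : T) : R :=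
  (Num.sqrt (2 * pi))^-1 * expR (- (t ^+ 2 / 2)) *
  \sum_(k < n) a k * (Num.sqrt (k`!)%:R)^-1 * (H k).[t] * zeta k w.

(* The random series converges in mean square for every [t]; joint
   measurability makes the integrals of the sample paths meaningful. *)
Record is_kappa (a : nat -> R) (H : nat -> {poly R}) (zeta : nat -> T -> R)
    (kappa : R -> T -> R) : Prop := {
  kappa_measurable :
    measurable_fun [set: measurableTypeR R * T] (fun p => kappa p.1 p.2) ;
  kappa_series : forall t,
    (\int[P]_w ((kappa_partial a H zeta n t w - kappa t w) ^+ 2)%:E
       @[n --> \oo] --> 0)%E }.

Definition kappa_hat (kappa : R -> T -> R) (theta : R) (w : T) : R[i] :=
  fourier (kappa ^~ w) theta.

Definition Uproc (kappa : R -> T -> R) (theta : R) (w : T) : R[i] :=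
  fourier (even_part (kappa ^~ w)) theta.

Definition Vproc (kappa : R -> T -> R) (theta : R) (w : T) : R[i] :=
  ('i)%C * fourier (odd_part (kappa ^~ w)) theta.

(* [X] is the improper integral of [f] over the real line in mean square, both
   end points going to infinity independently. *)
Definition ms_improper_integral (f : R -> T -> R[i]) (X : T -> R[i]) : Prop :=
  ((\int[P]_w (normsq (cintegral `[- ST.1, ST.2]%classic (f ^~ w) - X w))%:E
     @[ST --> filter_prod (pinfty_nbhs R) (pinfty_nbhs R)]) --> 0)%E.

(* Up to sign, these are [a_j theta^j / sqrt j! * exp (- theta^2 / 2)] for
   [j = 2k], and the same without one factor [theta] for [j = 2k+1]; the factor
   [sqrt k!], without which the series do not represent the transforms, comes
   from [(2k)! = (2k-1)!! 2^k k!] and [(2k+1)! = (2k+1)!! 2^k k!]. *)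
Definition Ucoef (a : nat -> R) (theta : R) (k : nat) : R :=
  poisson k (theta ^+ 2 / 2) * Num.sqrt (k`!)%:R
    / Num.sqrt (dfact (2 * k + (k == 0) - 1))%:R
  * a (2 * k)%N * (- Num.sqrt 2) ^+ k.

Definition Vcoef (a : nat -> R) (theta : R) (k : nat) : R :=
  poisson k (theta ^+ 2 / 2) * Num.sqrt (k`!)%:R
    / Num.sqrt (dfact (2 * k + 1))%:R
  * a (2 * k + 1)%N * (- Num.sqrt 2) ^+ k.

End gaussian.

Definition moment {R : realType} {d : measure_display} {T : measurableType d}
    (P : probability T R) (Y : T -> R) (k : nat) : R :=
  fine 'E_P[fun w => Y w ^+ k].

(* Main.v *)
Require Import Defs.
From HB Require Import structures.
From mathcomp Require Import all_boot all_order all_algebra.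
From mathcomp Require Import finmap.
From mathcomp Require Import all_classical all_reals all_analysis.
From mathcomp Require Import measurable_realfun.
From mathcomp.real_closed Require Import complex.
From mathcomp Require Import ring lra zify.

Set Implicit Arguments.
Unset Strict Implicit.
Unset Printing Implicit Defensive.

Import Order.TTheory GRing.Theory Num.Theory.
Import numFieldNormedType.Exports.

Local Open Scope classical_set_scope.
Local Open Scope ring_scope.

(** Write [a k] for the [k]-th moment of [Y] and [z k] for the independent
    standard normal variables. The points of the process lie in [[-1, 1]], so
    [|Y| <= 1] almost surely; this gives [|a k| <= 1] and
    [|a (2m+1)| <= a (2m)].

    Why the series can be transformed term by term. The [k]-th term is
    [a k z k] times a normalised Hermite function. For even [k] the square
    [He_k(0)^2 / k!] equals the central binomial ratio [cbin (k/2)], and for all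
    [k] the squared norm of [He_k e^(-t^2/2) / sqrt k!], even with the weight
    [1 + t^2], and the squared moment [(int |t|^k e^(-t^2/2))^2 / k!] are at
    most a constant times [cbin (k/2)]. Convergence of the series at the single
    point [t = 0] therefore makes [rho k = a k ^ 2 * cbin (k/2)] summable
    ([rho_summable]), and this bounds the expected weighted norm
    [int (1 + t^2) |error|^2 dt] of the truncation error
    ([pathnorm_expectation]). By the Cauchy-Schwarz inequality
    ([weighted_l1]) this norm controls every bounded linear functional of the
    path, in particular its Fourier transform at every frequency at once
    ([bounded_functional_error]). The paths are thus integrable, and the
    transforms have mean square expansions whose coefficients come from
    [hermite_transform]: the transform of [He_k e^(-t^2/2)] is
    [sqrt (2 pi) (i theta)^k e^(-theta^2/2)].

    Why the strong representation holds. Since [z k = O(2^k)] almost surely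
    ([sequence_growth]), the transformed series converges absolutely for every
    [theta] on one event of probability one. Its sum is identified along the
    random subsequences on which the path norm tends to zero
    ([pathnorm_small], [trans_series]). The double factorials enter only by
    [(2k)! = (2k-1)!! 2^k k!] and [(2k+1)! = (2k+1)!! 2^k k!].

    Laws. A finite sum of the [b k z k] is normal because the Gaussian measure
    of the plane is invariant under rotations ([stdn_rotation],
    [iid_sum_law]), and normality passes to mean square limits
    ([ms_sum_gaussian]). The process [U] is a function of the [z k] with [k]
    even and [V] of those with [k] odd, whence their independence
    ([independent_UV]); changing the signs of the odd ones turns the transform
    [U - i V] into [U + i V] and keeps the law of the sequence
    ([same_law_UV]).

    Inversion. The truncated inverse integral is again a mean square series, so
    its distance to the value of the process is governed by the differences of
    coefficients. These are tails of Gaussian integrals ([tail]), each of which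
    tends to zero with the window and whose squares are dominated by
    [2 pi rho k]; the sum tends to zero by dominated convergence of series
    ([tail_series_cvg0]). *)

(** * Hermite polynomials and their generating function *)

Section hermite.
Context {R : realType}.

Fixpoint hermite (k : nat) : {poly R} :=
  if k is k'.+1 then 'X * hermite k' - (hermite k')^`() else 1.
Arguments hermite : simpl never.

Lemma hermiteS k : hermite k.+1 = 'X * hermite k - (hermite k)^`().
Proof. by []. Qed.

Lemma deriv_hermite k : (hermite k.+1)^`() = k.+1%:R *: hermite k.
Proof.
elim: k => [|k IH].
  by rewrite hermiteS /= derivB derivM derivX derivC deriv0 subr0 mulr0 addr0 scale1r mulr1.
rewrite hermiteS derivB derivM derivX mul1r IH derivZ -scalerAr -addrA -scalerBr.
by rewrite -hermiteS [in RHS]mulrSr addrC scalerDl scale1r.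
Qed.

Lemma horner_hermiteSS k t : (hermite k.+2).[t] =
  t * (hermite k.+1).[t] - k.+1%:R * (hermite k).[t].
Proof.
rewrite hermiteS deriv_hermite; move: (hermite k.+1) (hermite k) => p q.
by rewrite hornerD hornerN hornerM hornerX hornerZ.
Qed.

(** The factor [n + 1] produced by differentiation is at most [2 ^ (n + 1)], so
    doubling the radius absorbs it. *)
Lemma cvg_pseries_diffs (c : nat -> R) :
  (forall x, cvgn (pseries c x)) -> forall x, cvgn (pseries (pseries_diffs c) x).
Proof.
move=> hc x; apply: normed_cvg.
set y := 2 * (`|x| + 1).
have y0 : 0 < y by rewrite mulr_gt0// ltr_wpDl.
have : cvgn (series (fun n => `|c n| * y ^+ n)).
  apply: (@is_cvg_pseries_inside_norm _ c (y + 1)); first exact: hc.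
  by rewrite !gtr0_norm ?ltrDl// addr_gt0.
move=> /cvg_ex[l hl].
have : cvgn (series (fun n => `|c n.+1| * y ^+ n.+1)).
  apply/cvg_ex; exists (l - `|c 0%N|).
  have -> : series (fun n => `|c n.+1| * y ^+ n.+1) =
      (fun n => series (fun n => `|c n| * y ^+ n) n.+1 - `|c 0%N|).
    apply/funext => n; rewrite /series/= [in RHS]big_nat_recl//= expr0 mulr1.
    by rewrite addrC addKr.
  by apply: cvgB; [rewrite (cvg_shiftS (series _)) | exact: cvg_cst].
apply: series_le_cvg => [n|n|n].
- by rewrite normr_ge0.
- by rewrite mulr_ge0// exprn_ge0// ltW.
rewrite /= /pseries_diffs !normrM normr_nat mulrAC mulrC ler_wpM2l//.
rewrite /y exprMn; apply: ler_pM => //.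
  by rewrite -natrX ler_nat ltnW// ltn_expl.
rewrite normrX exprSr -[leLHS]mulr1 ler_pM ?exprn_ge0 ?lerDr//.
by rewrite lerXn2r ?nnegrE ?lerDl ?addr_ge0.
Qed.

(** The [k]-th formal derivative of the generating series sums to the [k]-th
    derivative of [w |-> exp (w t - w ^ 2 / 2)], which is [hermite k] at [t - w]
    times that exponential; at [w = 0] the series reduces to [H k]. *)
Lemma hermite_chebycheffE (H : nat -> {poly R}) : hermite_chebycheff H ->
  forall k t, (H k).[t] = (hermite k).[t].
Proof.
move=> hH k t.
pose c n : R := (H n).[t] / n`!%:R.
pose f w := expR (w * t - w ^+ 2 / 2).
have cvgc x : pseries c x @ \oo --> f x.
  suff -> : pseries c x = (fun n => \sum_(k < n) x ^+ k / (k`!)%:R * (H k).[t]) by exact: hH.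
  apply/funext => n.
  by rewrite /pseries /series/= big_mkord; apply: eq_bigr => i _; rewrite /c; ring.
have main m : (forall x, pseries (iter m (@pseries_diffs R) c) x @ \oo -->
                 (hermite m).[t - x] * f x) /\
              forall n, iter m (@pseries_diffs R) c n = c (n + m)%N * ((n + m) ^_ m)%:R.
  elim: m => [|m [IH1 IH2]].
    by split=> [x|n]; [rewrite hornerE mul1r; exact: cvgc|rewrite addn0 ffactn0 mulr1].
  split=> [x|n]; last first.
    rewrite iterS {1}/pseries_diffs IH2 addSnnS ffactnSr -addSnnS addSn.
    by rewrite -[in RHS]addSn addnK natrM; ring.
  have C0 y : cvgn (pseries (iter m (@pseries_diffs R) c) y).
    by apply/cvg_ex; eexists; exact: IH1.
  have C1 := cvg_pseries_diffs C0.
  have C2 := cvg_pseries_diffs C1.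
  have hx : `|x| < `| `|x| + 1|.
    by rewrite [ltRHS]ger0_norm ?ltrDl// addr_ge0.
  have := pseries_snd_diffs (C0 _) (C1 _) (C2 _) hx.
  rewrite (_ : (fun x0 : R => _) = (fun x => (hermite m).[t - x] * f x)); last first.
    by apply/funext => y; apply/cvg_lim => //; exact: IH1.
  move=> D1.
  have D2 : is_derive x 1 (fun x => (hermite m).[t - x] * f x)
     ((hermite m.+1).[t - x] * f x).
    rewrite hermiteS; move: (hermite m) => h.
    pose q := h \Po (t%:P - 'X).
    have -> : (fun x => h.[t - x] * f x) = (fun x => q.[x]) * f.
      by apply/funext => y; rewrite fctE /q horner_comp !hornerE.
    apply: is_derive_eq.
    rewrite /q deriv_comp derivB derivX derivC !hornerE horner_comp !hornerE /f.
    rewrite horner_comp !hornerE /GRing.scale/=.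
    by field.
  have /= := @derive_val _ _ _ _ _ _ _ D1; rewrite (@derive_val _ _ _ _ _ _ _ D2) => ->.
  exact: C1.
have [h1 h2] := main k.
have := h1 0; rewrite subr0 /f mul0r expr0n/= mul0r subr0 expR0 mulr1 => hlim.
have e : pseries (iter k (@pseries_diffs R) c) 0 @ \oo --> (H k).[t].
  rewrite -cvg_shiftS /pseries /series/=.
  rewrite (_ : (fun n : nat => _) = cst (H k).[t]); first exact: cvg_cst.
  apply/funext => n; rewrite big_nat_recl//= expr0 mulr1 big1 ?addr0; last first.
    by move=> i _; rewrite expr0n/= mulr0.
  by rewrite h2 add0n ffactnn /c divfK// pnatr_eq0 -lt0n fact_gt0.
by rewrite -(cvg_lim _ hlim)// (cvg_lim _ e).
Qed.

End hermite.

Arguments hermite {R} k : simpl never.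

(** * Integration over the line *)

Section real_line_integrals.
Context {R : realType}.
Notation mu := (@lebesgue_measure R).

Definition integrableR (f : R -> R) := mu.-integrable setT (EFin \o f).
Definition intR (f : R -> R) : R := \int[mu]_x f x.

Lemma measurable_integrableR f : integrableR f -> measurable_fun setT f.
Proof. by move=> /measurable_int /measurable_EFinP. Qed.

Lemma integrableRD f g : integrableR f -> integrableR g ->
  integrableR (fun x => f x + g x).
Proof. by move=> hf hg; exact: (integrableD measurableT hf hg). Qed.

Lemma integrableRZ k f : integrableR f -> integrableR (fun x => k * f x).
Proof. by move=> hf; exact: (integrableZl measurableT k hf). Qed.

Lemma integrableRB f g : integrableR f -> integrableR g ->
  integrableR (fun x => f x - g x).
Proof. by move=> hf hg; exact: (integrableB measurableT hf hg). Qed.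

Lemma integrableR_le (f g : R -> R) : measurable_fun setT f -> integrableR g ->
  (forall x, `|f x| <= g x) -> integrableR f.
Proof.
move=> mf ig fg; apply: (le_integrable measurableT _ _ ig).
  exact/measurable_EFinP.
by move=> x _ /=; rewrite lee_fin (le_trans (fg x))// ler_norm.
Qed.

Lemma integrableR_norm f : integrableR f -> integrableR (fun x => `|f x|).
Proof. by move=> hf; exact: (integrable_norm hf). Qed.

Lemma intR_add f g : integrableR f -> integrableR g ->
  intR (fun x => f x + g x) = intR f + intR g.
Proof. by move=> hf hg; rewrite /intR RintegralD. Qed.

Lemma intR_sub f g : integrableR f -> integrableR g ->
  intR (fun x => f x - g x) = intR f - intR g.
Proof. by move=> hf hg; rewrite /intR RintegralB. Qed.

Lemma intR_scale k f : integrableR f -> intR (fun x => k * f x) = k * intR f.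
Proof. by move=> hf; rewrite /intR RintegralZl. Qed.

Lemma intR_lincomb (g : nat -> R -> R) (c : nat -> R) n :
  (forall k, integrableR (g k)) ->
  integrableR (fun x => \sum_(k < n) g k x * c k) /\
  intR (fun x => \sum_(k < n) g k x * c k) = \sum_(k < n) intR (g k) * c k.
Proof.
move=> ig; elim: n => [|n [IH1 IH2]].
  rewrite (_ : (fun _ => _) = (fun x => 0 * g 0%N x)).
    by split; [exact: integrableRZ|rewrite intR_scale ?mul0r ?big_ord0].
  by apply/funext => x; rewrite big_ord0 mul0r.
rewrite (_ : (fun _ => _) = (fun x => \sum_(k < n) g k x * c k + c n * g n x)).
  have iZ := integrableRZ (c n) (ig n).
  by rewrite intR_add// intR_scale// IH2 big_ord_recr/= mulrC; split=> //; exact: integrableRD.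
by apply/funext => x; rewrite big_ord_recr/= [c n * _]mulrC.
Qed.

Lemma intR_opp f : integrableR f -> intR (fun x => - f x) = - intR f.
Proof.
move=> hf; rewrite -mulN1r -intR_scale//; congr intR.
by apply/funext => x; rewrite mulN1r.
Qed.

Lemma le_intR f g : integrableR f -> integrableR g -> (forall x, f x <= g x) ->
  intR f <= intR g.
Proof. by move=> hf hg fg; apply: le_Rintegral => // x _; exact: fg. Qed.

Lemma ler_norm_intR f : integrableR f -> `|intR f| <= intR (fun x => `|f x|).
Proof. by move=> hf; apply: le_normr_Rintegral. Qed.

Lemma integrable_bounded_mul (h f : R -> R) : measurable_fun setT h ->
  (forall t, `|h t| <= 1) -> integrableR f -> integrableR (fun t => h t * f t).
Proof.
move=> mh h1 fi; apply: (integrableR_le _ (integrableR_norm fi)).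
  by apply: measurable_funM => //; exact: measurable_integrableR.
by move=> t; rewrite normrM ler_piMl.
Qed.

Lemma EFin_intR f : integrableR f -> (intR f)%:E = (\int[mu]_x (f x)%:E)%E.
Proof. by move=> hf; rewrite /intR /Rintegral fineK// integrable_fin_num. Qed.

Lemma intR_ge0 f : (forall x, 0 <= f x) -> 0 <= intR f.
Proof. by move=> f0; apply: Rintegral_ge0. Qed.

Lemma measurable_oppR : measurable_fun setT (fun x : R => - x).
Proof. exact: oppr_measurable. Qed.

Lemma integral_reflect (f : R -> \bar R) : measurable_fun [set: R] f ->
  (forall x, 0 <= f x)%E -> (\int[mu]_x f (- x)%R = \int[mu]_x f x)%E.
Proof.
move=> mf f0.
have := @ge0_integral_pushforward _ _ (measurableTypeR R) (measurableTypeR R)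
  R -%R measurable_oppR mu setT f measurableT mf.
rewrite preimage_setT => <-//.
by apply: eq_measure_integral => A mA _; exact: lebesgue_measureN.
Qed.

Lemma integrableR_reflect f : integrableR f -> integrableR (fun x => f (- x)).
Proof.
move=> hf; have mf := measurable_integrableR hf.
apply/integrableP; split.
  by apply/measurable_EFinP; apply: measurableT_comp => //; exact: measurable_oppR.
rewrite (@integral_reflect (fun x => `|(EFin \o f) x|)%E)//.
  by case/integrableP : hf.
by apply: measurableT_comp => //; exact/measurable_EFinP.
Qed.

Lemma intR_reflect f : integrableR f -> intR (fun x => f (- x)) = intR f.
Proof.
move=> hf; have mf := measurable_integrableR hf.
have mf' := measurable_int _ hf.
have := @integral_pushforward _ _ (measurableTypeR R) (measurableTypeR R)
  R -%R measurable_oppR mu setT (EFin \o f) mf'.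
rewrite preimage_setT => /(_ (integrableR_reflect hf) measurableT) E.
rewrite /intR /Rintegral; congr fine; apply: etrans (esym E) _.
by apply: eq_measure_integral => A mA _; exact: lebesgue_measureN.
Qed.

Lemma intR_odd f : integrableR f -> (forall x, f (- x) = - f x) -> intR f = 0.
Proof.
move=> hf odd; have := intR_reflect hf.
under [X in intR X]eq_fun do rewrite odd.
by rewrite intR_opp// => /eqP; rewrite eq_sym -subr_eq0 opprK -mulr2n mulrn_eq0/= => /eqP.
Qed.

(** The weight by which the Cauchy-Schwarz inequality turns weighted square
    integrability into integrability. *)
Lemma integrable_invonesqr : integrableR (fun x => (1 + x ^+ 2)^-1) /\
  intR (fun x => (1 + x ^+ 2)^-1) = pi.
Proof.
have h : (\int[mu]_x ((1 + x ^+ 2)^-1)%:E = pi%:E)%E.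
  rewrite (ge0_symfun_integralT (f := fun x => (1 + x ^+ 2)^-1)) => [|x||x].
  - rewrite (_ : [set x | _] = `[0, +oo[%classic); last first.
      by apply/seteqP; split => x/=; rewrite in_itv/= andbT.
    by rewrite integral0y_oneDsqr -EFinM mulrCA divff// mulr1.
  - by rewrite invr_ge0 addr_ge0// sqr_ge0.
  - exact: continuous_oneDsqrV.
  - by rewrite /= sqrrN.
have hi : integrableR (fun x => (1 + x ^+ 2)^-1).
  apply/integrableP; split.
    apply/measurable_EFinP; apply: continuous_measurable_fun; exact: continuous_oneDsqrV.
  under eq_integral do rewrite /= ger0_norm ?invr_ge0 ?addr_ge0 ?sqr_ge0//.
  by rewrite h ltry.
by split => //; rewrite /intR /Rintegral h.
Qed.

(** Exhaust the line by the intervals [[-n, n]], where the fundamental theorem of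
    calculus applies, and pass to the limit by dominated convergence. *)
Lemma intR_derivative (F f : R -> R) :
  (forall x, is_derive x (1 : R) F (f x)) -> continuous f -> integrableR f ->
  (fun n => F n%:R) @ \oo --> 0 -> (fun n => F (- n%:R)) @ \oo --> 0 ->
  intR f = 0.
Proof.
move=> dF cf fi F1 F2.
pose I n : set R := `[- n%:R, n%:R]%classic.
have mI n : measurable (I n) by exact: measurable_itv.
have mf_ n : measurable_fun [set: R] ((EFin \o f) \_ (I n)).
  apply/(measurable_restrictT _ (mI n)); apply/measurable_funTS.
  exact: measurable_int fi.
have cvg_ : {ae mu, forall x, [set: R] x ->
    ((EFin \o f) \_ (I n)) x @[n --> \oo] --> (EFin \o f) x}.
  apply: aeW => x _; apply: cvg_near_cst; near=> n.
  rewrite patchE ifT// inE /I/= in_itv/= -ler_norml.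
  near: n; exact: nbhs_infty_ger.
have dom_ : {ae mu, forall x n, [set: R] x ->
    (`|((EFin \o f) \_ (I n)) x| <= (abse \o (EFin \o f)) x)%E}.
  by apply: aeW => x n _; rewrite patchE; case: ifP => // _; rewrite abse0 abse_ge0.
have [_ _] := @dominated_convergence _ _ _ mu setT measurableT _ _ _ mf_ (measurable_int _ fi) cvg_
  (integrable_abse fi) dom_.
rewrite /=.
have -> : (fun n => \int[mu]_x ((EFin \o f) \_ (I n)) x)%E =
    (fun n => (F n%:R - F (- n%:R))%:E).
  apply/funext => n; rewrite -integral_mkcond.
  have [->|n0] := eqVneq n 0%N.
    by rewrite /I oppr0 set_itv1 integral_set1 subrr.
  rewrite (@continuous_FTC2 _ f F)//.
  - by rewrite gtrN// ltr0n lt0n.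
  - exact: continuous_subspaceT.
  - split.
    + by move=> x _; have [] := dF x.
    + apply: cvg_at_right_filter; apply/differentiable_continuous/derivable1_diffP.
      by have [] := dF (- n%:R).
    + apply: cvg_at_left_filter; apply/differentiable_continuous/derivable1_diffP.
      by have [] := dF n%:R.
  - by move=> x _; rewrite derive1E; have [_ ->] := dF x.
have h0 : (fun n => (F n%:R - F (- n%:R))%:E) @ \oo --> 0%E.
  apply: cvg_EFin; first exact: nearW.
  have h := cvgB F1 F2; rewrite subr0 in h; exact: h.
move=> H; apply: EFin_inj; rewrite EFin_intR//.
exact: (cvg_unique _ H h0).
Unshelve. all: by end_near.
Qed.

End real_line_integrals.

(** * Fourier transforms of polynomials times a Gaussian *)

Section gaussian_integrals.
Context {R : realType}.
Notation mu := (@lebesgue_measure R).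
Implicit Types (p q : {poly R}) (c t theta : R).

Definition gexp c t := expR (- (c * t ^+ 2 / 2)).

Lemma gexp_ge0 c t : 0 <= gexp c t. Proof. exact: expR_ge0. Qed.

Lemma is_derive_gexp c t : is_derive t 1 (gexp c) (- (c * t) * gexp c t).
Proof.
rewrite /gexp.
have -> : (fun t => expR (- (c * t ^+ 2 / 2))) = (fun t => expR ((- (c / 2))%:P * 'X^2).[t]).
  by apply/funext => s; rewrite hornerM hornerC hornerXn; congr expR; field.
apply: is_derive_eq.
rewrite derivM derivC mul0r add0r derivXn expr1 (hornerM _ ('X *+ 2)) hornerC hornerMn hornerX.
by rewrite hornerM hornerC hornerXn /GRing.scale/= [RHS]mulrC; congr (expR _ * _); field.
Qed.

Lemma continuous_gexp c : continuous (gexp c).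
Proof.
move=> t; apply/differentiable_continuous/derivable1_diffP.
by have [] := is_derive_gexp c t.
Qed.

(** The exponential series gives [u ^ k <= k! exp u] at [u = c t ^ 2 / 2]; this
    bounds even powers, which in turn dominate the odd ones up to [1]. *)
Lemma monomial_gexp_bounded c k : 0 < c ->
  forall t, `|t| ^+ k * gexp c t <= 1 + (2 / c) ^+ k * k`!%:R.
Proof.
move=> c0 t.
have u0 : 0 <= c * t ^+ 2 / 2 by rewrite divr_ge0// mulr_ge0 ?sqr_ge0// ltW.
have hu : (c * t ^+ 2 / 2) ^+ k <= k`!%:R * expR (c * t ^+ 2 / 2).
  case: k => [|k]; first by rewrite expr0 mul1r (le_trans _ (expR_ge1Dx _))// lerDl.
  rewrite [leRHS]mulrC -ler_pdivrMr ?ltr0n ?fact_gt0//.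
  by rewrite (le_trans _ (expR_ge1Dxn k u0))// lerDr.
have h1 : `|t| ^+ k <= 1 + (t ^+ 2) ^+ k.
  have [t1|t1] := leP `|t| 1.
    by rewrite (le_trans (y := 1)) ?exprn_ile1// lerDl exprn_ge0// sqr_ge0.
  rewrite -[t ^+ 2]ger0_norm ?sqr_ge0// normrX -exprM mulnC muln2 -addnn exprD.
  rewrite (le_trans (y := `|t| ^+ k * `|t| ^+ k)) ?lerDr// ler_peMr ?exprn_ge0//.
  by rewrite exprn_ege1// ltW.
have h2 : (t ^+ 2) ^+ k <= (2 / c) ^+ k * k`!%:R * expR (c * t ^+ 2 / 2).
  have -> : (t ^+ 2) ^+ k = (2 / c) ^+ k * (c * t ^+ 2 / 2) ^+ k.
    by rewrite -exprMn; congr (_ ^+ _); field; rewrite gt_eqF.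
  rewrite -[leRHS]mulrA; apply: ler_wpM2l => //; by rewrite exprn_ge0// divr_ge0// ltW.
rewrite /gexp expRN ler_pdivrMr ?expR_gt0//.
rewrite (le_trans h1)// [leRHS]mulrDl mul1r lerD//.
by rewrite (le_trans _ (expR_ge1Dx _))// lerDl.
Qed.

(** One majorant, decaying like [1 / (1 + t ^ 2)], yields both integrability and
    the vanishing boundary terms of the integrations by parts. *)
Lemma poly_gexp_decay c p : 0 < c ->
  exists2 C, 0 <= C & forall t, `|p.[t] * gexp c t| <= C * (1 + t ^+ 2)^-1.
Proof.
move=> c0; pose q := p * (1 + 'X^2).
exists (\sum_(i < size q) `|q`_i| * (1 + (2 / c) ^+ i * i`!%:R)).
  by apply: sumr_ge0 => i _; rewrite mulr_ge0// addr_ge0// mulr_ge0// exprn_ge0// divr_ge0// ltW.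
move=> t; rewrite ler_pdivlMr; last by rewrite ltr_pwDl// sqr_ge0.
have -> : `|p.[t] * gexp c t| * (1 + t ^+ 2) = `|q.[t]| * gexp c t.
  rewrite /q !hornerE !normrM (ger0_norm (gexp_ge0 _ _)).
  rewrite (ger0_norm (_ : 0 <= 1 + t ^+ 2)); first by ring.
  by rewrite addr_ge0// sqr_ge0.
rewrite horner_coef (le_trans (ler_wpM2r (gexp_ge0 _ _) (ler_norm_sum _ _ _)))//.
rewrite mulr_suml ler_sum// => i _.
rewrite normrM normrX -mulrA ler_wpM2l//.
exact: monomial_gexp_bounded.
Qed.

Lemma continuous_horner p : continuous (fun t => p.[t]).
Proof.
move=> t; apply/differentiable_continuous/derivable1_diffP; exact: ex_derive.
Qed.

Lemma measurable_poly_gexp c p : measurable_fun setT (fun t : R => p.[t] * gexp c t).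
Proof.
apply: measurable_funM; apply: continuous_measurable_fun;
  [exact: continuous_horner|exact: continuous_gexp].
Qed.

Lemma integrable_poly_gexp c p (h : R -> R) : 0 < c -> measurable_fun setT h ->
  (forall t, `|h t| <= 1) -> integrableR (fun t => p.[t] * gexp c t * h t).
Proof.
move=> c0 mh h1; have [C C0 hC] := poly_gexp_decay p c0.
apply: (integrableR_le (g := fun t => C * (1 + t ^+ 2)^-1)).
- by apply: measurable_funM => //; exact: measurable_poly_gexp.
- by apply: integrableRZ; exact: (integrable_invonesqr).1.
- move=> t; rewrite normrM (le_trans _ (hC t))//.
  by rewrite -[leRHS]mulr1 ler_wpM2l.
Qed.

Lemma poly_gexp_cvg0 c p (h : R -> R) (u : nat -> R) : 0 < c ->
  (forall t, `|h t| <= 1) -> (forall n, `|u n| = n%:R) ->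
  (fun n => p.[u n] * gexp c (u n) * h (u n)) @ \oo --> 0.
Proof.
move=> c0 h1 un; have [C C0 hC] := poly_gexp_decay p c0.
apply: norm_cvg0.
apply: (@squeeze_cvgr _ _ _ _ (cst 0) (fun n => C * (n.+1%:R)^-1 * 2)).
- apply: nearW => n; rewrite /= normr_ge0/= normrM.
  rewrite (le_trans (ler_wpM2l _ (h1 _)))// mulr1 (le_trans (hC _))// -mulrA ler_wpM2l//.
  rewrite -[u n ^+ 2]ger0_norm ?sqr_ge0// normrX un.
  rewrite -[X in X <= _]mul1r ler_pdivrMr; last by rewrite ltr_pwDl// sqr_ge0.
  rewrite -mulrA mulrC ler_pdivlMr ?ltr0n// mul1r -natr1.
  have : 0 <= (n%:R : R) by [].
  by move: (n%:R) => x x0; nra.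
- exact: cvg_cst.
- rewrite (_ : 0 = C * 0 * 2); last by rewrite mulr0 mul0r.
  by apply: cvgMl; apply: cvgMr; exact: cvg_harmonic.
Qed.

Lemma continuous_cosM theta : continuous (fun t : R => cos (theta * t)).
Proof.
by move=> t; apply/differentiable_continuous/derivable1_diffP; exact: ex_derive.
Qed.

Lemma continuous_sinM theta : continuous (fun t : R => sin (theta * t)).
Proof.
by move=> t; apply/differentiable_continuous/derivable1_diffP; exact: ex_derive.
Qed.

Lemma measurable_cosM theta : measurable_fun setT (fun t : R => cos (theta * t)).
Proof. by apply: continuous_measurable_fun; exact: continuous_cosM. Qed.

Lemma measurable_sinM theta : measurable_fun setT (fun t : R => sin (theta * t)).
Proof. by apply: continuous_measurable_fun; exact: continuous_sinM. Qed.

Lemma continuous_poly_gexp c p (h : R -> R) : continuous h ->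
  continuous (fun t => p.[t] * gexp c t * h t).
Proof.
move=> ch t; apply: cvgM; last exact: ch.
by apply: cvgM; [exact: continuous_horner|exact: continuous_gexp].
Qed.

Lemma cos_le1 (x : R) : `|cos x| <= 1.
Proof. by rewrite ler_norml cos_geN1 cos_le1. Qed.

Lemma sin_le1 (x : R) : `|sin x| <= 1.
Proof. by rewrite ler_norml sin_geN1 sin_le1. Qed.

(** Real and imaginary parts of the Fourier transform of [p(t) e^(-c t^2/2)]. *)
Definition gcos c p theta := intR (fun t => p.[t] * gexp c t * cos (theta * t)).
Definition gsin c p theta := intR (fun t => p.[t] * gexp c t * sin (theta * t)).

Lemma integrable_gcos c p theta : 0 < c ->
  integrableR (fun t => p.[t] * gexp c t * cos (theta * t)).
Proof.
by move=> c0; apply: integrable_poly_gexp => // [|t]; [exact: measurable_cosM|exact: cos_le1].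
Qed.

Lemma integrable_gsin c p theta : 0 < c ->
  integrableR (fun t => p.[t] * gexp c t * sin (theta * t)).
Proof.
by move=> c0; apply: integrable_poly_gexp => // [|t]; [exact: measurable_sinM|exact: sin_le1].
Qed.

Section linearity.
Variables (c : R) (c0 : 0 < c) (theta : R).

Lemma gcosD p q : gcos c (p + q) theta = gcos c p theta + gcos c q theta.
Proof.
rewrite /gcos -intR_add; [|exact: integrable_gcos..].
by congr intR; apply/funext => t; rewrite hornerD !mulrDl.
Qed.

Lemma gcosZ k p : gcos c (k *: p) theta = k * gcos c p theta.
Proof.
rewrite /gcos -intR_scale; last exact: integrable_gcos.
by congr intR; apply/funext => t; rewrite hornerZ !mulrA.
Qed.

Lemma gcosB p q : gcos c (p - q) theta = gcos c p theta - gcos c q theta.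
Proof. by rewrite gcosD -scaleN1r gcosZ mulN1r. Qed.

Lemma gsinD p q : gsin c (p + q) theta = gsin c p theta + gsin c q theta.
Proof.
rewrite /gsin -intR_add; [|exact: integrable_gsin..].
by congr intR; apply/funext => t; rewrite hornerD !mulrDl.
Qed.

Lemma gsinZ k p : gsin c (k *: p) theta = k * gsin c p theta.
Proof.
rewrite /gsin -intR_scale; last exact: integrable_gsin.
by congr intR; apply/funext => t; rewrite hornerZ !mulrA.
Qed.

Lemma gsinB p q : gsin c (p - q) theta = gsin c p theta - gsin c q theta.
Proof. by rewrite gsinD -scaleN1r gsinZ mulN1r. Qed.

(** Integration by parts: [p' - c X p] is the polynomial factor of the derivative
    of [p(t) e^(-c t^2/2)]. At [theta = 0] these identities also compute Gaussian
    moments. *)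
Lemma gcos_parts p :
  gcos c (p^`() - c *: ('X * p)) theta = theta * gsin c p theta.
Proof.
apply/eqP; rewrite -subr_eq0 /gsin -intR_scale; last exact: integrable_gsin.
rewrite /gcos -intR_sub; [|exact: integrable_gcos|by apply: integrableRZ; exact: integrable_gsin].
apply/eqP; apply: (intR_derivative (F := fun t => p.[t] * gexp c t * cos (theta * t))).
- move=> t; have := is_derive_gexp c t => hg.
  have -> : (fun t => p.[t] * gexp c t * cos (theta * t)) =
    (fun t => p.[t]) * gexp c * (fun t => cos (theta * t)) by [].
  apply: is_derive_eq; rewrite hornerD hornerN hornerZ hornerM hornerX /GRing.scale/= !fctE.
  by ring.
- move=> t; apply: cvgB => /=; first exact/continuous_poly_gexp/continuous_cosM.
  apply: cvgMr; exact/continuous_poly_gexp/continuous_sinM.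
- apply: integrableRB; first exact: integrable_gcos.
  by apply: integrableRZ; exact: integrable_gsin.
- apply: (@poly_gexp_cvg0 c p (fun t => cos (theta * t)) (fun n => n%:R)) => // [t|n].
    exact: cos_le1.
  by rewrite normr_nat.
- apply: (@poly_gexp_cvg0 c p (fun t => cos (theta * t)) (fun n => - n%:R)) => // [t|n].
    exact: cos_le1.
  by rewrite normrN normr_nat.
Qed.

Lemma gsin_parts p :
  gsin c (p^`() - c *: ('X * p)) theta = - theta * gcos c p theta.
Proof.
apply/eqP; rewrite mulNr -addr_eq0 /gcos -intR_scale; last exact: integrable_gcos.
rewrite /gsin -intR_add; [|exact: integrable_gsin|by apply: integrableRZ; exact: integrable_gcos].
apply/eqP; apply: (intR_derivative (F := fun t => p.[t] * gexp c t * sin (theta * t))).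
- move=> t; have := is_derive_gexp c t => hg.
  have -> : (fun t => p.[t] * gexp c t * sin (theta * t)) =
    (fun t => p.[t]) * gexp c * (fun t => sin (theta * t)) by [].
  apply: is_derive_eq; rewrite hornerD hornerN hornerZ hornerM hornerX /GRing.scale/= !fctE.
  by ring.
- move=> t; apply: cvgD => /=; first exact/continuous_poly_gexp/continuous_sinM.
  apply: cvgMr; exact/continuous_poly_gexp/continuous_cosM.
- apply: integrableRD; first exact: integrable_gsin.
  by apply: integrableRZ; exact: integrable_gcos.
- apply: (@poly_gexp_cvg0 c p (fun t => sin (theta * t)) (fun n => n%:R)) => // [t|n].
    exact: sin_le1.
  by rewrite normr_nat.
- apply: (@poly_gexp_cvg0 c p (fun t => sin (theta * t)) (fun n => - n%:R)) => // [t|n].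
    exact: sin_le1.
  by rewrite normrN normr_nat.
Qed.

End linearity.

End gaussian_integrals.

Section hermite_integrals.
Context {R : realType}.
Notation mu := (@lebesgue_measure R).
Implicit Types (p q : {poly R}) (c t theta : R).

Lemma gexp0 c : gexp c (0 : R) = 1.
Proof. by rewrite /gexp expr0n/= mulr0 mul0r oppr0 expR0. Qed.

Lemma gcos0E c p : gcos c p 0 = intR (fun t => p.[t] * gexp c t).
Proof. by rewrite /gcos; congr intR; apply/funext => t; rewrite mul0r cos0 mulr1. Qed.

Lemma integrable_gcos0 c p : 0 < c -> integrableR (fun t => p.[t] * gexp c t).
Proof.
move=> c0; have := integrable_gcos p 0 c0.
by congr integrableR; apply/funext => t; rewrite mul0r cos0 mulr1.
Qed.

Lemma gcos1_0 : gcos 1 1 (0 : R) = Num.sqrt (2 * pi).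
Proof.
have s0 : 0 < Num.sqrt (2 * pi) :> R by rewrite sqrtr_gt0 mulr_gt0// pi_gt0.
have h : intR (normal_pdf (0 : R) 1) = 1.
  by rewrite /intR /Rintegral integral_normal_pdf.
rewrite gcos0E.
have -> : (fun t : R => (1 : {poly R}).[t] * gexp 1 t) =
   (fun t => Num.sqrt (2 * pi) * normal_pdf 0 1 t).
  apply/funext => t; rewrite normal_pdfE ?oner_eq0// hornerC mul1r /normal_peak /normal_fun /gexp.
  by rewrite !expr1n !mul1r -(mulr_natl pi 2) mulrA divff ?gt_eqF// mul1r subr0 mulNr.
by rewrite intR_scale ?h ?mulr1//; exact: integrable_normal_pdf.
Qed.

Lemma gcos2_0 : gcos 2 1 (0 : R) = Num.sqrt pi.
Proof.
rewrite gcos0E (_ : (fun _ => _) = gauss_fun).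
  by rewrite /intR /Rintegral integralT_gauss.
apply/funext => t; rewrite hornerC mul1r /gexp /gauss_fun.
by rewrite mulrAC divff ?mul1r// pnatr_eq0.
Qed.

Lemma gsinX theta : gsin 1 'X theta = theta * gcos 1 1 theta.
Proof.
have := gsin_parts ltr01 theta (1 : {poly R}).
rewrite derivC scale1r mulr1 sub0r -scaleN1r gsinZ// => h.
by rewrite -[LHS]mul1r -[X in X * _]opprK mulNr h mulNr opprK.
Qed.

(** Differentiation under the integral produces [- gsin 1 'X], which integration
    by parts turns back into the function itself. *)
Lemma is_derive_gcos1 theta :
  is_derive theta (1 : R) (gcos 1 1) (- theta * gcos 1 1 theta).
Proof.
pose f (x t : R) : R := (1 : {poly R}).[t] * gexp 1 t * cos (x * t).
have df x t : is_derive x (1 : R) (f ^~ t) (- (('X : {poly R}).[t] * gexp 1 t * sin (x * t))).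
  by apply: is_derive_eq; rewrite /GRing.scale/= hornerX hornerC; ring.
have ht : `]theta - 1, theta + 1[%classic theta.
  by rewrite /= in_itv/= gtrBl ltr01 ltrDl ltr01.
have intf x : `]theta - 1, theta + 1[%classic x -> mu.-integrable setT (EFin \o f x).
  by move=> _; exact: integrable_gcos.
have der x y : `]theta - 1, theta + 1[%classic x -> setT y -> derivable (f ^~ y) x 1.
  by move=> _ _; have [] := df x y.
pose G t : R := `|('X : {poly R}).[t] * gexp 1 t|.
have G0 y : 0 <= G y by exact: normr_ge0.
have iG : mu.-integrable setT (EFin \o G).
  by apply: integrableR_norm; exact: integrable_gcos0.
have Gub x y : `]theta - 1, theta + 1[%classic x -> setT y ->
    `|partial1of2 f x y| <= G y.
  move=> _ _; rewrite partial1of2E; have [_ ->] := df x y.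
  by rewrite normrN normrM -[leRHS]mulr1 ler_wpM2l// sin_le1.
have D1 := derivable_under_integral measurableT ht intf der G0 iG Gub.
have D2 := differentiation_under_integral measurableT ht intf der G0 iG Gub.
apply: DeriveDef; first exact: D1.
rewrite -derive1E; apply: etrans D2 _.
rewrite mulNr -gsinX /gsin -intR_opp; last exact: integrable_gsin.
by apply: eq_Rintegral => y _; rewrite partial1of2E; have [_ ->] := df theta y.
Qed.

(** Both sides solve [g' = - theta g] and agree at [0]. *)
Lemma gcos1E theta : gcos 1 1 theta = Num.sqrt (2 * pi) * gexp 1 theta.
Proof.
pose g x : R := gcos 1 1 x * gexp (-1) x.
have dg x : is_derive x (1 : R) g 0.
  have := is_derive_gexp (-1) x; have := is_derive_gcos1 x => h1 h2.
  have -> : g = gcos 1 1 * gexp (-1) by [].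
  by apply: is_derive_eq; rewrite /GRing.scale/=; ring.
have := is_derive_0_is_cst theta 0 dg; rewrite /g gexp0 mulr1 gcos1_0 => <-.
rewrite -mulrA -expRD (_ : _ + _ = 0) ?expR0 ?mulr1//.
by field.
Qed.

Lemma gsin1E theta : gsin 1 1 theta = 0.
Proof.
apply: intR_odd => [|t]; first exact: integrable_gsin.
by rewrite !hornerC /gexp sqrrN mulrN sinN mulrN.
Qed.

(** Real and imaginary parts of the powers of the imaginary unit. *)
Fixpoint reim_pow_i (k : nat) : R * R :=
  if k is k'.+1 then (- (reim_pow_i k').2, (reim_pow_i k').1) else (1, 0).
Definition re_i k := (reim_pow_i k).1.
Definition im_i k := (reim_pow_i k).2.

Lemma re_iS k : re_i k.+1 = - im_i k. Proof. by []. Qed.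
Lemma im_iS k : im_i k.+1 = re_i k. Proof. by []. Qed.
Lemma re_i0 : re_i 0 = 1. Proof. by []. Qed.
Lemma im_i0 : im_i 0 = 0. Proof. by []. Qed.

Lemma reim_even m : re_i m.*2 = (-1) ^+ m /\ im_i m.*2 = 0.
Proof.
elim: m => [//|m [h1 h2]]; rewrite doubleS !re_iS !im_iS re_iS h1 h2.
by rewrite oppr0 exprS mulN1r.
Qed.

Lemma reim_odd m : re_i m.*2.+1 = 0 /\ im_i m.*2.+1 = (-1) ^+ m.
Proof. by have [h1 h2] := reim_even m; rewrite re_iS im_iS h1 h2 oppr0. Qed.

Lemma reim_le1 k : `|re_i k| <= 1 /\ `|im_i k| <= 1.
Proof.
elim: k => [|k [h1 h2]]; first by rewrite re_i0 im_i0 normr1 normr0.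
by rewrite re_iS im_iS normrN.
Qed.

(** As [He_(k+1) e^(-t^2/2) = - (He_k e^(-t^2/2))'], each step multiplies the
    transform by [i theta]. *)
Lemma hermite_transform k theta :
  gcos 1 (hermite k) theta = re_i k * theta ^+ k * (Num.sqrt (2 * pi) * gexp 1 theta) /\
  gsin 1 (hermite k) theta = im_i k * theta ^+ k * (Num.sqrt (2 * pi) * gexp 1 theta).
Proof.
elim: k => [|k [IH1 IH2]].
  by rewrite re_i0 im_i0 expr0 !mul1r !mul0r gcos1E gsin1E.
have e : hermite k.+1 = -1 *: ((hermite k)^`() - 1 *: ('X * hermite k)) :> {poly R}.
  by rewrite hermiteS scale1r scaleN1r opprB.
rewrite e gcosZ// gsinZ// gcos_parts// gsin_parts// IH1 IH2 re_iS im_iS exprS.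
by split; ring.
Qed.

(** The inverse transform of [(i theta) ^ k exp (- theta ^ 2 / 2)] obeys the
    three-term recurrence of the Hermite polynomials. *)
Lemma hermite_inverse k t :
  re_i k * gcos 1 'X^k t + im_i k * gsin 1 'X^k t =
    Num.sqrt (2 * pi) * ((hermite k).[t] * gexp 1 t) /\
  im_i k * gcos 1 'X^k t - re_i k * gsin 1 'X^k t = 0.
Proof.
pose D k := re_i k * gcos 1 'X^k t + im_i k * gsin 1 'X^k t.
pose E k := im_i k * gcos 1 'X^k t - re_i k * gsin 1 'X^k t.
have DE0 : D 0%N = Num.sqrt (2 * pi) * gexp 1 t /\ E 0%N = 0.
  rewrite /D /E re_i0 im_i0 expr0 gcos1E gsin1E.
  by split; ring.
have rec n : D n.+1 = t * D n - n%:R * D n.-1 /\ E n.+1 = t * E n - n%:R * E n.-1.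
  have := gcos_parts ltr01 t ('X^n : {poly R}).
  have := gsin_parts ltr01 t ('X^n : {poly R}).
  rewrite derivXn scale1r -exprS gcosB// gsinB// -scaler_nat gcosZ// gsinZ//.
  case: n => [|n] hs hc.
    rewrite /D /E re_iS im_iS re_i0 im_i0.
    rewrite !mul0r !sub0r in hs hc *.
    by split; lra.
  rewrite /D /E /= !re_iS !im_iS.
  move: hs hc; set a := gsin 1 'X^(n.+2) t; set b := gcos 1 'X^(n.+2) t => hs hc; rewrite re_iS.
  change (n.+1.-1) with n in hs; change (n.+1.-1) with n in hc.
  have -> : a = n.+1%:R * gsin 1 'X^n t + t * gcos 1 'X^(n.+1) t by lra.
  have -> : b = n.+1%:R * gcos 1 'X^n t - t * gsin 1 'X^(n.+1) t by lra.
  by split; ring.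
suff : (D k = Num.sqrt (2 * pi) * ((hermite k).[t] * gexp 1 t) /\ E k = 0) /\
       (D k.+1 = Num.sqrt (2 * pi) * ((hermite k.+1).[t] * gexp 1 t) /\ E k.+1 = 0).
  by case.
elim: k => [|k [[h1 h2] [h3 h4]]].
  have [d e] := DE0; have [d1 e1] := rec 0%N.
  have h0 : hermite 0 = 1 :> {poly R} by [].
  have h1 : hermite 1 = 'X :> {poly R} by rewrite (hermiteS 0) h0 derivC mulr1 subr0.
  rewrite d1 e1 d e h0 h1 hornerX hornerC.
  by split; split; ring.
split=> //; have [-> ->] := rec k.+1; rewrite /= h1 h2 h3 h4.
rewrite horner_hermiteSS.
by split; ring.
Qed.

End hermite_integrals.

(** * Norms of Hermite functions and Gaussian moments *)

Section hermite_norms.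
Context {R : realType}.
Implicit Types (p q : {poly R}).

(** The ratio ['C(2k, k) / 4 ^ k], to which all three sizes below reduce: the
    Hermite polynomials at the origin, their square norms, and the absolute
    Gaussian moments. *)
Fixpoint cbin (k : nat) : R :=
  if k is k'.+1 then cbin k' * ((2 * k'%:R + 1) / (2 * k'%:R + 2)) else 1.

Lemma cbinS k : cbin k.+1 = cbin k * ((2 * k%:R + 1) / (2 * k%:R + 2)).
Proof. by []. Qed.

Lemma cbin_ge0 k : 0 <= cbin k.
Proof.
elim: k => [|k IH]; rewrite ?ler01// cbinS mulr_ge0// divr_ge0// addr_ge0// mulr_ge0//.
Qed.

Lemma double2_neq0 k : 2 * k%:R + 2 != 0 :> R.
Proof. by rewrite gt_eqF// ltr_wpDl// mulr_ge0. Qed.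

Lemma fact_doubleS m :
  (m.+1.*2)`!%:R = (2 * m%:R + 2) * (2 * m%:R + 1) * (m.*2)`!%:R :> R.
Proof. by rewrite doubleS !factS !natrM -!natr1 -muln2 natrM; ring. Qed.

Lemma cbin_anti m n : (m <= n)%N -> cbin n <= cbin m.
Proof.
move=> /subnK <-; elim: (n - m)%N => [//|k IH].
apply: le_trans IH; rewrite addSn cbinS ler_piMr ?cbin_ge0//.
by rewrite ler_pdivrMr ?mul1r ?lerD2l ?ler1n// ltr_wpDl// mulr_ge0.
Qed.

(** At the origin the three-term recurrence loses its middle term. *)
Lemma hermite_at0 m : (hermite m.*2 : {poly R}).[0] ^+ 2 = (m.*2)`!%:R * cbin m.
Proof.
elim: m => [|m IH]; first by rewrite hornerC expr1n mul1r.
have -> : (hermite m.+1.*2 : {poly R}).[0] = - (m.*2.+1%:R * (hermite m.*2).[0]).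
  by rewrite doubleS horner_hermiteSS mul0r add0r.
rewrite sqrrN exprMn IH cbinS fact_doubleS -natr1 -muln2 natrM.
by field; exact: double2_neq0.
Qed.

Lemma gcos2_parts p : gcos 2 (p^`() - 2 *: ('X * p)) 0 = 0.
Proof. by rewrite gcos_parts// mul0r. Qed.

(** Two integrations by parts against [e^(-t^2)], applied to [He_j He_(j+1)] and
    to [t He_j^2], form a linear system for the two unknown integrals. *)
Lemma hermite_sqr_rec j :
  let I := gcos 2 ((hermite j : {poly R}) ^+ 2) 0 in
  let M := gcos 2 ((hermite j : {poly R})^`() * hermite j.+1) 0 in
  2 * gcos 2 ((hermite j.+1 : {poly R}) ^+ 2) 0 = (2 * j + 1)%:R * I /\ M = - j%:R * I.
Proof.
move=> I M.
have h1 := gcos2_parts (hermite j * hermite j.+1 : {poly R}).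
have h2 := gcos2_parts ('X * hermite j ^+ 2 : {poly R}).
have e1 : (hermite j * hermite j.+1 : {poly R})^`() - 2 *: ('X * (hermite j * hermite j.+1)) =
  j.+1%:R *: (hermite j ^+ 2) - 2 *: (hermite j.+1 ^+ 2) - (hermite j)^`() * hermite j.+1.
  rewrite derivM deriv_hermite hermiteS -!mul_polyC.
  by move: (hermite j) ((hermite j)^`()) (j.+1%:R%:P) => a b k; ring.
have e2 : ('X * hermite j ^+ 2 : {poly R})^`() - 2 *: ('X * ('X * hermite j ^+ 2)) =
  hermite j ^+ 2 - 2 *: (hermite j.+1 ^+ 2) - 2 *: ((hermite j)^`() * hermite j.+1).
  rewrite (expr2 (hermite j)) !derivM derivX hermiteS -!mul_polyC.
  by move: (hermite j) ((hermite j)^`()) => a b; ring.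
rewrite e1 !gcosB// !gcosZ// -/I -/M in h1.
rewrite e2 !gcosB// !gcosZ// -/I -/M in h2.
rewrite natrD natrM; rewrite -natr1 in h1.
by move: h1 h2; move: (gcos 2 _ 0) I M (j%:R) => a b c' k h1 h2; split; lra.
Qed.

Lemma hermite_sqr_norm j :
  gcos 2 (hermite j ^+ 2) 0 = Num.sqrt pi * j`!%:R * cbin j.
Proof.
elim: j => [|j IH]; first by rewrite expr1n gcos2_0 !mulr1.
have [h _] := hermite_sqr_rec j.
apply: (@mulfI _ (2 : R)) => //; rewrite h IH cbinS factS natrM -natr1 natrD natrM.
by field; exact: double2_neq0.
Qed.

(** Since [t He_j = He_(j+1) + He_j'], the weight [t ^ 2] only involves
    neighbouring norms, whose ratios to the [j]-th grow like [j]; the cross term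
    is negative and cancels this growth. *)
Lemma hermite_sqr_weight_norm j :
  gcos 2 ((1 + 'X^2) * hermite j ^+ 2) 0 <= 5 / 2 * (Num.sqrt pi * j`!%:R * cbin j).
Proof.
have e : (1 + 'X^2) * hermite j ^+ 2 = hermite j ^+ 2 + hermite j.+1 ^+ 2 +
    2 *: ((hermite j)^`() * hermite j.+1) + ((hermite j)^`()) ^+ 2 :> {poly R}.
  by rewrite hermiteS -!mul_polyC; ring.
rewrite -hermite_sqr_norm e !gcosD// gcosZ//.
have [h1 h2] := hermite_sqr_rec j.
have I0 : 0 <= gcos 2 ((hermite j : {poly R}) ^+ 2) 0.
  by rewrite hermite_sqr_norm !mulr_ge0// ?sqrtr_ge0 ?cbin_ge0.
suff K : gcos 2 ((hermite j : {poly R})^`() ^+ 2) 0 <=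
    (j%:R + 1) * gcos 2 ((hermite j : {poly R}) ^+ 2) 0.
  move: h1 K; rewrite h2 natrD natrM; move: I0 {h2}.
  move: (gcos _ _ _) (gcos _ _ _) (gcos _ _ _) (j%:R) => a b c x; lra.
case: j {e h1 h2} I0 => [|j] I0.
  have -> : (hermite 0)^`() ^+ 2 = 0 *: (hermite 0) :> {poly R}.
    by rewrite scale0r (derivC 1) expr0n.
  by rewrite gcosZ// mul0r add0r mul1r.
rewrite deriv_hermite exprZn gcosZ//; move: I0.
have [+ _] := hermite_sqr_rec j; rewrite natrD natrM -[j.+1%:R]natr1.
move: (gcos _ _ _) (gcos _ _ _) => a b.
have : 0 <= (j%:R : R) by [].
move: (j%:R) => x x0 h3 b0.
have a0 : 0 <= a.
  rewrite -(pmulr_rge0 _ (_ : 0 < 2 * x + 1)); last by lra.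
  by rewrite -h3 mulr_ge0.
have -> : b = (2 * x + 1) * a / 2 by lra.
nra.
Qed.

Definition absmoment k := intR (fun t : R => `|t| ^+ k * gexp 1 t).

Lemma integrable_absmoment k : integrableR (fun t : R => `|t| ^+ k * gexp 1 t).
Proof.
have := integrableR_norm (integrable_gcos0 'X^k (@ltr01 R)).
congr integrableR; apply/funext => t.
by rewrite hornerXn normrM normrX (ger0_norm (gexp_ge0 _ _)).
Qed.

Lemma absmoment_ge0 k : 0 <= absmoment k.
Proof. by apply: intR_ge0 => x; rewrite mulr_ge0 ?gexp_ge0// exprn_ge0. Qed.

Lemma absmoment_evenE m : absmoment m.*2 = gcos 1 'X^(m.*2) 0.
Proof.
rewrite gcos0E /absmoment; congr intR; apply/funext => t.
by rewrite hornerXn -muln2 mulnC !exprM real_normK ?num_real.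
Qed.

Lemma absmoment_evenS m : absmoment m.+1.*2 = m.*2.+1%:R * absmoment m.*2.
Proof.
have := gcos_parts ltr01 0 ('X^(m.*2.+1) : {poly R}).
rewrite derivXn scale1r -exprS gcosB// -scaler_nat gcosZ// mul0r /=.
by rewrite !absmoment_evenE doubleS => /eqP; rewrite subr_eq0 => /eqP <-.
Qed.

Lemma absmoment_even m : absmoment m.*2 ^+ 2 = 2 * pi * (m.*2)`!%:R * cbin m.
Proof.
elim: m => [|m IH].
  rewrite absmoment_evenE expr0 gcos1_0 sqr_sqrtr ?mulr1//.
  by rewrite mulr_ge0// pi_ge0.
rewrite absmoment_evenS exprMn IH cbinS fact_doubleS -natr1 -muln2 natrM.
by field; exact: double2_neq0.
Qed.

(** For odd orders, [2 |t| ^ (2m+1) <= s t ^ (2m) + s^-1 t ^ (2m+2)] with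
    [s = sqrt (2m+1)], the value balancing the two even moments. *)
Lemma absmoment_le k : absmoment k ^+ 2 <= 2 * pi * k`!%:R * cbin k./2.
Proof.
rewrite -[in X in X <= _](odd_double_half k) -[in k`!](odd_double_half k).
case: (odd k); rewrite ?add0n ?add1n; last by rewrite absmoment_even.
set m := k./2; set s : R := Num.sqrt m.*2.+1%:R.
have s2 : s ^+ 2 = m.*2.+1%:R by rewrite sqr_sqrtr.
have s0 : 0 < s by rewrite sqrtr_gt0 ltr0n.
have h : absmoment m.*2.+1 <= s * absmoment m.*2.
  have -> : s * absmoment m.*2 = s / 2 * absmoment m.*2 + s^-1 / 2 * absmoment m.+1.*2.
    by rewrite absmoment_evenS -s2; field; rewrite gt_eqF.
  rewrite /absmoment -!intR_scale; [|exact: integrable_absmoment..].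
  have iD := integrableRD (integrableRZ (s / 2) (integrable_absmoment m.*2))
      (integrableRZ (s^-1 / 2) (integrable_absmoment m.+1.*2)).
  rewrite -intR_add; [|by apply: integrableRZ; exact: integrable_absmoment..].
  apply: le_intR => // [|t]; first exact: integrable_absmoment.
  rewrite doubleS !exprS -subr_ge0.
  set y := `|t|; set z := _ ^+ _; set g := gexp 1 t.
  have -> : s / 2 * (z * g) + s^-1 / 2 * (y * (y * z) * g) - y * z * g =
      (s - y) ^+ 2 / (2 * s) * (z * g) by field; rewrite gt_eqF.
  apply: mulr_ge0; last by rewrite mulr_ge0 ?gexp_ge0// exprn_ge0// /y normr_ge0.
  by rewrite divr_ge0 ?sqr_ge0// mulr_ge0// ltW.
have := absmoment_ge0 m.*2.+1 => h0.
rewrite factS natrM -s2 (le_trans (y := (s * absmoment m.*2) ^+ 2))//.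
  by rewrite lerXn2r// nnegrE// (le_trans h0).
by rewrite exprMn absmoment_even !mulrA [s ^+ 2 * 2]mulrC -!mulrA; lra.
Qed.

End hermite_norms.

Arguments cbin {R} k : simpl never.

(** * Rotation invariance of the Gaussian measure *)

Section push_measure.
Context d d' (T1 : measurableType d) (T2 : measurableType d') (R : realType).
Variables (m : {measure set T1 -> \bar R}) (f : T1 -> T2).
Hypothesis mf : measurable_fun [set: T1] f.

(** The image measure, bundled so that it can be passed to uniqueness lemmas. *)
Definition push_measure : {measure set T2 -> \bar R}.
Proof. refine (pushforward m f : {measure set T2 -> \bar R}). exact: mf. Defined.

Lemma ge0_integral_push (g : T2 -> \bar R) : measurable_fun setT g ->
  (forall x, 0 <= g x)%E -> (\int[push_measure]_y g y = \int[m]_x g (f x))%E.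
Proof.
move=> mg g0; have := @ge0_integral_pushforward _ _ T1 T2 R f mf m setT g measurableT mg.
by rewrite preimage_setT => <-.
Qed.

End push_measure.

Section affine_change_of_variables.
Context {R : realType}.
Notation mu := (@lebesgue_measure R).

Lemma measurable_affine (c b : R) : measurable_fun setT (fun x : R => c * x + b).
Proof. by apply: measurable_funD => //; apply: measurable_funM. Qed.

(** Lebesgue measure is determined by the lengths of intervals, which an affine
    map multiplies by its slope. *)
Lemma pos_integral_affine (c b : R) (f : R -> \bar R) : 0 < c ->
  measurable_fun setT f -> (forall x, 0 <= f x)%E ->
  (\int[mu]_x f x = c%:E * \int[mu]_x f (c * x + b)%R)%E.
Proof.
move=> c0 mf f0.
pose phi : measurableTypeR R -> measurableTypeR R := fun x => c * x + b.
have mphi : measurable_fun setT phi by exact: measurable_affine.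
pose k : {nonneg R} := NngNum (ltW c0).
pose m := mscale k (push_measure mu mphi).
have hm X : measurable X -> mu X = m X.
  apply: lebesgue_measure_unique => _ [[x y]] _ <-.
  transitivity (c%:E * mu (phi @^-1` `]x, y]%classic))%E; last by [].
  have -> : phi @^-1` `]x, y]%classic = `](x - b) / c, (y - b) / c]%classic.
    apply/seteqP; split => z /=; rewrite !in_itv/= /phi.
      by rewrite ltr_pdivrMr// ler_pdivlMr// ltrBlDr lerBrDr mulrC.
    by rewrite ltr_pdivrMr// ler_pdivlMr// ltrBlDr lerBrDr mulrC.
  rewrite !lebesgue_measure_itv/= !lte_fin ltr_pM2r ?invr_gt0// ltrD2r.
  case: ifP => _; last by rewrite mule0.
  rewrite -!EFinB -EFinM; congr EFin; field.
  by rewrite gt_eqF.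
rewrite (eq_measure_integral m); last by move=> A mA _; exact: hm.
rewrite ge0_integral_mscale//; congr (_ * _)%E.
exact: (ge0_integral_push mu mphi mf f0).
Qed.

Lemma integral_affine (c b : R) (f : R -> \bar R) : c != 0 ->
  measurable_fun setT f -> (forall x, 0 <= f x)%E ->
  (\int[mu]_x f x = `|c|%:E * \int[mu]_x f (c * x + b)%R)%E.
Proof.
move=> c0 mf f0; have [cp|cn] := ltP 0 c.
  by rewrite gtr0_norm//; exact: pos_integral_affine.
have {c0 cn} cn : c < 0 by rewrite lt_neqAle c0.
rewrite ltr0_norm// (@pos_integral_affine (- c) b) ?oppr_gt0//; congr (_ * _)%E.
rewrite -(integral_reflect (f := fun x => f (c * x + b))) => [| |x].
- by apply: eq_integral => x _; rewrite mulrN mulNr.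
- exact: (measurableT_comp mf (measurable_affine c b)).
- exact: f0.
Qed.

End affine_change_of_variables.

Section standard_normal.
Context {R : realType}.
Notation mu := (@lebesgue_measure R).
Notation phi := (@normal_pdf R 0 1).
Local Notation stdn := (@normal_prob R 0 1).

Lemma phiE x : phi x = (Num.sqrt (2 * pi))^-1 * gexp 1 x.
Proof.
rewrite normal_pdfE ?oner_eq0// /normal_peak /normal_fun /gexp.
by rewrite !expr1n !mul1r subr0 mulNr -(mulr_natl pi 2).
Qed.

Lemma measurable_phi : measurable_fun setT phi.
Proof. exact: measurable_normal_pdf. Qed.

(** Integration against a law with a density; the density is the
    Radon-Nikodym derivative by uniqueness of the latter. *)
Lemma ge0_integral_normal_prob (m s : R) (g : R -> \bar R) :
  measurable_fun setT g -> (forall x, 0 <= g x)%E ->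
  (\int[normal_prob m s]_x g x = \int[mu]_x (g x * (normal_pdf m s x)%:E))%E.
Proof.
move=> mg g0.
have dom := normal_prob_dominates m s.
have := @Radon_Nikodym_SigmaFinite.change_of_variables _ (measurableTypeR R) R
  (normal_prob m s) mu dom g setT g0 measurableT mg.
move=> <-.
have RNi := @Radon_Nikodym_SigmaFinite.f_integrable _ (measurableTypeR R) R
  (normal_prob m s) mu dom.
apply: ae_eq_integral => //.
- by apply: emeasurable_funM => //; exact: measurable_int RNi.
- by apply: emeasurable_funM => //; apply/measurable_EFinP; exact: measurable_normal_pdf.
- apply: ae_eqe_mul2l; apply: integral_ae_eq => //.
  + by apply/measurable_EFinP; exact: measurable_normal_pdf.
  + move=> E _ mE.
    by rewrite -(@Radon_Nikodym_SigmaFinite.f_integral _ (measurableTypeR R) R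
       (normal_prob m s) mu dom E mE).
Qed.

Lemma stdn_indic (A : set R) : measurable A ->
  stdn A = (\int[mu]_x (\1_A x * phi x)%:E)%E.
Proof.
move=> mA; rewrite /normal_prob integral_mkcond; apply: eq_integral => x _.
by rewrite patchE indicE; case: ifP => xA; rewrite ?mul1r ?mul0r.
Qed.

(** The substitution [x = s y] in the density. The right-hand side also makes
    sense at [s = 0], where the parametrised law is not the point mass. *)
Lemma normal_prob_scale (s : R) (A : set R) : s != 0 -> measurable A ->
  normal_prob 0 s A = stdn ((fun x => s * x) @^-1` A).
Proof.
move=> s0 mA.
have mpre : measurable ((fun x : R => s * x) @^-1` A).
  by rewrite -[X in measurable X]setTI; apply: (measurable_funM _ _ measurableT mA).
rewrite stdn_indic// /normal_prob integral_mkcond.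
rewrite (_ : (fun x => _) = (fun x => (\1_A x * normal_pdf 0 s x)%:E)); last first.
  apply/funext => x.
  by rewrite patchE indicE; case: ifP => xA; rewrite ?mul1r ?mul0r.
have mg : measurable_fun setT (fun x => (\1_A x * normal_pdf 0 s x)%:E).
  apply/measurable_EFinP; apply: measurable_funM; first exact: measurable_indic.
  exact: measurable_normal_pdf.
have g0 x : (0 <= (\1_A x * normal_pdf 0 s x)%:E)%E.
  by rewrite lee_fin mulr_ge0// normal_pdf_ge0.
rewrite (integral_affine 0 s0 mg g0).
rewrite -ge0_integralZl//; last exact: (measurableT_comp mg (measurable_affine s 0)).
apply: eq_integral => x _; rewrite -EFinM addr0 mulrCA; congr (_ * _)%:E.
rewrite !normal_pdfE ?oner_eq0// /normal_peak /normal_fun !subr0 expr1n mul1r.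
rewrite mulrA; congr (_ * expR _); last by field.
rewrite -mulrnAr sqrtrM ?sqr_ge0// sqrtr_sqr invfM mulrA divff ?mul1r//.
by rewrite normr_eq0.
Qed.

(** The points [(x, (u - c x) / d)] and [(u, (x - c u) / d)] are at the same
    distance from the origin. *)
Lemma phi_rotation (c d x u : R) : d != 0 -> c ^+ 2 + d ^+ 2 = 1 ->
  phi x * phi ((u - c * x) / d) = phi u * phi ((x - c * u) / d).
Proof.
move=> d0 cd.
have phiM a b : phi a * phi b = (Num.sqrt (2 * pi))^-1 ^+ 2 *
    expR (- (1 * a ^+ 2 / 2) + - (1 * b ^+ 2 / 2)).
  by rewrite !phiE /gexp expRD expr2 mulrACA.
rewrite !phiM; congr (_ * expR _).
have -> : ((u - c * x) / d) ^+ 2 = (u - c * x) ^+ 2 / d ^+ 2 by rewrite exprMn exprVn.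
have -> : ((x - c * u) / d) ^+ 2 = (x - c * u) ^+ 2 / d ^+ 2 by rewrite exprMn exprVn.
have h : d ^+ 2 != 0 by rewrite sqrf_eq0.
apply/eqP; rewrite -subr_eq0; apply/eqP.
have -> : - (1 * x ^+ 2 / 2) + - (1 * ((u - c * x) ^+ 2 / d ^+ 2) / 2) -
  (- (1 * u ^+ 2 / 2) + - (1 * ((x - c * u) ^+ 2 / d ^+ 2) / 2)) =
  (u ^+ 2 - x ^+ 2) * (d ^+ 2 + c ^+ 2 - 1) / (2 * d ^+ 2) by field.
by rewrite addrC in cd; rewrite cd subrr mulr0 mul0r.
Qed.

(** Rotation invariance of the standard Gaussian measure on the plane, seen
    through one coordinate: the substitution [u = c x + d y] completes the
    square. *)
Lemma stdn_rotation (c d : R) (A : set R) : c ^+ 2 + d ^+ 2 = 1 -> measurable A ->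
  (stdn \x stdn)%E [set z : R * R | A (c * z.1 + d * z.2)] = stdn A.
Proof.
move=> cd mA.
have affineK (e : R) y : d != 0 -> (d * y + e - e) / d = y.
  by move=> d0; rewrite addrK mulrAC divff ?mul1r.
have mlin : measurable_fun setT (fun z : R * R => c * z.1 + d * z.2).
  by apply: measurable_funD; apply: measurable_funM => //.
rewrite /product_measure1.
have xs x : xsection [set z : R * R | A (c * z.1 + d * z.2)] x =
    (fun y => d * y + c * x) @^-1` A.
  by apply/seteqP; split => y; rewrite /xsection/= inE/= addrC.
have mpre x : measurable ((fun y : R => d * y + c * x) @^-1` A).
  by rewrite -[X in measurable X]setTI; apply: (measurable_affine d (c * x) measurableT mA).
have [d0|d0] := eqVneq d 0.
  subst d.
  move: cd; rewrite expr0n/= addr0 => /eqP; rewrite sqrf_eq1 => c1.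
  under eq_integral do rewrite /= xs.
  transitivity (\int[stdn]_x (\1_((fun y : R => c * y) @^-1` A) x)%:E)%E.
    apply: eq_integral => x _; rewrite indicE /=; have [xA|xA] := boolP (x \in _).
      rewrite (_ : _ @^-1` _ = setT) ?probability_setT//.
      by apply/seteqP; split => // y _ /=; rewrite mul0r add0r; move: xA; rewrite inE.
    rewrite (_ : _ @^-1` _ = set0) ?measure0//.
    apply/seteqP; split => // y /=; rewrite mul0r add0r => h; move: xA.
    by rewrite notin_setE.
  have c0 : c != 0 by case/orP: c1 => /eqP ->; rewrite ?oppr_eq0 oner_eq0.
  have mpre' : measurable ((fun y : R => c * y) @^-1` A).
    by rewrite -[X in measurable X]setTI; apply: (measurable_funM _ _ measurableT mA).
  transitivity (stdn ((fun y : R => c * y) @^-1` A)).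
    by rewrite integral_indic// setIT.
  rewrite -(normal_prob_scale c0 mA).
  case/orP: c1 => /eqP ->; first by [].
  apply: eq_integral => x _; rewrite !normal_pdfE ?oppr_eq0 ?oner_eq0//.
  by rewrite /normal_peak /normal_fun sqrrN.
transitivity (\int[stdn]_x \int[mu]_u
   (`|d|^-1 * (\1_A u * phi ((u - c * x) / d)))%:E)%E.
  apply: eq_integral => x _ /=; rewrite xs stdn_indic//.
  have mf : measurable_fun setT (fun u => (\1_A u * phi ((u - c * x) / d))%:E).
    apply/measurable_EFinP; apply: measurable_funM; first exact: measurable_indic.
    apply: measurableT_comp; first exact: measurable_phi.
    by apply: measurable_funM => //; exact: measurable_funB.
  have f0 u : (0 <= (\1_A u * phi ((u - c * x) / d))%:E)%E.
    by rewrite lee_fin mulr_ge0// normal_pdf_ge0.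
  under [RHS]eq_integral do rewrite EFinM.
  rewrite ge0_integralZl//.
  rewrite (integral_affine (c * x) d0 mf f0) muleA -EFinM mulVf ?normr_eq0// mul1e.
  by apply: eq_integral => y _; rewrite affineK.
have mA2 : measurable_fun setT (fun z : R * R => \1_A z.2 : R).
  by apply: (measurableT_comp (f := (\1_A : R -> R))); [exact: measurable_indic|exact: measurable_snd].
have mphi2 : measurable_fun setT (fun z : R * R => phi z.2).
  by apply: (measurableT_comp (f := phi)); [exact: measurable_phi|exact: measurable_snd].
have mJ : measurable_fun setT (fun z : R * R =>
    (`|d|^-1 * (\1_A z.2 * phi ((z.2 - c * z.1) / d)))%:E).
  apply/measurable_EFinP; apply: measurable_funM => //.
  apply: measurable_funM; first exact: mA2.
  apply: measurableT_comp; first exact: measurable_phi.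
  by apply: measurable_funM => //; apply: measurable_funB => //; apply: measurable_funM.
have J0 z : (0 <= (`|d|^-1 * (\1_A z.2 * phi ((z.2 - c * z.1) / d)))%:E)%E.
  by rewrite lee_fin mulr_ge0 ?invr_ge0// mulr_ge0// normal_pdf_ge0.
rewrite ge0_integral_normal_prob; last 2 first.
- exact: (@measurable_fun_fubini_tonelli_F _ _ _ _ _ mu _ mJ J0).
- by move=> x; apply: integral_ge0 => y _; exact: (J0 (x, y)).
transitivity (\int[mu]_x \int[mu]_u
   (`|d|^-1 * (\1_A u * (phi u * phi ((x - c * u) / d))))%:E)%E.
  apply: eq_integral => x _.
  rewrite -ge0_integralZr//; first last.
  - by rewrite lee_fin normal_pdf_ge0.
  - by move=> y _; exact: (J0 (x, y)).
  - exact: (measurable_fun_pair2 (f := fun z : R * R =>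
      (`|d|^-1 * (\1_A z.2 * phi ((z.2 - c * z.1) / d)))%:E) x mJ).
  apply: eq_integral => u _; rewrite -EFinM; congr EFin.
  by rewrite -phi_rotation//; ring.
have mK : measurable_fun setT (fun z : R * R =>
    (`|d|^-1 * (\1_A z.2 * (phi z.2 * phi ((z.1 - c * z.2) / d))))%:E).
  apply/measurable_EFinP; apply: measurable_funM => //.
  apply: measurable_funM; first exact: mA2.
  apply: measurable_funM; first exact: mphi2.
  apply: measurableT_comp; first exact: measurable_phi.
  by apply: measurable_funM => //; apply: measurable_funB => //; apply: measurable_funM.
have K0 z : (0 <= (`|d|^-1 * (\1_A z.2 * (phi z.2 * phi ((z.1 - c * z.2) / d))))%:E)%E.
  by rewrite lee_fin mulr_ge0 ?invr_ge0// mulr_ge0// mulr_ge0// normal_pdf_ge0.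
apply: etrans (@fubini_tonelli _ _ (measurableTypeR R) (measurableTypeR R) R mu mu _ mK K0) _.
rewrite stdn_indic//.
apply: eq_integral => u _ /=.
have mL : measurable_fun setT (fun x : R => (phi ((x - c * u) / d))%:E).
  apply/measurable_EFinP; apply: measurableT_comp; first exact: measurable_phi.
  by apply: measurable_funM => //; exact: measurable_funB.
have L0 x : (0 <= (phi ((x - c * u) / d))%:E)%E by rewrite lee_fin normal_pdf_ge0.
transitivity (\int[mu]_x ((`|d|^-1 * (\1_A u * phi u))%:E * (phi ((x - c * u) / d))%:E))%E.
  by apply: eq_integral => x _; rewrite -EFinM -!mulrA.
rewrite ge0_integralZl//; last first.
  by rewrite lee_fin mulr_ge0 ?invr_ge0// mulr_ge0// normal_pdf_ge0.
rewrite (integral_affine (c * u) d0 mL L0).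
under eq_integral do rewrite affineK//.
rewrite integral_normal_pdf mule1 -EFinM mulrAC mulVf ?mul1r//.
by rewrite normr_eq0.
Qed.

(** Integration by parts of [t e^(-t^2/2)] at [theta = 0]. *)
Lemma stdn_second_moment (s : R) :
  (\int[stdn]_x ((s * x) ^+ 2)%:E = (s ^+ 2)%:E)%E.
Proof.
rewrite ge0_integral_normal_prob; last 2 first.
- by apply/measurable_EFinP; apply: measurable_funX; apply: measurable_funM.
- by move=> x; rewrite lee_fin sqr_ge0.
have h := gcos_parts ltr01 0 ('X : {poly R}).
rewrite derivX scale1r gcosB// mul0r in h.
have e : (fun x => (((s * x) ^+ 2)%:E * (phi x)%:E)%E) =
  EFin \o (fun x : R => (s ^+ 2 / Num.sqrt (2 * pi)) * (('X * 'X : {poly R}).[x] * gexp 1 x)).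
  apply/funext => x /=; rewrite -EFinM phiE hornerM hornerX; congr EFin.
  by rewrite exprMn; ring.
rewrite e -EFin_intR; last by apply: integrableRZ; exact: integrable_gcos0.
rewrite intR_scale; last exact: integrable_gcos0.
move/eqP : h; rewrite gcos1_0 subr_eq0 gcos0E => /eqP <-.
by rewrite divfK// gt_eqF// sqrtr_gt0 mulr_gt0// pi_gt0.
Qed.

End standard_normal.

(** * Laws of sequences of independent variables *)

Section law_uniqueness.
Context {R : realType}.

Lemma distribution_unique (m1 m2 : {measure set (measurableTypeR R) -> \bar R}) :
  m1 setT = 1%E -> m2 setT = 1%E ->
  (forall x : R, m1 `]-oo, x[%classic = m2 `]-oo, x[%classic) ->
  forall A, measurable A -> m1 A = m2 A.
Proof.
move=> h1 h2 h.
apply: (@measure_unique _ R (measurableTypeR R) (@RGenInftyO.G R)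
  (fun n => `]-oo, n%:R[%classic)).
- exact: RGenInftyO.measurableE.
- move=> A B [x ->] [y ->]; exists (Order.min x y).
  by apply/seteqP; split => z /=; rewrite !in_itv/= lt_min => /andP.
- by move=> i; exists i%:R.
- apply/seteqP; split => // x _; exists (Num.truncn `|x|).+1 => //=.
  rewrite in_itv/=; apply: le_lt_trans (ler_norm x) _.
  by have /andP[] := truncn_itv (normr_ge0 x).
- by move=> A [x ->].
- move=> k; rewrite (@le_lt_trans _ _ 1%E) ?ltry// -h1.
  by apply: le_measure; rewrite ?inE//; exact: measurable_itv.
Qed.

End law_uniqueness.

Section sequence_space.
Context {R : realType}.

Definition cylinder (n : nat) (A : nat -> set R) : set (nat -> R) :=
  [set s | forall k, (k < n)%N -> A k (s k)].
Definition cylinders : set (set (nat -> R)) :=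
  [set C | exists n A, (forall k, measurable (A k)) /\ C = cylinder n A].
(** The space of real sequences with the product sigma-algebra. *)
Definition seqT := g_sigma_algebraType cylinders.

Lemma cylinder_widen n m A : (n <= m)%N ->
  cylinder n A = cylinder m (fun k => if (k < n)%N then A k else setT).
Proof.
move=> nm; apply/seteqP; split => s h k.
  by move=> _; case: ifP => // /h.
by move=> kn; have := h k (leq_trans kn nm); rewrite kn.
Qed.

Lemma cylinderI n A B :
  cylinder n A `&` cylinder n B = cylinder n (fun k => A k `&` B k).
Proof.
apply/seteqP; split => s; first by move=> [h1 h2] k kn; split; [exact: h1|exact: h2].
by move=> h; split => k /h[].
Qed.

Lemma setI_closed_cylinders : setI_closed cylinders.
Proof.
move=> _ _ [n [A [mA ->]]] [m [B [mB ->]]].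
rewrite (cylinder_widen A (leq_maxl n m)) (cylinder_widen B (leq_maxr n m)) cylinderI.
by eexists; eexists; split; last by []; move=> k; apply: measurableI; case: ifP.
Qed.

Lemma cylinderT : cylinder 0 (fun=> setT) = setT.
Proof. by apply/seteqP; split. Qed.

Lemma measurable_cylinder n A : (forall k, measurable (A k)) ->
  @measurable _ seqT (cylinder n A).
Proof. by move=> mA; apply: sub_sigma_algebra; exists n, A. Qed.

Lemma measurable_coord k : measurable_fun [set: seqT] (fun s : seqT => s k).
Proof.
move=> _ A mA; rewrite setTI; apply: sub_sigma_algebra.
exists k.+1, (fun j => if j == k then A else setT); split => [j|]; first by case: ifP.
apply/seteqP; split => s /= h; last by have := h k (ltnSn k); rewrite eqxx.
by move=> j _; case: eqP => // ->.
Qed.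

Lemma seq_law_unique (m1 m2 : {measure set seqT -> \bar R}) :
  (m1 setT < +oo)%E ->
  (forall n A, (forall k, measurable (A k)) -> m1 (cylinder n A) = m2 (cylinder n A)) ->
  forall S, @measurable _ seqT S -> m1 S = m2 S.
Proof.
move=> h h12; apply: (@measure_unique _ R seqT cylinders (fun=> setT)).
- by [].
- exact: setI_closed_cylinders.
- by move=> _; exists 0%N, (fun=> setT); rewrite cylinderT.
- by apply/seteqP; split => // s _; exists 0%N.
- by move=> _ [n [A [mA ->]]]; exact: h12.
- by [].
Qed.

Context {d : measure_display} {T : measurableType d}.

Lemma measurable_seq (z : nat -> T -> R) : (forall k, measurable_fun setT (z k)) ->
  measurable_fun setT (fun w => (fun k => z k w) : seqT).
Proof.
move=> mz; apply: (@measurability _ _ T seqT _ _ cylinders); first by [].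
move=> _ [_ [n [A [mA ->]]] <-]; rewrite setTI.
have -> : (fun w => (fun k => z k w) : seqT) @^-1` cylinder n A =
    \bigcap_(k in `I_n) (z k @^-1` A k).
  by apply/seteqP; split => w h k /=; exact: h.
apply: fin_bigcap_measurable => // k _.
by rewrite -[X in measurable X]setTI; exact: mz.
Qed.

(** Coordinates outside of [I] are set to [0] rather than forgotten, so that all
    blocks live in the same space of sequences. *)
Definition restrict_seq (I : pred nat) (s : nat -> R) : nat -> R :=
  fun k => if I k then s k else 0.

Lemma measurable_restrict_seq (I : pred nat) (z : nat -> T -> R) :
  (forall k, measurable_fun setT (z k)) ->
  measurable_fun setT (fun w => restrict_seq I (z ^~ w) : seqT).
Proof.
by move=> mz; apply: measurable_seq => k; rewrite /restrict_seq; case: (I k).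
Qed.

End sequence_space.

Section iid.
Context {R : realType} {d : measure_display} {T : measurableType d}.
Variables (P : probability T R) (z : nat -> T -> R).
Hypothesis hz : iid_std_normal P z.
Local Notation stdn := (@normal_prob R 0 1).
Let mz := iid_measurable hz.

Lemma measurable_preimage (f : T -> R) (A : set R) :
  measurable_fun setT f -> measurable A -> measurable (f @^-1` A).
Proof. by move=> mf mA; rewrite -[X in measurable X]setTI; exact: mf. Qed.

Lemma iid_cylinder n (A : nat -> set R) : (forall k, measurable (A k)) ->
  P [set w | cylinder n A (z ^~ w)] = (\prod_(0 <= k < n) stdn (A k))%E.
Proof.
move=> mA; have := (iid_indep hz) [fset k in iota 0 n]%fset A mA.
rewrite (_ : \bigcap_(_ in _) _ = [set w | cylinder n A (z ^~ w)]); last first.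
  apply/seteqP; split => w h k /=.
    by move=> kn; apply: (h k); rewrite /= inE mem_iota.
  by rewrite inE mem_iota => /andP[_ kn]; exact: h.
move=> ->; rewrite (perm_big (iota 0 n)); last first.
  rewrite uniq_perm ?fset_uniq ?iota_uniq// => k.
  by rewrite !inE.
rewrite /index_iota subn0; apply: eq_bigr => k _.
by rewrite (iid_law hz).
Qed.

(** In each coordinate one of the two constraints concerns the constant [0], hence
    is always or never satisfied, and the product formula splits. *)
Lemma iid_blocks_cylinder (I : pred nat) n (A B : nat -> set R) :
  (forall k, measurable (A k)) -> (forall k, measurable (B k)) ->
  P ([set w | cylinder n A (restrict_seq I (z ^~ w))] `&`
     [set w | cylinder n B (restrict_seq (predC I) (z ^~ w))]) =
  (P [set w | cylinder n A (restrict_seq I (z ^~ w))] *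
   P [set w | cylinder n B (restrict_seq (predC I) (z ^~ w))])%E.
Proof.
move=> mA mB.
pose r (J : pred nat) k (x : R) := if J k then x else 0.
have E (J : pred nat) (C : nat -> set R) :
    [set w | cylinder n C (restrict_seq J (z ^~ w))] =
    [set w | cylinder n (fun k => r J k @^-1` C k) (z ^~ w)].
  by apply/seteqP; split => w.
have mr (J : pred nat) (C : nat -> set R) : (forall k, measurable (C k)) ->
    forall k, measurable (r J k @^-1` C k).
  move=> mC k; have mrk : measurable_fun setT (r J k) by rewrite /r; case: (J k).
  by rewrite -[X in measurable X]setTI; exact: mrk.
rewrite !E.
rewrite (_ : _ `&` _ = [set w | cylinder n
    (fun k => r I k @^-1` A k `&` r (predC I) k @^-1` B k) (z ^~ w)]); last first.
  by rewrite -cylinderI.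
rewrite !iid_cylinder; [|exact: mr..|by move=> k; apply: measurableI; exact: mr].
rewrite -big_split/=; apply: eq_bigr => k _; rewrite /r /=.
have triv (D : set R) (x : R) :
    ((fun=> x) : R -> R) @^-1` D = setT \/ ((fun=> x) : R -> R) @^-1` D = set0.
  have [Dx|Dx] := pselect (D x); first by left; apply/seteqP; split.
  by right; apply/seteqP; split => // y /Dx.
case: (I k) => /=.
  by have [->|->] := triv (B k) 0; rewrite ?setIT ?setI0 ?measure0 ?mule0 ?probability_setT ?mule1.
by have [->|->] := triv (A k) 0; rewrite ?setTI ?set0I ?measure0 ?mul0e ?probability_setT ?mul1e.
Qed.

(** Cylinders determine finite measures on the space of sequences, so the product
    formula extends to measurable sets, in one argument after the other. *)
Lemma iid_blocks (I : pred nat) (A B : set seqT) :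
  measurable A -> measurable B ->
  P ((fun w => restrict_seq I (z ^~ w)) @^-1` A `&`
     (fun w => restrict_seq (predC I) (z ^~ w)) @^-1` B) =
  (P ((fun w => restrict_seq I (z ^~ w)) @^-1` A) *
   P ((fun w => restrict_seq (predC I) (z ^~ w)) @^-1` B))%E.
Proof.
set X : T -> seqT := fun w => restrict_seq I (z ^~ w).
set Y : T -> seqT := fun w => restrict_seq (predC I) (z ^~ w).
have mX : measurable_fun setT X by exact: measurable_restrict_seq.
have mY : measurable_fun setT Y by exact: measurable_restrict_seq.
have preX C : measurable C -> measurable (X @^-1` C).
  by move=> mC; rewrite -[W in measurable W]setTI; exact: mX.
have preY C : measurable C -> measurable (Y @^-1` C).
  by move=> mC; rewrite -[W in measurable W]setTI; exact: mY.
have cyl n A1 m B1 : (forall k, measurable (A1 k)) -> (forall k, measurable (B1 k)) ->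
    P (X @^-1` cylinder n A1 `&` Y @^-1` cylinder m B1) =
    (P (X @^-1` cylinder n A1) * P (Y @^-1` cylinder m B1))%E.
  move=> mA1 mB1.
  rewrite (cylinder_widen A1 (leq_maxl n m)) (cylinder_widen B1 (leq_maxr n m)).
  by apply: iid_blocks_cylinder => k; case: ifP.
have fact (E : set T) (mE : measurable E) (W : T -> seqT) (mW : measurable_fun setT W) :
    (forall n (A1 : nat -> set R), (forall k, measurable (A1 k)) ->
      P (W @^-1` cylinder n A1 `&` E) = (P (W @^-1` cylinder n A1) * P E)%E) ->
    forall S, measurable S -> P (W @^-1` S `&` E) = (P (W @^-1` S) * P E)%E.
  move=> h S mS.
  have PE0 : 0 <= fine (P E) by exact: fine_ge0.
  have PEfin : (fine (P E))%:E = P E by rewrite fineK// fin_num_measure.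
  pose m1 := push_measure (mrestr P mE) mW.
  pose m2 : {measure set seqT -> \bar R} := mscale (NngNum PE0) (push_measure P mW).
  rewrite [RHS]muleC -PEfin.
  suff : m1 S = m2 S by [].
  apply: (@seq_law_unique R m1 m2) => //.
    rewrite /m1 /= /pushforward /mrestr preimage_setT setTI.
    by rewrite (le_lt_trans (probability_le1 P mE))// ltry.
  move=> n A1 mA1; rewrite /m1 /m2 /mscale/= /pushforward /mrestr h//.
  transitivity ((fine (P E))%:E * P (W @^-1` cylinder n A1))%E; last by [].
  by rewrite muleC PEfin.
move=> mA mB.
apply: (fact _ (preY B mB) X mX) => // n A1 mA1.
rewrite setIC muleC.
have mC : @measurable _ seqT (cylinder n A1) by exact: measurable_cylinder.
apply: (fact _ (preX _ mC) Y mY) => // m B1 mB1.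
by rewrite setIC muleC; exact: cyl.
Qed.

End iid.

Lemma iid_same_law {R : realType} {d d' : measure_display}
  {T : measurableType d} {T' : measurableType d'}
  (P : probability T R) (P' : probability T' R) (z : nat -> T -> R) (z' : nat -> T' -> R) :
  iid_std_normal P z -> iid_std_normal P' z' ->
  forall S, @measurable _ (@seqT R) S ->
  P [set w | S (z ^~ w)] = P' [set w | S (z' ^~ w)].
Proof.
move=> hz hz' S mS.
have mz := measurable_seq (iid_measurable hz).
have mz' := measurable_seq (iid_measurable hz').
suff : push_measure P mz S = push_measure P' mz' S by [].
apply: (@seq_law_unique R (push_measure P mz) (push_measure P' mz')) => //.
  by rewrite /= /pushforward preimage_setT probability_setT ltry.
move=> n A mA; apply: etrans (iid_cylinder hz n mA) _.
by apply/esym; exact: iid_cylinder.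
Qed.

(** * Linear combinations of independent normal variables *)

Section gaussian_sums.
Context {R : realType} {d : measure_display} {T : measurableType d}.
Variable P : probability T R.
Local Notation stdn := (@normal_prob R 0 1).

(** The law [N(0, s^2)], as the image of the standard normal law by dilation:
    this form includes the degenerate case [s = 0]. *)
Definition normal_law (X : T -> R) (s : R) : Prop :=
  forall A : set R, measurable A -> P (X @^-1` A) = stdn ((fun x => s * x) @^-1` A).

Lemma preimage_scale0 (A : set R) :
  (A 0 -> (fun x : R => 0 * x) @^-1` A = setT) /\
  (~ A 0 -> (fun x : R => 0 * x) @^-1` A = set0).
Proof.
by split=> A0; apply/seteqP; split => // x /=; rewrite mul0r.
Qed.

Lemma measurable_scale (s : R) : measurable_fun setT (fun x : R => s * x).
Proof. exact: measurable_funM. Qed.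

(** The pair [(X, Y)] is distributed as [(s x, y)] under the standard Gaussian
    measure of the plane, so its image by [x + b y] is found by a rotation. *)
Lemma normal_law_add (X Y : T -> R) (s b : R) :
  measurable_fun setT X -> measurable_fun setT Y ->
  normal_law X s -> normal_law Y 1 ->
  (forall A B : set R, measurable A -> measurable B ->
     P (X @^-1` A `&` Y @^-1` B) = (P (X @^-1` A) * P (Y @^-1` B))%E) ->
  normal_law (fun w => X w + b * Y w) (Num.sqrt (s ^+ 2 + b ^+ 2)).
Proof.
move=> mX mY lX lY ind A mA.
have mXY : measurable_fun setT (fun w => (X w, Y w)) by exact: measurable_fun_pair.
have msx : measurable_fun setT (fun z : R * R => (s * z.1, z.2)).
  by apply: measurable_fun_pair => //; exact: measurable_funM.
pose J := push_measure P mXY.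
pose K := push_measure (stdn \x stdn)%E msx.
have mlin : measurable_fun setT (fun z : R * R => z.1 + b * z.2).
  by apply: measurable_funD => //; exact: measurable_funM.
have mpre : measurable [set z : R * R | A (z.1 + b * z.2)].
  by rewrite -[X in measurable X]setTI; exact: mlin.
have JK : J [set z | A (z.1 + b * z.2)] = K [set z | A (z.1 + b * z.2)].
  pose G : set (set (R * R)) := [set A `*` B | A in @measurable _ R & B in @measurable _ R].
  apply: (measure_unique G (fun=> setT)) => //.
  - by rewrite measurable_prod_measurableType.
  - move=> _ _ [A1 mA1 [B1 mB1 <-]] [A2 mA2 [B2 mB2 <-]].
    exists (A1 `&` A2); first exact: measurableI.
    exists (B1 `&` B2); first exact: measurableI.
    by rewrite setXI.
  - by move=> _; exists setT => //; exists setT => //; rewrite setXTT.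
  - by apply/seteqP; split => // z _; exists 0%N.
  - move=> _ [A1 mA1 [B1 mB1 <-]].
    transitivity (P (X @^-1` A1 `&` Y @^-1` B1)); first by [].
    rewrite ind// lX// lY//.
    transitivity ((stdn \x stdn)%E (((fun x => s * x) @^-1` A1) `*` B1)); last by [].
    rewrite product_measure1E//; last first.
      by rewrite -[X in measurable X]setTI; exact: measurable_scale.
    congr (_ * _)%E; congr (stdn _).
    by apply/seteqP; split => x /=; rewrite mul1r.
  - move=> _; rewrite /J /= /pushforward preimage_setT.
    by rewrite probability_setT ltry.
transitivity (J [set z | A (z.1 + b * z.2)]); first by [].
rewrite JK.
transitivity ((stdn \x stdn)%E [set z : R * R | A (s * z.1 + b * z.2)]); first by [].
set r := Num.sqrt _.
have r2 : r ^+ 2 = s ^+ 2 + b ^+ 2 by rewrite sqr_sqrtr// addr_ge0// sqr_ge0.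
have [r0|r0] := eqVneq r 0.
  move: r2; rewrite r0 expr0n/= => /esym/eqP.
  rewrite paddr_eq0 ?sqr_ge0// !sqrf_eq0 => /andP[/eqP -> /eqP ->].
  have [A0|A0] := pselect (A 0).
    rewrite (_ : [set z : R * R | _] = setT `*` setT); last first.
      by rewrite setXTT; apply/seteqP; split => // z _ /=; rewrite !mul0r addr0.
    have p1 : stdn [set: R] = 1%E by exact: probability_setT.
    rewrite ((preimage_scale0 A).1 A0).
    rewrite p1; apply: etrans (product_measure1E _ _ measurableT measurableT) _.
    by apply: etrans (congr2 mule p1 p1) _; rewrite mul1e.
  rewrite (_ : [set z : R * R | _] = set0); last first.
    by apply/seteqP; split => // z /=; rewrite !mul0r addr0.
  rewrite ((preimage_scale0 A).2 A0).
  by rewrite !measure0.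
rewrite -(@stdn_rotation R (s / r) (b / r)); last 2 first.
- by rewrite !exprMn !exprVn -mulrDl -r2 divff// sqrf_eq0.
- by rewrite -[X in measurable X]setTI; exact: measurable_scale.
have e (x y : R) : r * (s / r * x + b / r * y) = s * x + b * y by field.
by congr ((_ \x _)%E _); apply/seteqP; split => z /=; rewrite e.
Qed.

Variable z : nat -> T -> R.
Hypothesis hz : iid_std_normal P z.
Let mz := iid_measurable hz.

Lemma measurable_lincomb (b : nat -> R) n :
  measurable_fun setT (fun w => \sum_(k < n) b k * z k w).
Proof.
apply: measurable_sum => k; apply: measurable_funM => //; exact: mz.
Qed.

(** The first [n] coordinates and the next one are independent blocks, to which
    the addition rule applies. *)
Lemma iid_sum_law (b : nat -> R) n :
  normal_law (fun w => \sum_(k < n) b k * z k w) (Num.sqrt (\sum_(k < n) b k ^+ 2)).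
Proof.
elim: n => [|n IH].
  move=> A mA; under [X in X @^-1` _]eq_fun do rewrite big_ord0.
  rewrite big_ord0 sqrtr0.
  have [A0|A0] := pselect (A 0).
    rewrite ((preimage_scale0 A).1 A0).
    have -> : (fun=> 0) @^-1` A = [set: T] by apply/seteqP; split.
    by rewrite !probability_setT.
  rewrite ((preimage_scale0 A).2 A0).
  have -> : (fun=> 0) @^-1` A = set0 :> set T by apply/seteqP; split.
  by rewrite !measure0.
under [X in normal_law X _]eq_fun do rewrite big_ord_recr /=.
rewrite big_ord_recr /= -[X in X + _]sqr_sqrtr; last first.
  by apply: sumr_ge0 => k _; exact: sqr_ge0.
apply: normal_law_add => //.
- exact: measurable_lincomb.
- move=> A mA; rewrite (iid_law hz)//; congr (stdn _).
  by apply/seteqP; split => x /=; rewrite mul1r.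
move=> A B mA mB.
pose A' : set seqT := (fun s : seqT => \sum_(k < n) b k * s k) @^-1` A.
pose B' : set seqT := (fun s : seqT => s n) @^-1` B.
have mA' : measurable A'.
  rewrite -[X in measurable X]setTI.
  have : measurable_fun setT (fun s : @seqT R => \sum_(k < n) b k * s k).
    by apply: measurable_sum => k; apply: measurable_funM => //; exact: measurable_coord.
  by apply.
have mB' : measurable B' by rewrite -[X in measurable X]setTI; exact: measurable_coord.
have := iid_blocks hz (fun k => (k < n)%N) mA' mB'.
have -> : (fun w => restrict_seq (fun k => (k < n)%N) (z ^~ w)) @^-1` A' =
    (fun w => \sum_(k < n) b k * z k w) @^-1` A.
  apply/seteqP; split => w; rewrite /A' /=; congr (A _);
  by apply: eq_bigr => k _; rewrite /restrict_seq ltn_ord.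
have -> // : (fun w => restrict_seq (predC (fun k => (k < n)%N)) (z ^~ w)) @^-1` B' = z n @^-1` B.
by apply/seteqP; split => w; rewrite /B' /= /restrict_seq /= ltnn.
Qed.

Lemma normal_law_sqr (X : T -> R) s : measurable_fun setT X -> normal_law X s ->
  (\int[P]_w ((X w) ^+ 2)%:E = (s ^+ 2)%:E)%E.
Proof.
move=> mX lX.
have msq : measurable_fun setT (fun x : R => (x ^+ 2)%:E).
  by apply/measurable_EFinP; exact: measurable_funX.
have sq0 (x : R) : (0 <= (x ^+ 2)%:E)%E by rewrite lee_fin sqr_ge0.
rewrite -(ge0_integral_push P mX msq sq0).
rewrite -(stdn_second_moment s) -(ge0_integral_push stdn (measurable_scale s) msq sq0).
by apply: eq_measure_integral => A mA _; exact: lX.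
Qed.

Lemma iid_sum_sqr (b : nat -> R) n :
  (\int[P]_w ((\sum_(k < n) b k * z k w) ^+ 2)%:E = (\sum_(k < n) b k ^+ 2)%:E)%E.
Proof.
rewrite (normal_law_sqr (measurable_lincomb b n) (iid_sum_law b n)) sqr_sqrtr//.
by apply: sumr_ge0 => k _; exact: sqr_ge0.
Qed.

End gaussian_sums.

(** * Gaussian series in mean square *)

Section mean_square.
Context {R : realType} {d : measure_display} {T : measurableType d}.
Variable P : probability T R.
Local Notation stdn := (@normal_prob R 0 1).
Implicit Types X Y : T -> R.

Definition sqnorm X : \bar R := (\int[P]_w ((X w) ^+ 2)%:E)%E.

Lemma measurable_sqr X : measurable_fun setT X ->
  measurable_fun setT (fun w => ((X w) ^+ 2)%:E).
Proof. by move=> mX; apply/measurable_EFinP; exact: measurable_funX. Qed.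

Lemma sqnorm_ge0 X : (0 <= sqnorm X)%E.
Proof. by apply: integral_ge0 => w _; rewrite lee_fin sqr_ge0. Qed.

Lemma sqnorm_le X Y : measurable_fun setT X -> measurable_fun setT Y ->
  (forall w, `|X w| <= `|Y w|) -> (sqnorm X <= sqnorm Y)%E.
Proof.
move=> mX mY XY; apply: ge0_le_integral => //.
- by move=> w _; rewrite lee_fin sqr_ge0.
- exact: measurable_sqr.
- exact: measurable_sqr.
- move=> w _; rewrite lee_fin -(real_normK (num_real (X w))) -(real_normK (num_real (Y w))).
  by rewrite lerXn2r// nnegrE.
Qed.

Lemma sqnormD X Y : measurable_fun setT X -> measurable_fun setT Y ->
  (sqnorm (fun w => X w + Y w)%R <= 2%:E * sqnorm X + 2%:E * sqnorm Y)%E.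
Proof.
move=> mX mY; have mX2 := measurable_sqr mX; have mY2 := measurable_sqr mY.
have m2X : measurable_fun setT (fun w => 2%:E * ((X w) ^+ 2)%:E)%E by exact: measurable_funeM.
have m2Y : measurable_fun setT (fun w => 2%:E * ((Y w) ^+ 2)%:E)%E by exact: measurable_funeM.
rewrite /sqnorm -!ge0_integralZl//; [|by move=> w _; rewrite lee_fin sqr_ge0..].
rewrite -ge0_integralD//; [|by move=> w _; rewrite -EFinM lee_fin mulr_ge0 ?sqr_ge0..].
apply: ge0_le_integral => //.
- by move=> w _; rewrite lee_fin sqr_ge0.
- by apply: measurable_sqr; exact: measurable_funD.
- exact: emeasurable_funD.
- move=> w _; rewrite -!EFinM -EFinD lee_fin.
  by have := sqr_ge0 (X w - Y w); rewrite sqrrB sqrrD; move: (X w) (Y w) => x y; nra.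
Qed.

Lemma sqnormZ c X : measurable_fun setT X ->
  sqnorm (fun w => c * X w) = ((c ^+ 2)%:E * sqnorm X)%E.
Proof.
move=> mX; rewrite /sqnorm -ge0_integralZl//.
- by apply: eq_integral => w _; rewrite exprMn EFinM.
- exact: measurable_sqr.
- by move=> w _; rewrite lee_fin sqr_ge0.
- by rewrite lee_fin sqr_ge0.
Qed.

Lemma chebyshev_sqnorm X (e : R) : 0 < e -> measurable_fun setT X ->
  ((e ^+ 2)%:E * P [set w | e <= `|X w|]%R <= sqnorm X)%E.
Proof.
move=> e0 mX.
have := @le_integral_abse _ T R P setT measurableT (fun w => ((X w) ^+ 2)%:E) (e ^+ 2)
  (measurable_sqr mX) (exprn_gt0 2 e0).
rewrite setTI; under eq_integral do rewrite gee0_abs ?lee_fin ?sqr_ge0//.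
suff -> : [set x | (e ^+ 2)%:E <= `|(X x ^+ 2)%:E|]%E = [set w | e <= `|X w|] by [].
have le2 w : ((e ^+ 2)%:E <= `|(X w ^+ 2)%:E|)%E = (e <= `|X w|).
  rewrite gee0_abs ?lee_fin ?sqr_ge0// -(real_normK (num_real (X w))).
  by rewrite ler_pXn2r// nnegrE ltW.
by apply/seteqP; split => w /=; rewrite le2.
Qed.

(** Lets processes be replaced by almost surely equal ones in the events below. *)
Lemma ae_prob_eq (A B : set T) : measurable A -> measurable B ->
  {ae P, forall w, A w <-> B w} -> P A = P B.
Proof.
move=> mA mB [N [mN N0 sub]].
have h (C D : set T) : measurable C -> measurable D -> C `<=` D `|` N -> (P C <= P D)%E.
  move=> mC mD CD; apply: (@le_trans _ _ (P (D `|` N))).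
    by apply: le_measure; rewrite ?inE//; exact: measurableU.
  by apply: le_trans (measureU2 P mD mN) _; rewrite -[leRHS]adde0 leeD2l//;
    suff: (P N <= 0)%E by []; rewrite N0.
apply/eqP; rewrite eq_le; apply/andP; split; apply: h => // w Cw.
  have [Bw|Bw] := pselect (B w); [by left|right; apply: sub => /= H].
  by apply: Bw; apply/H.
have [Aw|Aw] := pselect (A w); [by left|right; apply: sub => /= H].
by apply: Aw; apply/H.
Qed.

Variable z : nat -> T -> R.
Hypothesis hz : iid_std_normal P z.
Let mz := iid_measurable hz.

(** Convergence of the random series [sum_k b_k z_k] in mean square; the
    coefficients determine the law of the sum, and linear operations on sums act
    on coefficients. *)
Definition ms_sum (b : nat -> R) X : Prop :=
  measurable_fun setT X /\
  ((fun n => sqnorm (fun w => \sum_(k < n) b k * z k w - X w)) @ \oo --> 0%E).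

Lemma ms_sum_ext b b' X : b =1 b' -> ms_sum b X -> ms_sum b' X.
Proof. by move=> /funext ->. Qed.

Let mS := measurable_lincomb hz.

Lemma partial_sum_sub (b : nat -> R) n m w : (n <= m)%N ->
  \sum_(k < n) b k * z k w - \sum_(k < m) b k * z k w =
  \sum_(k < m) (if (n <= k)%N then - b k else 0) * z k w.
Proof.
move=> nm.
rewrite -(big_mkord xpredT (fun k => b k * z k w)) -(big_mkord xpredT (fun k => b k * z k w)).
rewrite -(big_mkord xpredT (fun k => (if (n <= k)%N then - b k else 0) * z k w)).
rewrite !(big_cat_nat (leq0n n) nm)//= opprD addrA subrr sub0r.
rewrite [X in _ = X + _]big_nat_cond [X in _ = X + _]big1 ?add0r; last first.
  by move=> k; rewrite andbT => /andP[_ kn]; rewrite leqNgt kn mul0r.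
rewrite -sumrN; apply: eq_big_nat => k /andP[nk _].
by rewrite nk mulNr.
Qed.

Lemma sqnorm_partial_sub (b : nat -> R) n m : (n <= m)%N ->
  sqnorm (fun w => \sum_(k < n) b k * z k w - \sum_(k < m) b k * z k w) =
  (\sum_(n <= k < m) b k ^+ 2)%:E.
Proof.
move=> nm; rewrite /sqnorm; under eq_integral do rewrite partial_sum_sub//.
rewrite (iid_sum_sqr hz (fun k => if (n <= k)%N then - b k else 0)); congr EFin.
rewrite -(big_mkord xpredT (fun k => (if (n <= k)%N then - b k else 0) ^+ 2)).
rewrite (big_cat_nat (leq0n n) nm)//= big_nat big1 ?add0r; last first.
  by move=> k /andP[_ kn]; rewrite leqNgt kn expr0n.
apply: eq_big_nat => k /andP[nk _].
by rewrite nk sqrrN.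
Qed.

Lemma ms_sum_near b X : ms_sum b X -> forall e : R, 0 < e ->
  exists N, forall n, (N <= n)%N ->
    (sqnorm (fun w => \sum_(k < n) b k * z k w - X w)%R <= e%:E)%E.
Proof.
move=> [mX /fine_cvgP[fX /cvgr0_norm_le cX]] e e0.
have [N1 _ h1] := fX; have [N2 _ h2] := cX _ e0.
exists (maxn N1 N2) => n; rewrite geq_max => /andP[n1 n2].
have := h2 n n2; rewrite /= ger0_norm; last by rewrite fine_ge0// sqnorm_ge0.
by move=> he; rewrite -[leLHS]fineK ?lee_fin//; exact: (h1 n n1).
Qed.

(** Compare with a later partial sum whose own error is negligible: by
    orthogonality the squared distance of two partial sums is a block of the
    series of squares. The factor [2] comes from the crude triangle inequality
    for squares. *)
Lemma ms_sum_tail b X n : ms_sum b X ->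
  (sqnorm (fun w => \sum_(k < n) b k * z k w - X w)%R <=
   2%:E * \sum_(n <= k <oo) (b k ^+ 2)%:E)%E.
Proof.
move=> hX; have [mX _] := hX; apply/lee_addgt0Pr => e e0.
have [N hN] := ms_sum_near hX (divr_gt0 e0 (ltr0n R 2)).
pose m := maxn n N.
have nm : (n <= m)%N by exact: leq_maxl.
have -> : (fun w => \sum_(k < n) b k * z k w - X w) = (fun w =>
   (\sum_(k < n) b k * z k w - \sum_(k < m) b k * z k w) +
   (\sum_(k < m) b k * z k w - X w)).
  by apply/funext => w; rewrite subrKA.
apply: le_trans (sqnormD _ _) _; [by apply: measurable_funB; exact: mS|
  by apply: measurable_funB => //; exact: mS|].
apply: leeD.
  rewrite lee_pmul2l// sqnorm_partial_sub// -sumEFin.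
  rewrite (nneseries_split _ (m - n))//; last by move=> k _; rewrite lee_fin sqr_ge0.
  rewrite subnKC// leeDl//.
  by apply: nneseries_ge0 => k _ _; rewrite lee_fin sqr_ge0.
have h2 : (0 <= 2%:E :> \bar R)%E by rewrite lee_fin.
apply: le_trans (lee_wpmul2l h2 (hN m (leq_maxr n N))) _.
by rewrite -EFinM mulrCA divff ?mulr1.
Qed.

Lemma ms_sum_bounded b X : ms_sum b X ->
  exists M, forall n, \sum_(k < n) b k ^+ 2 <= M.
Proof.
move=> hX; have [mX _] := hX; have [N hN] := ms_sum_near hX ltr01.
exists (\sum_(k < N) b k ^+ 2 + 4) => n.
have [nN|/ltnW Nn] := leqP n N.
  rewrite ler_wpDr// -!(big_mkord xpredT (fun k => b k ^+ 2)) (big_cat_nat (leq0n n) nN)//=.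
  by rewrite lerDl sumr_ge0// => k _; exact: sqr_ge0.
rewrite -!(big_mkord xpredT (fun k => b k ^+ 2)) (big_cat_nat (leq0n N) Nn)//= lerD2l.
rewrite -lee_fin -sqnorm_partial_sub//.
have -> : (fun w => \sum_(k < N) b k * z k w - \sum_(k < n) b k * z k w) = (fun w =>
   (\sum_(k < N) b k * z k w - X w) + (-1) * (\sum_(k < n) b k * z k w - X w)).
  by apply/funext => w; rewrite mulN1r opprB subrKA.
have mD m : measurable_fun setT (fun w => \sum_(k < m) b k * z k w - X w).
  by apply: measurable_funB => //; exact: mS.
apply: le_trans (sqnormD (mD N) _) _; first by apply: measurable_funM.
rewrite sqnormZ// sqrrN expr1n mul1e.
have -> : 4%:E = (2%:E * 1%:E + 2%:E * 1%:E)%E :> \bar R.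
  by rewrite -!EFinM -EFinD; congr EFin; ring.
by apply: leeD; rewrite lee_pmul2l// hN.
Qed.

Lemma ms_sum0 : ms_sum (fun=> 0) (fun=> 0).
Proof.
split=> //; rewrite (_ : (fun _ => _) = cst 0%E); first exact: cvg_cst.
apply/funext => n; rewrite /sqnorm; apply: integral0_eq => w _.
by rewrite big1 ?subr0 ?expr0n// => k _; rewrite mul0r.
Qed.

Lemma ms_sumD b X b' X' : ms_sum b X -> ms_sum b' X' ->
  ms_sum (fun k => b k + b' k) (fun w => X w + X' w).
Proof.
move=> [mX cX] [mX' cX']; split; first exact: measurable_funD.
have mD (c : nat -> R) Y m : measurable_fun setT Y ->
    measurable_fun setT (fun w => \sum_(k < m) c k * z k w - Y w).
  by move=> mY; apply: measurable_funB => //; exact: mS.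
have h : (fun n => 2%:E * sqnorm (fun w => \sum_(k < n) b k * z k w - X w)%R +
   2%:E * sqnorm (fun w => \sum_(k < n) b' k * z k w - X' w)%R)%E @ \oo --> 0%E.
  rewrite (_ : 0%E = (2%:E * 0 + 2%:E * 0)%E); last by rewrite mule0 adde0.
  by apply: cvgeD; [rewrite mule0|exact: cvgeZl..].
apply: squeeze_cvge h; last exact: cvg_cst.
apply: nearW => n; rewrite sqnorm_ge0 /=.
apply: le_trans (sqnormD (mD b X n mX) (mD b' X' n mX')).
rewrite le_eqVlt; apply/orP; left; apply/eqP; congr sqnorm; apply/funext => w.
under eq_bigr do rewrite mulrDl.
by rewrite big_split/= opprD addrACA.
Qed.

Lemma ms_sumZ c b X : ms_sum b X -> ms_sum (fun k => c * b k) (fun w => c * X w).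
Proof.
move=> [mX cX]; split; first exact: measurable_funM.
rewrite (_ : (fun _ => _) = (fun n => (c ^+ 2)%:E *
   sqnorm (fun w => \sum_(k < n) b k * z k w - X w)%R)%E).
  by rewrite -[X in _ --> X](mule0 (c ^+ 2)%:E); exact: cvgeZl.
apply/funext => n; rewrite -sqnormZ; last by apply: measurable_funB => //; exact: mS.
congr sqnorm; apply/funext => w; rewrite mulrBr mulr_sumr; congr (_ - _).
by apply: eq_bigr => k _; rewrite mulrA.
Qed.

Lemma ms_sum_lincomb n (c : 'I_n -> R) (b : 'I_n -> nat -> R) (X : 'I_n -> T -> R) :
  (forall i, ms_sum (b i) (X i)) ->
  ms_sum (fun k => \sum_(i < n) c i * b i k) (fun w => \sum_(i < n) c i * X i w).
Proof.
elim: n c b X => [|n IH] c b X h.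
  have := ms_sum0; congr ms_sum; apply/funext => x; by rewrite big_ord0.
have h1 := IH (fun i => c (widen_ord (leqnSn n) i)) _ _ (fun i => h (widen_ord (leqnSn n) i)).
have h2 := ms_sumZ (c ord_max) (h ord_max).
have := ms_sumD h1 h2.
by congr ms_sum; apply/funext => x; rewrite big_ord_recr.
Qed.

Lemma sqnorm0_ae X : measurable_fun setT X -> sqnorm X = 0%E ->
  {ae P, forall w, X w = 0}.
Proof.
move=> mX X0.
have X1 : (\int[P]_(w in setT) `|((X w) ^+ 2)%:E| = 0)%E.
  by rewrite -[RHS]X0; apply: eq_integral => w _; rewrite gee0_abs// lee_fin sqr_ge0.
have := (@ae_eq_integral_abs _ T R P setT measurableT _ (measurable_sqr mX)).1 X1.
apply: filterS => w /(_ I) /= /eqP; rewrite eqe sqrf_eq0 => /eqP; exact.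
Qed.

(** The standard normal density is at most [1]. *)
Lemma stdn_itv_le (x y : R) : x <= y ->
  (stdn `]-oo, y[ <= stdn `]-oo, x[ + (y - x)%:E)%E.
Proof.
move=> xy.
have -> : `]-oo, y[%classic = `]-oo, x[ `|` `[x, y[ :> set R.
  apply/seteqP; split => u /=; rewrite !in_itv/=.
    by move=> uy; have [ux|xu] := ltP u x; [left|right; rewrite uy].
  by case=> [|/andP[]//] => /lt_le_trans; exact.
apply: le_trans (measureU2 _ _ _) _ => //; rewrite leeD2l//.
suff: (stdn `[x, y[ <= (y - x)%:E)%E by [].
rewrite stdn_indic//.
have mi : measurable (`[x, y[%classic : set R) by exact: measurable_itv.
have -> : (y - x)%:E = (\int[@lebesgue_measure R]_u (\1_(`[x, y[) u)%:E)%E.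
  rewrite integral_indic// setIT.
  apply: etrans (esym (lebesgue_measure_itv `[x, y[)); rewrite /= lte_fin.
  by case: ltgtP xy => // -> _; rewrite subrr.
apply: ge0_le_integral => //.
- by move=> u _; rewrite lee_fin mulr_ge0 ?normal_pdf_ge0.
- apply/measurable_EFinP; apply: measurable_funM; last exact: measurable_normal_pdf.
  exact: measurable_indic.
- by apply/measurable_EFinP; exact: measurable_indic.
move=> u _; rewrite lee_fin ler_piMr//.
rewrite phiE mulr_ile1 ?invr_ge0 ?sqrtr_ge0 ?gexp_ge0//.
  rewrite invf_le1 ?sqrtr_gt0 ?mulr_gt0 ?pi_gt0//.
  rewrite -[leLHS]sqrtr1 ler_sqrt ?mulr_ge0 ?pi_ge0//; have := @pi_ge2 R; lra.
by rewrite /gexp -[leRHS]expR0 ler_expR oppr_le0 mul1r divr_ge0// sqr_ge0.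
Qed.

Lemma stdn_itv_lip (x y : R) :
  (stdn `]-oo, y[ <= stdn `]-oo, x[ + `|y - x|%:E)%E.
Proof.
have [xy|yx] := leP x y; first by rewrite ger0_norm ?subr_ge0// stdn_itv_le.
apply: (@le_trans _ _ (stdn `]-oo, x[)); last by rewrite leeDl.
apply: le_measure; rewrite ?inE//; try exact: measurable_itv.
by move=> u /=; rewrite !in_itv/= => /lt_trans; apply.
Qed.

Lemma preimage_scale_ray (s x : R) : 0 < s ->
  (fun u : R => s * u) @^-1` `]-oo, x[ = `]-oo, x / s[%classic.
Proof.
by move=> s0; apply/seteqP; split => u /=; rewrite !in_itv/= ltr_pdivlMr// mulrC.
Qed.

(** If [X < x] then [Y < x + e] unless [X] and [Y] differ by [e] or more, an event
    bounded by Chebyshev's inequality. *)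
Lemma prob_ray_le X Y (x e : R) : measurable_fun setT X -> measurable_fun setT Y -> 0 < e ->
  (P (X @^-1` `]-oo, x[) <= P (Y @^-1` `]-oo, (x + e)%R[) +
     ((e ^+ 2)^-1)%:E * sqnorm (fun w => X w - Y w)%R)%E.
Proof.
move=> mX mY e0.
have mXY : measurable_fun setT (fun w => X w - Y w) by exact: measurable_funB.
have mA : measurable [set w | e <= `|X w - Y w|].
  rewrite -[X in measurable X]setTI.
  rewrite (_ : [set w | _] = (fun w => `|X w - Y w|) @^-1` `[e, +oo[); last first.
    by apply/seteqP; split => w /=; rewrite in_itv/= andbT.
  have : measurable_fun setT (fun w => `|X w - Y w|).
    by apply: measurableT_comp => //; exact: measurable_normr.
  by apply.
have mY' := measurable_preimage mY (measurable_itv `]-oo, x + e[).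
apply: (@le_trans _ _ (P (Y @^-1` `]-oo, x + e[ `|` [set w | e <= `|X w - Y w|]))).
  apply: le_measure; rewrite ?inE; last 2 first.
  - exact: measurableU.
  - move=> w /=; rewrite !in_itv/= => Xx; have [//|h] := leP e `|X w - Y w|; first by right.
    left; move: h; rewrite ltr_norml => /andP[h _]; lra.
  exact: measurable_preimage.
apply: le_trans (measureU2 _ _ _) _ => //; rewrite leeD2l//.
rewrite lee_pdivlMl ?exprn_gt0//; exact: chebyshev_sqnorm.
Qed.

(** Partial sums are normal with standard deviations converging to some [s]. If
    [s = 0] the sum vanishes almost surely; otherwise the distribution functions
    of the partial sums approximate that of [X] up to a shift of the argument and
    a Chebyshev error, and the limiting one is Lipschitz. *)
Lemma ms_sum_gaussian b X : ms_sum b X -> exists2 s, 0 <= s & normal_law P X s.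
Proof.
move=> hX; have [mX _] := hX.
have [M hM] := ms_sum_bounded hX.
pose q n := \sum_(k < n) b k ^+ 2.
have qnd : nondecreasing_seq q.
  by apply/nondecreasing_seqP => n; rewrite /q big_ord_recr/= lerDl sqr_ge0.
have qc : cvgn q by apply: nondecreasing_is_cvgn => //; exists M => _ [n _ <-]; exact: hM.
have qle n : q n <= limn q by exact: nondecreasing_cvgn_le.
exists (Num.sqrt (limn q)); first exact: sqrtr_ge0.
have [q0|q0] := leP (limn q) 0.
  have b0 k : b k = 0.
    have := le_trans (qle k.+1) q0; rewrite /q big_ord_recr/= => h.
    apply/eqP; rewrite -sqrf_eq0 eq_le sqr_ge0 andbT; apply: le_trans h.
    by rewrite lerDr sumr_ge0// => i _; exact: sqr_ge0.
  have X0 : sqnorm X = 0%E.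
    apply/eqP; rewrite eq_le sqnorm_ge0 andbT; apply/lee_addgt0Pr => e e0; rewrite add0e.
    have [N /(_ N (leqnn N))] := ms_sum_near hX e0; apply: le_trans.
    apply: sqnorm_le => //; first by apply: measurable_funB => //; exact: mS.
    move=> w; rewrite big1 ?sub0r ?normrN// => k _; by rewrite b0 mul0r.
  move=> A mA; rewrite (ler0_sqrtr q0).
  have [A0|A0] := pselect (A 0).
    rewrite ((preimage_scale0 A).1 A0).
    rewrite probability_setT -(@probability_setT _ _ _ P); apply: ae_prob_eq => //.
      exact: measurable_preimage.
    by apply: filterS (sqnorm0_ae mX X0) => w /= ->.
  rewrite ((preimage_scale0 A).2 A0).
  rewrite measure0 -(@measure0 _ _ _ P); apply: ae_prob_eq => //.
    exact: measurable_preimage.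
  by apply: filterS (sqnorm0_ae mX X0) => w /= ->.
set s := Num.sqrt _; have s0 : 0 < s by rewrite sqrtr_gt0.
have sn : (fun n => Num.sqrt (q n)) @ \oo --> s.
  by apply: continuous_cvg => //; exact: sqrt_continuous.
have mX' : measurable_fun setT (X : T -> measurableTypeR R) by exact: mX.
have ms : measurable_fun setT ((fun x => s * x) : measurableTypeR R -> measurableTypeR R).
  exact: measurable_scale.
pose m2 := push_measure stdn ms.
suff h : forall A : set R, measurable A -> push_measure P mX' A = m2 A by move=> A mA; exact: h.
apply: distribution_unique.
- by rewrite /push_measure /= /pushforward preimage_setT probability_setT.
- by rewrite /push_measure /= /pushforward preimage_setT probability_setT.
move=> x.
suff main : forall e : R, 0 < e ->
    (P (X @^-1` `]-oo, x[) <= stdn `]-oo, (x / s)%R[ + e%:E)%E /\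
    (stdn `]-oo, (x / s)%R[ <= P (X @^-1` `]-oo, x[) + e%:E)%E.
  transitivity (P (X @^-1` `]-oo, x[)); first by [].
  transitivity (stdn `]-oo, x / s[); last first.
    by rewrite -preimage_scale_ray.
  by apply/eqP; rewrite eq_le; apply/andP; split;
    apply/lee_addgt0Pr => e /main [].
move=> e e0.
pose dl := e * s / 4.
have dl0 : 0 < dl by rewrite divr_gt0// mulr_gt0.
have cv (y : R) : (fun n => `|y / Num.sqrt (q n) - x / s|) @ \oo --> `|y / s - x / s|.
  apply: cvg_norm; apply: cvgB; last exact: cvg_cst.
  apply: cvgMr; apply: cvgV => //; exact: lt0r_neq0.
have lim (y : R) : `|y - x| = dl -> `|y / s - x / s| < e / 2.
  move=> h; rewrite -mulrBl normrM h /dl normfV (gtr0_norm s0) mulrAC mulfK ?lt0r_neq0//.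
  lra.
have hp := lim (x + dl); have hm := lim (x - dl).
have /hp {}hp : `|x + dl - x| = dl by rewrite addrC addKr gtr0_norm.
have /hm {}hm : `|x - dl - x| = dl by rewrite addrAC subrr sub0r normrN gtr0_norm.
have [N1 _ h1] : \forall n \near \oo, `|(x + dl) / Num.sqrt (q n) - x / s| < e / 2.
  exact: (cvgr_lt _ (cv _)).
have [N2 _ h2] : \forall n \near \oo, `|(x - dl) / Num.sqrt (q n) - x / s| < e / 2.
  exact: (cvgr_lt _ (cv _)).
have [N3 _ h3] : \forall n \near \oo, 0 < Num.sqrt (q n) by exact: (cvgr_gt _ sn).
have [N4 h4] := ms_sum_near hX (mulr_gt0 (exprn_gt0 2 dl0) (divr_gt0 e0 (ltr0n R 2))).
pose n := maxn (maxn N1 N2) (maxn N3 N4).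
have {}h1 := h1 n (leq_trans (leq_maxl N1 N2) (leq_maxl _ _)).
have {}h2 := h2 n (leq_trans (leq_maxr N1 N2) (leq_maxl _ _)).
have {}h3 := h3 n (leq_trans (leq_maxl N3 N4) (leq_maxr _ _)).
have {}h4 := h4 n (leq_trans (leq_maxr N3 N4) (leq_maxr _ _)).
have law := iid_sum_law hz b n.
have err : (((dl ^+ 2)^-1)%:E * sqnorm (fun w => \sum_(k < n) b k * z k w - X w)%R
    <= (e / 2)%:E)%E.
  by rewrite lee_pdivrMl ?exprn_gt0// -EFinM.
have sqnormC : sqnorm (fun w => X w - \sum_(k < n) b k * z k w) =
    sqnorm (fun w => \sum_(k < n) b k * z k w - X w).
  by apply: eq_integral => w _; rewrite -sqrrN opprB.
have e2 : e%:E = ((e / 2)%:E + (e / 2)%:E)%E by rewrite -EFinD -splitr.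
split.
  apply: le_trans (prob_ray_le x mX (mS b n) dl0) _.
  rewrite law// preimage_scale_ray// sqnormC e2 addeA; apply: leeD => //.
  by apply: le_trans (stdn_itv_lip (x / s) _) _; rewrite leeD2l// lee_fin ltW.
apply: le_trans (stdn_itv_lip ((x - dl) / Num.sqrt (q n)) _) _.
rewrite distrC e2 addeA addeAC; apply: leeD; last by rewrite lee_fin ltW.
rewrite -preimage_scale_ray// -law//.
have := prob_ray_le (x - dl) (mS b n) mX dl0; rewrite subrK => /le_trans; apply.
by rewrite leeD2l.
Qed.

Lemma normal_law_gaussian_rv X s : measurable_fun setT X -> normal_law P X s ->
  gaussian_rv P X.
Proof.
move=> mX lX; split=> //; exists 0, s => A mA; rewrite lX//.
case: (eqVneq s 0) => [->|s0]; last by apply/esym; exact: normal_prob_scale s0 mA.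
rewrite diracE; have [A0|A0] := pselect (A 0).
  rewrite ((preimage_scale0 A).1 A0).
  by rewrite probability_setT mem_set.
rewrite ((preimage_scale0 A).2 A0).
by rewrite measure0 memNset.
Qed.

Lemma ms_sum_gaussian_process (X : R -> T -> R) (b : R -> nat -> R) :
  (forall t, ms_sum (b t) (X t)) -> gaussian_process P X.
Proof.
move=> h n t c.
have hX := ms_sum_lincomb c (fun i => h (t i)).
by have [s _] := ms_sum_gaussian hX; apply: normal_law_gaussian_rv; case: hX.
Qed.

End mean_square.

(** * Integrals with a parameter and a weighted inequality *)

Section parameter_integrals.
Context {R : realType}.
Notation mu := (@lebesgue_measure R).

(** Tonelli's theorem applies to the positive and the negative part. *)
Lemma measurable_param_integral {d : measure_display} {T' : measurableType d}
    (f : measurableTypeR R * T' -> \bar R) :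
  measurable_fun setT f -> measurable_fun setT (fun y => (\int[mu]_t f (t, y))%E).
Proof.
move=> mf; under eq_fun do rewrite integralE.
apply: emeasurable_funB.
- rewrite (_ : (fun _ => _) = fubini_G mu (f^\+)%E); last first.
    by apply/funext => y; apply: eq_integral => t _; rewrite !funeposE.
  apply: (@measurable_fun_fubini_tonelli_G _ _ _ T' R mu _ (measurable_funepos mf)) => z.
  exact: funepos_ge0.
- rewrite (_ : (fun _ => _) = fubini_G mu (f^\-)%E); last first.
    by apply/funext => y; apply: eq_integral => t _; rewrite !funenegE.
  apply: (@measurable_fun_fubini_tonelli_G _ _ _ T' R mu _ (measurable_funeneg mf)) => z.
  exact: funeneg_ge0.
Qed.

Lemma measurable_param_intR {d : measure_display} {T' : measurableType d}
    (f : measurableTypeR R * T' -> R) :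
  measurable_fun setT f -> measurable_fun setT (fun y => intR (fun t => f (t, y))).
Proof.
move=> mf; apply: measurableT_comp => //.
by apply: (@measurable_param_integral _ _ (EFin \o f)); apply/measurable_EFinP.
Qed.

(** The Cauchy-Schwarz inequality with the weight [1 + t^2], whose inverse has
    integral [pi]; it is obtained from the arithmetic-geometric mean
    inequality with a free scale [l], optimised at the end. *)
Lemma weighted_l1 (f : R -> R) (D : R) : measurable_fun setT f ->
  (\int[mu]_t ((1 + t ^+ 2) * f t ^+ 2)%:E = D%:E)%E ->
  integrableR f /\ (intR (fun t => `|f t|)) ^+ 2 <= pi * D.
Proof.
move=> mf hD.
have w0 (t : R) : 0 < 1 + t ^+ 2 by rewrite ltr_pwDl// sqr_ge0.
have g0 (t : R) : 0 <= (1 + t ^+ 2) * f t ^+ 2 by rewrite mulr_ge0 ?sqr_ge0// ltW.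
have ig : integrableR (fun t => (1 + t ^+ 2) * f t ^+ 2).
  apply/integrableP; split.
    apply/measurable_EFinP; apply: measurable_funM; last exact: measurable_funX.
    by apply: measurable_funD => //; exact: measurable_funX.
  by under eq_integral do rewrite /= ger0_norm//; rewrite hD ltry.
have [ih eh] := @integrable_invonesqr R.
have amgm l t : 0 < l ->
    `|f t| <= l / 2 * ((1 + t ^+ 2) * f t ^+ 2) + (2 * l)^-1 * (1 + t ^+ 2)^-1.
  move=> l0; have := w0 t; move: (1 + t ^+ 2) => a a0.
  have -> : f t ^+ 2 = `|f t| ^+ 2 by rewrite real_normK// num_real.
  move: `|f t| => x; rewrite -subr_ge0.
  have -> : l / 2 * (a * x ^+ 2) + (2 * l)^-1 * a^-1 - x = (l * a * x - 1) ^+ 2 / (2 * l * a).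
    by field; rewrite !gt_eqF.
  by rewrite divr_ge0 ?sqr_ge0// !mulr_ge0// ltW.
have iS l : integrableR (fun t => l / 2 * ((1 + t ^+ 2) * f t ^+ 2) + (2 * l)^-1 * (1 + t ^+ 2)^-1).
  by apply: integrableRD; exact: integrableRZ.
have fi : integrableR f.
  by apply: (integrableR_le mf (iS 1)) => t; exact: amgm.
split=> //; set I := intR _.
have eD : intR (fun t => (1 + t ^+ 2) * f t ^+ 2) = D.
  by rewrite /intR /Rintegral hD.
have bound l : 0 < l -> I <= l / 2 * D + (2 * l)^-1 * pi.
  move=> l0; rewrite -eD -eh -!intR_scale// -intR_add; [|exact: integrableRZ..].
  by apply: (le_intR (integrableR_norm fi) (iS l)) => t; exact: amgm.
have I0 : 0 <= I by apply: intR_ge0.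
have D0 : 0 <= D by rewrite -eD; apply: intR_ge0.
have pi0 := @pi_gt0 R.
(* [l = pi / I] balances the two terms of the bound. *)
have [I1|I1] := leP I 0.
  have -> : I = 0 by apply/eqP; rewrite eq_le I1.
  by rewrite expr0n/= mulr_ge0// ltW.
have aux (p i : R) : 0 < p -> 0 < i -> i <= p / i / 2 * D + (2 * (p / i))^-1 * p ->
    i ^+ 2 <= p * D.
  move=> p0 i0.
  have -> : (2 * (p / i))^-1 * p = i / 2 by field; rewrite !gt_eqF.
  have -> : p / i / 2 * D = p * D / (2 * i) by field; rewrite !gt_eqF.
  move=> h; have : i / 2 <= p * D / (2 * i) by lra.
  by rewrite ler_pdivlMr ?mulr_gt0//; nra.
exact: aux pi0 I1 (bound (pi / I) (divr_gt0 pi0 I1)).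
Qed.

End parameter_integrals.

(** * The series of the process in weighted mean square *)

Section kappa.
Context {R : realType} {d : measure_display} {T : measurableType d}.
Variable P : probability T R.
Variable z : nat -> T -> R.
Hypothesis hz : iid_std_normal P z.
Variable a : nat -> R.
Hypothesis a_odd : forall m, a m.*2.+1 ^+ 2 <= a m.*2 ^+ 2.
Notation mu := (@lebesgue_measure R).

(** The coefficient of [z k] in the series of the process at [t]. *)
Definition beta (t : R) (k : nat) : R :=
  (Num.sqrt (2 * pi))^-1 * gexp 1 t * (a k / Num.sqrt (k`!)%:R) * (hermite k).[t].

Variable kappa : R -> T -> R.
Hypothesis mkappa : measurable_fun [set: measurableTypeR R * T] (fun p => kappa p.1 p.2).
Hypothesis hkappa : forall t, ms_sum P z (beta t) (kappa t).

(** Up to constants, a bound for the weighted square norm of [beta] in [t] and for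
    the squared tails of its inverse transform; its summability is what
    convergence of the series at [t = 0] says. *)
Definition rho k := a k ^+ 2 * cbin k./2.

Lemma rho_ge0 k : 0 <= rho k.
Proof. by rewrite mulr_ge0 ?sqr_ge0// cbin_ge0. Qed.

Let sq2pi : Num.sqrt (2 * pi) ^+ 2 = 2 * pi :> R.
Proof. by rewrite sqr_sqrtr// mulr_ge0// pi_ge0. Qed.

Let fact_gt0R k : 0 < k`!%:R :> R. Proof. by rewrite ltr0n fact_gt0. Qed.

Lemma beta_sqr t k :
  beta t k ^+ 2 = (2 * pi)^-1 * gexp 1 t ^+ 2 * (a k ^+ 2 / k`!%:R) * (hermite k).[t] ^+ 2.
Proof.
rewrite /beta !exprMn !exprVn sq2pi; congr (_ * (_ * _) * _).
by rewrite sqr_sqrtr// ltW.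
Qed.

Lemma rho_double m : rho m.*2 = 2 * pi * beta 0 m.*2 ^+ 2.
Proof.
rewrite beta_sqr gexp0 expr1n mulr1 hermite_at0 /rho doubleK.
have := @pi_gt0 R; have := fact_gt0R m.*2.
by move: (pi) (m.*2`!%:R) => p f f0 p0; field; rewrite !gt_eqF.
Qed.

Lemma rho_doubleS m : rho m.*2.+1 <= rho m.*2.
Proof.
by rewrite /rho -uphalfE uphalf_double doubleK ler_wpM2r ?cbin_ge0.
Qed.

(** At [t = 0] the odd terms of the series vanish and the even ones have square
    [rho / (2 pi)]; the odd values of [rho] are dominated by the even ones because
    [|Y| <= 1]. *)
Lemma rho_summable : (\sum_(0 <= k <oo) (rho k)%:E < +oo)%E.
Proof.
have [M hM] := ms_sum_bounded hz (hkappa 0).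
have [K K0 hK] : exists2 K : R, 0 <= K & forall m, 2 * rho m.*2 <= K * beta 0 m.*2 ^+ 2.
  exists (2 * (2 * pi)); first by rewrite mulr_ge0// mulr_ge0// pi_ge0.
  by move=> m; rewrite rho_double mulrA.
have key n : \sum_(k < n.*2) rho k <= K * \sum_(k < n.*2) beta 0 k ^+ 2.
  elim: n => [|n IH]; first by rewrite !big_ord0 mulr0.
  rewrite doubleS !big_ord_recr/=.
  have := hK n; have := rho_doubleS n; have := mulr_ge0 K0 (sqr_ge0 (beta 0 n.*2.+1)).
  move: (\sum_(i < _) rho i) (\sum_(i < _) beta 0 i ^+ 2) IH => x y; lra.
apply: (@le_lt_trans _ _ (K * M)%:E); last exact: ltry.
apply: lime_le.
  by apply: is_cvg_nneseries => k _ _; rewrite lee_fin rho_ge0.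
apply: nearW => n; rewrite big_mkord sumEFin lee_fin.
apply: (@le_trans _ _ (\sum_(k < n.*2) rho k)).
  rewrite -!(big_mkord xpredT rho) (big_cat_nat (leq0n n) (_ : (n <= n.*2)%N))//=.
    by rewrite lerDl sumr_ge0// => k _; exact: rho_ge0.
  by rewrite -addnn leq_addr.
by apply: le_trans (key n) _; rewrite ler_wpM2l.
Qed.

(** The constant of [hermite_sqr_weight_norm] divided by the normalisation of the
    Gaussian weight. *)
Let C : R := (2 * pi)^-1 * (5 / 2) * Num.sqrt pi.

Let C0 : 0 <= C.
Proof. by rewrite !mulr_ge0 ?invr_ge0 ?sqrtr_ge0// mulr_ge0// pi_ge0. Qed.

Lemma integrable_beta k : integrableR (beta ^~ k).
Proof.
rewrite (_ : beta ^~ k = fun t => (Num.sqrt (2 * pi))^-1 * (a k / Num.sqrt (k`!)%:R) *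
   ((hermite k).[t] * gexp 1 t)).
  by apply: integrableRZ; exact: integrable_gcos0.
by apply/funext => t; rewrite /beta; ring.
Qed.

Lemma measurable_beta k : measurable_fun setT (beta ^~ k).
Proof. exact: measurable_integrableR (integrable_beta k). Qed.

Lemma beta_weight_norm k :
  (\int[mu]_t ((1 + t ^+ 2) * beta t k ^+ 2)%:E <= (C * rho k)%:E)%E.
Proof.
have e t : (1 + t ^+ 2) * beta t k ^+ 2 = (2 * pi)^-1 * (a k ^+ 2 / k`!%:R) *
    (((1 + 'X^2) * hermite k ^+ 2).[t] * gexp 2 t).
  have -> : gexp 2 t = gexp 1 t ^+ 2.
    by rewrite /gexp -[expR (- (1 * _ / 2))^+2]expRM_natl; congr expR; field.
  by rewrite beta_sqr hornerM hornerD hornerC hornerXn horner_exp; ring.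
have ig := @integrable_gcos0 R 2 ((1 + 'X^2) * hermite k ^+ 2) (ltr0n R 2).
under eq_integral do rewrite e.
rewrite -EFin_intR; last exact: integrableRZ.
rewrite intR_scale// -gcos0E lee_fin.
have c0 : 0 <= (2 * pi)^-1 * (a k ^+ 2 / k`!%:R) :> R.
  by rewrite mulr_ge0 ?invr_ge0 ?divr_ge0 ?sqr_ge0// ?mulr_ge0 ?pi_ge0// ltW.
apply: le_trans (ler_wpM2l c0 (hermite_sqr_weight_norm k)) _.
have -> : (2 * pi)^-1 * (a k ^+ 2 / k`!%:R) * (5 / 2 * (Num.sqrt pi * k`!%:R * cbin k)) =
    C * (a k ^+ 2 * cbin k) :> R.
  rewrite /C; have := @pi_gt0 R; have := fact_gt0R k.
  by move: (pi) (Num.sqrt _) (k`!%:R) => p q f f0 p0; field; rewrite !gt_eqF.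
rewrite ler_wpM2l// ler_wpM2l ?sqr_ge0//; apply: cbin_anti.
by rewrite leq_half_double -addnn leqW// leq_addr.
Qed.

Definition err n t w := \sum_(k < n) beta t k * z k w - kappa t w.
(** The weight makes this norm of the error control its integrals over the whole
    line. *)
Definition pathnorm n w : \bar R := (\int[mu]_t ((1 + t ^+ 2) * err n t w ^+ 2)%:E)%E.

Let mz := iid_measurable hz.

Lemma measurable_err n :
  measurable_fun [set: measurableTypeR R * T] (fun p => err n p.1 p.2).
Proof.
apply: measurable_funB => //; apply: measurable_sum => k; apply: measurable_funM.
  by apply: (measurableT_comp (measurable_beta k)); exact: measurable_fst.
by apply: (measurableT_comp (mz k)); exact: measurable_snd.
Qed.

Lemma measurable_err_sqr n : measurable_fun [set: measurableTypeR R * T]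
  (fun p => ((1 + p.1 ^+ 2) * err n p.1 p.2 ^+ 2)%:E).
Proof.
apply/measurable_EFinP; apply: measurable_funM; last first.
  by apply: measurable_funX; exact: measurable_err.
apply: measurable_funD => //; apply: measurable_funX.
exact: measurable_fst.
Qed.

Lemma pathnorm_ge0 n w : (0 <= pathnorm n w)%E.
Proof.
apply: integral_ge0 => t _; rewrite lee_fin mulr_ge0 ?sqr_ge0//.
by rewrite addr_ge0// sqr_ge0.
Qed.

Lemma measurable_pathnorm n : measurable_fun setT (pathnorm n).
Proof. exact: (measurable_param_integral (measurable_err_sqr n)). Qed.

(** Tonelli's theorem exchanges the expectation and the integral over [t]; for
    fixed [t] the mean square error is at most twice the tail of the squared
    coefficients. *)
Lemma pathnorm_expectation n :
  (\int[P]_w pathnorm n w <= (2 * C)%:E * \sum_(n <= k <oo) (rho k)%:E)%E.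
Proof.
have w0 (t : R) : 0 <= 1 + t ^+ 2 by rewrite addr_ge0// sqr_ge0.
have e0 (p : measurableTypeR R * T) :
    (0 <= ((1 + p.1 ^+ 2) * err n p.1 p.2 ^+ 2)%:E)%E.
  by rewrite lee_fin mulr_ge0 ?sqr_ge0.
have -> : (\int[P]_w pathnorm n w =
    \int[mu]_t \int[P]_w ((1 + t ^+ 2) * err n t w ^+ 2)%:E)%E.
  apply/esym.
  exact: (@fubini_tonelli _ _ _ _ _ mu P _ (measurable_err_sqr n) e0).
pose g k t : \bar R := if (n <= k)%N then (2 * ((1 + t ^+ 2) * beta t k ^+ 2))%:E else 0%E.
have g0 k t : (0 <= g k t)%E.
  by rewrite /g; case: ifP => // _; rewrite lee_fin mulr_ge0// mulr_ge0 ?sqr_ge0.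
have mg k : measurable_fun [set: measurableTypeR R] (g k).
  rewrite /g; case: (n <= k)%N => //.
  apply/measurable_EFinP; apply: measurable_funM => //; apply: measurable_funM.
    by apply: measurable_funD => //; exact: measurable_funX.
  by apply: measurable_funX; exact: measurable_beta.
have me t : measurable_fun setT (err n t).
  exact: (@measurable_fun_pair2 _ _ _ (measurableTypeR R) T _ _ t (measurable_err n)).
apply: (@le_trans _ _ (\int[mu]_t \sum_(k <oo) g k t)%E).
  apply: ge0_le_integral => //.
  - by move=> t _; apply: integral_ge0 => w _; exact: (e0 (t, w)).
  - have := @measurable_fun_fubini_tonelli_F _ _ _ _ R P _ (measurable_err_sqr n) e0.
    exact.
  - exact: ge0_emeasurable_sum.
  move=> t _.
  have -> : (\int[P]_w ((1 + t ^+ 2) * err n t w ^+ 2)%:E = (1 + t ^+ 2)%:E *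
      sqnorm P (err n t))%E.
    rewrite /sqnorm -ge0_integralZl_EFin//.
    by move=> w _; rewrite lee_fin sqr_ge0.
    by apply/measurable_EFinP; exact: measurable_funX.
  apply: le_trans (lee_wpmul2l _ (ms_sum_tail hz n (hkappa t))) _.
    by rewrite lee_fin.
  rewrite muleA -EFinM -nneseriesZl; last by move=> k _; rewrite lee_fin sqr_ge0.
  rewrite eseries_cond eseries_mkcond; apply: lee_nneseries => k _.
    by move=> _; case: ifP => // _; rewrite -EFinM lee_fin mulr_ge0 ?sqr_ge0// mulr_ge0.
  rewrite /g andTb; case: ifP => // _; rewrite -EFinM lee_fin.
  by rewrite [(_ + _) * 2]mulrC mulrA.
rewrite integral_nneseries//.
rewrite -nneseriesZl; last by move=> k _; rewrite lee_fin rho_ge0.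
rewrite [leRHS]eseries_cond [leRHS]eseries_mkcond; apply: lee_nneseries => k _.
  by move=> _; apply: integral_ge0.
rewrite /g andTb; case: ifP => _; last by rewrite integral0.
under eq_integral do rewrite EFinM.
rewrite ge0_integralZl_EFin//.
- rewrite -EFinM -mulrA EFinM; apply: lee_wpmul2l => //; exact: beta_weight_norm.
- by move=> t _; rewrite lee_fin mulr_ge0 ?sqr_ge0.
- apply/measurable_EFinP; apply: measurable_funM.
    by apply: measurable_funD => //; exact: measurable_funX.
  by apply: measurable_funX; exact: measurable_beta.
Qed.

Lemma pathnorm_expectation_cvg0 : (\int[P]_w pathnorm n w)%E @[n --> \oo] --> 0%E.
Proof.
have h : ((2 * C)%:E * \sum_(n <= k <oo) (rho k)%:E)%E @[n --> \oo] --> 0%E.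
  rewrite -[X in _ --> X](mule0 (2 * C)%:E); apply: cvgeZl => //.
  apply: (nneseries_tail_cvg rho_summable).
  by move=> k _; rewrite lee_fin rho_ge0.
apply: squeeze_cvge h; last exact: cvg_cst.
apply: nearW => n; rewrite pathnorm_expectation andbT.
by apply: integral_ge0 => w _; exact: pathnorm_ge0.
Qed.

Lemma integrable_pathnorm n w D : pathnorm n w = D%:E ->
  [/\ integrableR (err n ^~ w), intR (fun t => `|err n t w|) ^+ 2 <= pi * D &
      integrableR (kappa ^~ w)].
Proof.
move=> hD.
have me : measurable_fun [set: R] (err n ^~ w).
  exact: (@measurable_fun_pair1 _ _ _ (measurableTypeR R) T _ _ w (measurable_err n)).
have [ie l1] := weighted_l1 me hD; split=> //.
have [iS _] := intR_lincomb (z ^~ w) n integrable_beta.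
rewrite (_ : kappa ^~ w = fun t => \sum_(k < n) beta t k * z k w - err n t w).
  exact: integrableRB.
by apply/funext => t; rewrite /err opprB addrC subrK.
Qed.

(** The infimum of the path norms over [n >= N] has expectation zero, so the
    paths converge along a random subsequence, which is enough for limits that
    are known to exist. *)
Lemma pathnorm_small : {ae P, forall w, forall N (e : R), 0 < e ->
  exists2 n, (N <= n)%N & (pathnorm n w < e%:E)%E}.
Proof.
have h N : {ae P, forall w, einfs (pathnorm ^~ w) N = 0%E}.
  have me : measurable_fun setT (fun w => einfs (pathnorm ^~ w) N).
    by apply: measurable_fun_einfs => n; exact: measurable_pathnorm.
  have e0 w : (0 <= einfs (pathnorm ^~ w) N)%E.
    by apply: le_ereal_inf_tmp => _ [n _ <-]; exact: pathnorm_ge0.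
  have i0 : (\int[P]_(w in setT) `|einfs (pathnorm ^~ w) N| = 0)%E.
    under eq_integral do rewrite gee0_abs//.
    apply/eqP; rewrite eq_le; apply/andP; split; last by apply: integral_ge0.
    apply/lee_addgt0Pr => e e0'; rewrite add0e.
    have /fine_cvgP[fX /cvgr0_norm_le cX] := pathnorm_expectation_cvg0.
    have [N1 _ h1] := fX; have [N2 _ h2] := cX _ e0'.
    pose n := maxn N (maxn N1 N2).
    have n1 : (N1 <= n)%N by rewrite /n !leq_max leqnn orbT.
    have n2 : (N2 <= n)%N by rewrite /n !leq_max leqnn !orbT.
    apply: (@le_trans _ _ (\int[P]_w pathnorm n w)%E).
      apply: ge0_le_integral => //.
      - exact: measurable_pathnorm.
      - move=> w _; apply: ereal_inf_lbound; exists n => //=; exact: leq_maxl.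
    have := h2 n n2; rewrite /= ger0_norm; last first.
      by rewrite fine_ge0// integral_ge0// => w _; exact: pathnorm_ge0.
    by move=> he; rewrite -[leLHS]fineK ?lee_fin//; exact: (h1 n n1).
  have := (@ae_eq_integral_abs _ T R P setT measurableT _ me).1 i0.
  by apply: filterS => w /(_ I).
have := ae_foralln h; apply: filterS => w hw N e e0.
have : (einfs (pathnorm ^~ w) N < e%:E)%E by rewrite hw lte_fin.
by move=> /ereal_inf_lt[_ [n Nn <-]]; exists n.
Qed.

Lemma kappa_path_integrable : {ae P, forall w, integrableR (kappa ^~ w)}.
Proof.
apply: filterS pathnorm_small => w /(_ 0%N 1 ltr01)[n _ h].
have /fineK/esym/integrable_pathnorm[] // : pathnorm n w \is a fin_num.
by rewrite ge0_fin_numE ?pathnorm_ge0// (lt_trans h)// ltry.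
Qed.

End kappa.

(** * Fourier transforms of the paths *)

Section transforms.
Context {R : realType} {d : measure_display} {T : measurableType d}.
Variable P : probability T R.
Variable z : nat -> T -> R.
Hypothesis hz : iid_std_normal P z.
Variable a : nat -> R.
Hypothesis a_odd : forall m, a m.*2.+1 ^+ 2 <= a m.*2 ^+ 2.
Hypothesis a_le1 : forall k, `|a k| <= 1.
Notation mu := (@lebesgue_measure R).
Variable kappa : R -> T -> R.
Hypothesis mkappa : measurable_fun [set: measurableTypeR R * T] (fun p => kappa p.1 p.2).
Hypothesis hkappa : forall t, ms_sum P z (beta a t) (kappa t).
Let mz := iid_measurable hz.
Let pathnorm_nneg := pathnorm_ge0 z a kappa.
Let mpathnorm := measurable_pathnorm hz a mkappa.

(** The expected path norm tends to zero, so a pathwise bound of the error by a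
    multiple of it suffices. *)
Lemma ms_sum_of_pathnorm (b : nat -> R) (X : T -> R) (K : R) : measurable_fun setT X ->
  (forall n w, (((\sum_(k < n) b k * z k w - X w)%R ^+ 2)%:E <= K%:E * pathnorm z a kappa n w)%E) ->
  0 <= K -> ms_sum P z b X.
Proof.
move=> mX hX K0; split => //.
have mS := measurable_lincomb hz b.
have h : (K%:E * \int[P]_w pathnorm z a kappa n w)%E @[n --> \oo] --> 0%E.
  rewrite -[X in _ --> X](mule0 K%:E); apply: cvgeZl => //.
  exact: (pathnorm_expectation_cvg0 hz a_odd mkappa hkappa).
apply: squeeze_cvge h; last exact: cvg_cst.
apply: nearW => n; rewrite sqnorm_ge0/= -ge0_integralZl_EFin//.
apply: ge0_le_integral => //.
- by move=> w _; rewrite lee_fin sqr_ge0.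
- by apply: measurable_sqr; apply: measurable_funB mX; exact: mS.
- exact: measurable_funeM.
- by move=> w _; exact: hX.
Qed.

(** Where the path norm is infinite there is nothing to prove, so the estimate
    holds for every outcome; where it is finite the path is integrable and
    [weighted_l1] applies to the error. *)
Lemma bounded_functional_error (h : R -> R) n w : measurable_fun setT h ->
  (forall t, `|h t| <= 1) ->
  (((\sum_(k < n) intR (fun t => h t * beta a t k) * z k w - intR (fun t => h t * kappa t w)) ^+ 2)%:E
    <= pi%:E * pathnorm z a kappa n w)%E.
Proof.
move=> mh h1; have := pathnorm_ge0 z a kappa n w; case e : (pathnorm z a kappa n w) => [D| |] // D0.
  rewrite -EFinM lee_fin.
  have [ie le ik] := integrable_pathnorm hz mkappa e.
  apply: le_trans le.
  have [iSn eSn] := intR_lincomb (z ^~ w) n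
    (fun k => integrable_bounded_mul mh h1 (integrable_beta a k)).
  rewrite -eSn -intR_sub//; last exact: integrable_bounded_mul.
  rewrite (_ : (fun _ => _) = (fun t => h t * err z a kappa n t w)); last first.
    apply/funext => t; rewrite /err mulrBr mulr_sumr; congr (_ - _).
    by apply: eq_bigr => k _; rewrite [RHS]mulrA.
  have ih := integrable_bounded_mul mh h1 ie.
  rewrite -(real_normK (num_real (intR _))) lerXn2r ?nnegrE//; first exact: intR_ge0.
  apply: le_trans (ler_norm_intR ih) _.
  apply: le_intR; [exact: integrableR_norm|exact: integrableR_norm|].
  by move=> t; rewrite normrM ler_piMl.
by rewrite gt0_muley ?lte_fin ?pi_gt0// leey.
Qed.

Lemma ms_sum_bounded_functional (h : R -> R) : measurable_fun setT h ->
  (forall t, `|h t| <= 1) ->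
  ms_sum P z (fun k => intR (fun t => h t * beta a t k)) (fun w => intR (fun t => h t * kappa t w)).
Proof.
move=> mh h1; apply: (@ms_sum_of_pathnorm _ _ pi) => //.
- apply: (@measurable_param_intR _ _ _ (fun p => h p.1 * kappa p.1 p.2)).
  apply: measurable_funM => //.
  by apply: (measurableT_comp mh); exact: measurable_fst.
- by move=> n w; exact: bounded_functional_error.
- exact: pi_ge0.
Qed.

(** The Fourier transform of [beta] is [i ^ k] times this real function. *)
Definition upsilon theta k : R := a k / Num.sqrt (k`!)%:R * theta ^+ k * gexp 1 theta.

Lemma beta_transform theta k :
  intR (fun t => cos (theta * t) * beta a t k) = re_i k * upsilon theta k /\
  intR (fun t => sin (theta * t) * beta a t k) = im_i k * upsilon theta k.
Proof.
have [hc hs] := @hermite_transform R k theta.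
have s0 : Num.sqrt (2 * pi) != 0 :> R.
  by rewrite gt_eqF// sqrtr_gt0 mulr_gt0// pi_gt0.
split.
- rewrite (_ : (fun _ => _) = fun t => (Num.sqrt (2 * pi))^-1 * (a k / Num.sqrt (k`!)%:R) *
     ((hermite k).[t] * gexp 1 t * cos (theta * t))).
    rewrite intR_scale; last exact: integrable_gcos.
    rewrite -/(gcos 1 (hermite k) theta) hc /upsilon.
    by move: (a k / _) (re_i k) => A B; field.
  by apply/funext => t; rewrite /beta; ring.
- rewrite (_ : (fun _ => _) = fun t => (Num.sqrt (2 * pi))^-1 * (a k / Num.sqrt (k`!)%:R) *
     ((hermite k).[t] * gexp 1 t * sin (theta * t))).
    rewrite intR_scale; last exact: integrable_gsin.
    rewrite -/(gsin 1 (hermite k) theta) hs /upsilon.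
    by move: (a k / _) (im_i k) => A B; field.
  by apply/funext => t; rewrite /beta; ring.
Qed.

Definition ctrans theta w := intR (fun t => cos (theta * t) * kappa t w).
Definition strans theta w := intR (fun t => sin (theta * t) * kappa t w).

Lemma ms_sum_ctrans theta :
  ms_sum P z (fun k => re_i k * upsilon theta k) (ctrans theta).
Proof.
have := ms_sum_bounded_functional (measurable_cosM theta) (fun t => cos_le1 (theta * t)).
by apply: ms_sum_ext => k; rewrite (beta_transform theta k).1.
Qed.

Lemma ms_sum_strans theta :
  ms_sum P z (fun k => im_i k * upsilon theta k) (strans theta).
Proof.
have := ms_sum_bounded_functional (measurable_sinM theta) (fun t => sin_le1 (theta * t)).
by apply: ms_sum_ext => k; rewrite (beta_transform theta k).2.
Qed.

Lemma geometric4_le n : \sum_(k < n) (4^-1) ^+ k <= 2 - 2 * (4^-1) ^+ n :> R.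
Proof.
elim: n => [|n IH]; first by rewrite big_ord0 expr0 mulr1 subrr.
rewrite big_ord_recr/= exprS; have : 0 <= (4^-1) ^+ n :> R by rewrite exprn_ge0// invr_ge0.
move: ((4^-1) ^+ n) (\sum_(i < n) _) IH => x y; lra.
Qed.

(** The sum of the [4 ^ - k z_k ^ 2] has finite expectation. *)
Lemma sequence_growth : {ae P, forall w, exists C, forall k, `|z k w| <= C * 2 ^+ k}.
Proof.
pose g k w : \bar R := ((4^-1) ^+ k * (z k w) ^+ 2)%:E.
have g0 k w : (0 <= g k w)%E by rewrite lee_fin mulr_ge0 ?sqr_ge0// exprn_ge0// invr_ge0.
have mg k : measurable_fun setT (g k).
  by apply/measurable_EFinP; apply: measurable_funM => //; exact: measurable_funX.
have Eg k : (\int[P]_w g k w = ((4^-1) ^+ k)%:E)%E.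
  rewrite /g; under eq_integral do rewrite EFinM.
  rewrite ge0_integralZl_EFin//; first last.
  - exact: measurable_sqr.
  - by move=> w _; rewrite lee_fin sqr_ge0.
  rewrite (@normal_law_sqr _ _ _ P (z k) 1) ?expr1n ?mule1//.
  move=> A mA; rewrite (iid_law hz)//; congr (normal_prob _ _ _).
  by apply/seteqP; split => x /=; rewrite mul1r.
have mS : measurable_fun setT (fun w => \sum_(k <oo) g k w)%E by exact: ge0_emeasurable_sum.
have iS : P.-integrable setT (fun w => \sum_(k <oo) g k w)%E.
  apply/integrableP; split => //.
  under eq_integral do rewrite gee0_abs ?nneseries_ge0//.
  rewrite integral_nneseries//; apply: (@le_lt_trans _ _ 2%:E); last exact: ltry.
  apply: lime_le; first by apply: is_cvg_nneseries => k _ _; exact: integral_ge0.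
  apply: nearW => n; rewrite big_mkord; under eq_bigr do rewrite Eg.
  rewrite sumEFin lee_fin; apply: le_trans (geometric4_le n) _.
  by rewrite gerBl mulr_ge0// exprn_ge0// invr_ge0.
have := integrable_ae measurableT iS; apply: filterS => w /(_ I).
set S := (\sum_(k <oo) g k w)%E => fS.
have S0 : (0 <= S)%E by exact: nneseries_ge0.
exists (fine S + 1) => k.
have : (g k w <= S)%E.
  apply: le_trans (nneseries_lim_ge k.+1 _) => //; rewrite big_mkord big_ord_recr/=.
  by rewrite leeDr// sume_ge0.
rewrite -[S]fineK// lee_fin exprVn ler_pdivrMl ?exprn_gt0// => h.
have f0 : 0 <= fine S by exact: fine_ge0.
rewrite -(@ler_pXn2r _ 2)// ?nnegrE//; last by rewrite mulr_ge0 ?exprn_ge0// addr_ge0.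
rewrite real_normK ?num_real//; apply: le_trans h _.
have -> : 4 ^+ k = (2 ^+ k) ^+ 2 :> R by rewrite -exprM mulnC exprM; congr (_ ^+ _); ring.
rewrite exprMn [leRHS]mulrC ler_wpM2l ?sqr_ge0//.
by rewrite /=; move: (fine S) f0 => s s0; nra.
Qed.

(** The terms are dominated by [C x ^ k / sqrt k!] with [x = 2 |theta|], and
    [x ^ k / sqrt k! <= (4 ^ - k + (4 x ^ 2) ^ k / k!) / 2], the arithmetic-geometric
    mean of a geometric and an exponential series. *)
Lemma upsilon_series_cvg w theta (c : nat -> R) : (forall k, `|c k| <= 1) ->
  (exists C, forall k, `|z k w| <= C * 2 ^+ k) ->
  cvgn (fun n => \sum_(k < n) c k * upsilon theta k * z k w).
Proof.
move=> c1 [C hC].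
have C0 : 0 <= C by have := le_trans (normr_ge0 _) (hC 0%N); rewrite expr0 mulr1.
pose x := 2 * `|theta|.
have x0 : 0 <= x by rewrite mulr_ge0.
pose v k : R := C / 2 * ((4^-1) ^+ k + (4 * x ^+ 2) ^+ k / k`!%:R).
have bound k : `|c k * upsilon theta k * z k w| <= v k.
  have f0 : 0 < k`!%:R :> R by rewrite ltr0n fact_gt0.
  have s0 : 0 < Num.sqrt k`!%:R :> R by rewrite sqrtr_gt0.
  have g1 : gexp 1 theta <= 1.
    by rewrite /gexp -[leRHS]expR0 ler_expR oppr_le0 mul1r divr_ge0// sqr_ge0.
  rewrite !normrM normfV normrX (ger0_norm (gexp_ge0 _ _)) (gtr0_norm s0).
  apply: (@le_trans _ _ (1 * (1 / Num.sqrt k`!%:R * `|theta| ^+ k * 1) * (C * 2 ^+ k))).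
    have [p q] := (exprn_ge0 k (normr_ge0 theta), gexp_ge0 1 theta).
    have i0 : 0 <= (Num.sqrt k`!%:R)^-1 :> R by rewrite invr_ge0 ltW.
    have ai : 0 <= `|a k| / Num.sqrt k`!%:R by exact: mulr_ge0.
    have aip := mulr_ge0 ai p.
    apply: ler_pM => //; first by apply: mulr_ge0 => //; exact: mulr_ge0.
    apply: ler_pM => //; first exact: mulr_ge0.
    apply: ler_pM => //; apply: ler_pM => //.
    by apply: ler_wpM2r.
  have -> : 1 * (1 / Num.sqrt k`!%:R * `|theta| ^+ k * 1) * (C * 2 ^+ k) =
      C * ((2^-1) ^+ k * ((2 * x) ^+ k / Num.sqrt k`!%:R)).
    rewrite /x !exprMn exprVn; field.
    by rewrite gt_eqF// expf_neq0.
  rewrite /v -mulrA ler_wpM2l//.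
  have -> : (4^-1) ^+ k = ((2^-1) ^+ k) ^+ 2 :> R.
    by rewrite -exprM mulnC exprM; congr (_ ^+ _); field.
  have -> : (4 * x ^+ 2) ^+ k / k`!%:R = ((2 * x) ^+ k / Num.sqrt k`!%:R) ^+ 2.
    rewrite [RHS]exprMn exprVn sqr_sqrtr ?(ltW f0)// -exprM mulnC exprM.
    by congr (_ ^+ _ * _); ring.
  move: ((2^-1) ^+ k) ((2 * x) ^+ k / _) => p q.
  by have := sqr_ge0 (p - q); nra.
have cv : cvgn (series v).
  have -> : series v = fun n => C / 2 * (series (geometric 1 4^-1) n +
      series (exp_coeff (4 * x ^+ 2)) n).
    apply/funext => n; rewrite !seriesEnat /= -big_split/= mulr_sumr.
    by apply: eq_bigr => k _; rewrite /exp_coeff/= mul1r.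
  apply: is_cvgMr; apply: is_cvgD; last exact: is_cvg_series_exp_coeff.
  apply: is_cvg_geometric_series.
  by rewrite ger0_norm ?invr_ge0// invf_lt1// ltr1n.
have cv2 : cvgn [normed series (fun k => c k * upsilon theta k * z k w)].
  apply: series_le_cvg cv => k; [exact: normr_ge0| |exact: bound].
  exact: le_trans (normr_ge0 _) (bound k).
have := normed_cvg cv2; rewrite seriesEnat.
by rewrite (_ : [sequence _]_n = fun n => \sum_(k < n) c k * upsilon theta k * z k w)//;
  apply/funext => n; rewrite /= big_mkord.
Qed.

(** Domination gives convergence for all [theta] at once; the sums are identified
    along the subsequences on which the path norms tend to zero. *)
Lemma trans_series : {ae P, forall w, forall theta,
  (\sum_(k < n) re_i k * upsilon theta k * z k w @[n --> \oo] --> ctrans theta w) /\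
  (\sum_(k < n) im_i k * upsilon theta k * z k w @[n --> \oo] --> strans theta w)}.
Proof.
apply: filterS2 (pathnorm_small hz a_odd mkappa hkappa) sequence_growth => w small growth theta.
have key (c : nat -> R) (h : R -> R) : measurable_fun setT h -> (forall t, `|h t| <= 1) ->
    (forall k, `|c k| <= 1) -> (forall k, intR (fun t => h t * beta a t k) = c k * upsilon theta k) ->
    \sum_(k < n) c k * upsilon theta k * z k w @[n --> \oo] --> intR (fun t => h t * kappa t w).
  move=> mh h1 c1 hc; have cv := @upsilon_series_cvg w theta c c1 growth.
  set X := intR _; set S := (fun n => _) in cv *.
  suff -> : X = limn S by [].
  apply/eqP; rewrite eq_sym -subr_eq0 -normr_le0; apply/ler_addgt0Pr => e e0; rewrite add0r.
  have [N _ hN] : \forall n \near \oo, `|limn S - S n| < e / 2.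
    by have /cvgrPdist_lt := cv; apply; rewrite divr_gt0.
  have d0 : 0 < (e / 2) ^+ 2 / pi by rewrite divr_gt0 ?pi_gt0// exprn_gt0// divr_gt0.
  have [n Nn hn] := small N _ d0.
  rewrite -[limn S](subrK (S n)) -addrA [e]splitr (le_trans (ler_normD _ _))//.
  apply: lerD; first exact: ltW (hN n Nn).
  have := bounded_functional_error n w mh h1.
  under eq_bigr do rewrite hc.
  rewrite -/(S n) -/X => hle.
  have : (((S n - X) ^+ 2)%:E <= ((e / 2) ^+ 2)%:E)%E.
    apply: le_trans hle _; rewrite -[leRHS](_ : (pi%:E * ((e / 2) ^+ 2 / pi)%:E)%E = _).
      by apply: lee_wpmul2l; [rewrite lee_fin pi_ge0|exact: ltW].
    by rewrite -EFinM mulrC divfK// gt_eqF// pi_gt0.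
  rewrite lee_fin -(real_normK (num_real (S n - X))) ler_pXn2r// nnegrE//.
  by rewrite divr_ge0// ltW.
have r1 k := @reim_le1 R k.
split; apply: key.
- exact: measurable_cosM.
- by move=> t; exact: cos_le1.
- by move=> k; have [] := r1 k.
- by move=> k; rewrite (beta_transform theta k).1.
- exact: measurable_sinM.
- by move=> t; exact: sin_le1.
- by move=> k; have [] := r1 k.
- by move=> k; rewrite (beta_transform theta k).2.
Qed.

End transforms.

(** * Transforms of even and odd parts *)

Section fourier_parts.
Context {R : realType}.
Implicit Types f : R -> R.

Lemma Re_fourier f theta : complex.Re (fourier f theta) = intR (fun t => cos (theta * t) * f t).
Proof.
rewrite /fourier /cintegral /=; congr intR; apply/funext => t /=.
by rewrite mulr0 subr0.
Qed.

Lemma Im_fourier f theta : complex.Im (fourier f theta) = intR (fun t => sin (theta * t) * f t).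
Proof.
rewrite /fourier /cintegral /=; congr intR; apply/funext => t /=.
by rewrite mulr0 add0r.
Qed.

Lemma Re_mul_i (x : R[i]) : complex.Re (('i)%C * x) = - complex.Im x.
Proof. by case: x => x y /=; rewrite mul0r mul1r sub0r. Qed.

Lemma Im_mul_i (x : R[i]) : complex.Im (('i)%C * x) = complex.Re x.
Proof. by case: x => x y /=; rewrite mul0r mul1r add0r. Qed.

Lemma integrable_cos_mul f theta : integrableR f -> integrableR (fun t => cos (theta * t) * f t).
Proof.
apply: integrable_bounded_mul; first exact: measurable_cosM.
by move=> t; exact: cos_le1.
Qed.

Lemma integrable_sin_mul f theta : integrableR f -> integrableR (fun t => sin (theta * t) * f t).
Proof.
apply: integrable_bounded_mul; first exact: measurable_sinM.
by move=> t; exact: sin_le1.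
Qed.

Lemma fourier_even_part f theta : integrableR f ->
  fourier (even_part f) theta = (intR (fun t => cos (theta * t) * f t))%:C%C.
Proof.
move=> fi; have fi' := integrableR_reflect fi.
have ei : integrableR (even_part f).
  rewrite (_ : even_part f = fun t => 2^-1 * (f t + f (- t))).
    by apply: integrableRZ; exact: integrableRD.
  by apply/funext => t; rewrite /even_part mulrC.
apply/eqP; rewrite eq_complex Re_fourier Im_fourier /=; apply/andP; split; apply/eqP.
  have h : intR (fun t => cos (theta * t) * f (- t)) = intR (fun t => cos (theta * t) * f t).
    rewrite -[RHS]intR_reflect; last exact: integrable_cos_mul.
    by congr intR; apply/funext => t; rewrite mulrN cosN.
  rewrite (_ : (fun _ => _) = fun t => 2^-1 * (cos (theta * t) * f t + cos (theta * t) * f (- t))).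
    have i1 := integrable_cos_mul theta fi; have i2 := integrable_cos_mul theta fi'.
    by rewrite intR_scale ?intR_add ?h//; [field|exact: integrableRD].
  by apply/funext => t; rewrite /even_part; field.
apply: intR_odd; first exact: integrable_sin_mul.
by move=> t; rewrite /even_part opprK mulrN sinN mulNr [f (- t) + _]addrC.
Qed.

Lemma fourier_odd_part f theta : integrableR f ->
  fourier (odd_part f) theta = (0 +i* intR (fun t => sin (theta * t) * f t))%C.
Proof.
move=> fi; have fi' := integrableR_reflect fi.
have ei : integrableR (odd_part f).
  rewrite (_ : odd_part f = fun t => 2^-1 * (f t - f (- t))).
    by apply: integrableRZ; exact: integrableRB.
  by apply/funext => t; rewrite /odd_part mulrC.
apply/eqP; rewrite eq_complex Re_fourier Im_fourier /=; apply/andP; split; apply/eqP.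
  apply: intR_odd; first exact: integrable_cos_mul.
  by move=> t; rewrite /odd_part opprK mulrN cosN -mulrN -mulNr opprB.
have h : intR (fun t => sin (theta * t) * f (- t)) = - intR (fun t => sin (theta * t) * f t).
  rewrite -intR_reflect; last exact: integrable_sin_mul.
  rewrite -intR_opp; last exact: integrable_sin_mul.
  by congr intR; apply/funext => t; rewrite mulrN sinN opprK mulNr.
rewrite (_ : (fun _ => _) = fun t => 2^-1 * (sin (theta * t) * f t - sin (theta * t) * f (- t))).
  have i1 := integrable_sin_mul theta fi; have i2 := integrable_sin_mul theta fi'.
  by rewrite intR_scale ?intR_sub ?h//; [field|exact: integrableRB].
by apply/funext => t; rewrite /odd_part; field.
Qed.

End fourier_parts.

(** * The transforms as functions of the normal variables *)

Section series_functionals.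
Context {R : realType}.
Variable a : nat -> R.

Definition partial_trans (c : nat -> R) theta n (s : nat -> R) : R :=
  \sum_(k < n) c k * upsilon a theta k * s k.

(** The sum of the series as a function of the coefficient sequence; the upper
    limit makes it measurable and defined everywhere. *)
Definition sum_trans (c : nat -> R) theta (s : nat -> R) : R :=
  fine (limn_esup (fun n => (partial_trans c theta n s)%:E)).

Lemma sum_transE c theta s l : partial_trans c theta n s @[n --> \oo] --> l ->
  sum_trans c theta s = l.
Proof.
move=> h; rewrite /sum_trans.
have h' : (partial_trans c theta n s)%:E @[n --> \oo] --> l%:E.
  by apply/fine_cvgP; split => //; exact: nearW.
by rewrite (cvg_limn_einf_sup h').2.
Qed.

Lemma measurable_sum_trans c theta : measurable_fun [set: @seqT R] (sum_trans c theta).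
Proof.
apply: measurableT_comp => //; apply: measurable_fun_limn_esup => n.
apply/measurable_EFinP; apply: measurable_sum => k; apply: measurable_funM => //.
exact: measurable_coord.
Qed.

Lemma sum_trans_restrict (c : nat -> R) theta (I : pred nat) s :
  (forall k, ~~ I k -> c k = 0) -> sum_trans c theta (restrict_seq I s) = sum_trans c theta s.
Proof.
move=> c0; congr (fine (limn_esup _)); apply/funext => n; congr EFin.
apply: eq_bigr => k _; rewrite /restrict_seq; case: ifPn => // /c0 ->.
by rewrite !mul0r.
Qed.

Lemma sum_trans_sign (c : nat -> R) theta (e : R) s l :
  (forall k, c k * (-1) ^+ k = e * c k) ->
  partial_trans c theta n s @[n --> \oo] --> l ->
  sum_trans c theta (fun k => (-1) ^+ k * s k) = e * l.
Proof.
move=> hc h; apply: sum_transE.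
rewrite (_ : (fun _ => _) = fun n => e * partial_trans c theta n s); first exact: cvgMr.
apply/funext => n; rewrite /partial_trans mulr_sumr; apply: eq_bigr => k _.
by rewrite !mulrA -[e * _]hc; ring.
Qed.

(** Real parts of [i ^ k] select the even indices and imaginary parts the odd
    ones, which is what the sign changes [(-1) ^ k] see. *)
Lemma reim_i_parity k :
  [/\ (~~ odd k -> im_i k = 0 :> R), (odd k -> re_i k = 0 :> R),
    re_i k * (-1) ^+ k = 1 * re_i k :> R & im_i k * (-1) ^+ k = -1 * im_i k :> R].
Proof.
have [h1 h2] := @reim_even R k./2; have [h3 h4] := @reim_odd R k./2.
rewrite -[k]odd_double_half -signr_odd oddD odd_double addbF oddb; case: (odd k) => /=.
  by rewrite add1n h3 h4 expr1 !mulrN1 mulN1r oppr0 mulr0; split.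
by rewrite add0n h1 h2 expr0 !mulr1 mul1r mulr0; split.
Qed.

End series_functionals.

Section symmetric_normal.
Context {R : realType} {d : measure_display} {T : measurableType d}.
Variable P : probability T R.
Variable z : nat -> T -> R.
Hypothesis hz : iid_std_normal P z.

(** The standard normal law is invariant under [x |-> - x], its parameter entering
    only by its square. *)
Lemma iid_sign : iid_std_normal P (fun k w => (-1) ^+ k * z k w).
Proof.
have mz := iid_measurable hz.
have mf k : measurable_fun setT (fun x : R => (-1) ^+ k * x) by exact: measurable_funM.
have mpre k (A : set R) : measurable A -> measurable ((fun x : R => (-1) ^+ k * x) @^-1` A).
  by move=> mA; rewrite -[X in measurable X]setTI; exact: mf.
have law k (A : set R) : measurable A ->
    P ((fun w => (-1) ^+ k * z k w) @^-1` A) = P (z k @^-1` ((fun x => (-1) ^+ k * x) @^-1` A)).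
  by [].
split.
- by move=> k; apply: measurable_funM => //; exact: mz.
- move=> k A mA; rewrite law// (iid_law hz); last exact: mpre.
  have s0 : (-1) ^+ k != 0 :> R by rewrite signr_eq0.
  have := @normal_prob_scale R ((-1) ^+ k) A s0 mA.
  move=> <-; rewrite /normal_prob; congr (integral _ _ _); apply/funext => x.
  by rewrite !normal_pdfE ?oner_eq0// /normal_peak /normal_fun sqrr_sign expr1n.
- move=> J A mA.
  exact: (iid_indep hz J (fun k => mpre k _ (mA k))).
Qed.

End symmetric_normal.

(** * The coefficients in terms of double factorials *)

Section double_factorials.
Context {R : realType}.
Variable a : nat -> R.

Lemma dfactSS n : dfact n.+2 = (n.+2 * dfact n)%N. Proof. by []. Qed.

Lemma dfact_gt0 n : (0 < dfact n)%N.
Proof.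
suff : (0 < dfact n)%N && (0 < dfact n.+1)%N by case/andP.
by elim: n => [//|n /andP[h1 h2]]; rewrite h2 dfactSS muln_gt0.
Qed.

Lemma fact_dfact k : ((2 * k)`! = dfact (2 * k + (k == 0) - 1) * 2 ^ k * k`!)%N /\
  ((2 * k + 1)`! = dfact (2 * k + 1) * 2 ^ k * k`!)%N.
Proof.
elim: k => [//|k [_ IH2]].
have h1 : ((2 * k.+1)`! = dfact (2 * k + 1) * 2 ^ k.+1 * k.+1`!)%N.
  have -> : (2 * k.+1 = (2 * k + 1).+1)%N by rewrite mulnS addn1.
  rewrite factS IH2 factS expnS; nia.
have -> : (2 * k.+1 + (k.+1 == 0) - 1 = 2 * k + 1)%N by lia.
split=> //.
have -> : (2 * k.+1 + 1 = (2 * k + 1).+2)%N by lia.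
rewrite dfactSS factS.
have -> : ((2 * k + 1).+1 = 2 * k.+1)%N by lia.
by rewrite h1; lia.
Qed.

Lemma poissonE theta k : poisson k (theta ^+ 2 / 2) =
  (theta ^+ k) ^+ 2 / 2 ^+ k / k`!%:R * gexp 1 theta :> R.
Proof.
by rewrite /poisson /gexp mul1r exprMn exprVn -!exprM mulnC.
Qed.

Lemma sqrt_dfact D k : Num.sqrt (D * 2 ^ k * k`!)%:R =
  Num.sqrt D%:R * Num.sqrt 2 ^+ k * Num.sqrt k`!%:R :> R.
Proof.
rewrite !natrM natrX sqrtrM ?mulr_ge0 ?exprn_ge0// sqrtrM//; congr (_ * _ * _).
by rewrite -[X in X ^+ k](@sqr_sqrtr _ 2)// -exprM mulnC exprM sqrtr_sqr ger0_norm.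
Qed.

(** With [D] a double factorial, the square root on the right is that of [(2k)!]
    or [(2k + 1)!]: the powers of [sqrt 2] and [sqrt k!] are exactly what it has
    in excess of [sqrt D]. *)
Lemma coef_sqrt_fact D theta k : (0 < D)%N ->
  poisson k (theta ^+ 2 / 2) * Num.sqrt k`!%:R / Num.sqrt D%:R * (- Num.sqrt 2) ^+ k =
  (-1) ^+ k / Num.sqrt (D * 2 ^ k * k`!)%:R * (theta ^+ k) ^+ 2 * gexp 1 theta :> R.
Proof.
move=> D0; rewrite poissonE sqrt_dfact.
have {}D0 : Num.sqrt D%:R != 0 :> R by rewrite gt_eqF// sqrtr_gt0 ltr0n.
have f0 : Num.sqrt k`!%:R != 0 :> R by rewrite gt_eqF// sqrtr_gt0 ltr0n fact_gt0.
have s0 : Num.sqrt 2 ^+ k != 0 :> R by rewrite expf_neq0// gt_eqF// sqrtr_gt0.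
have e2 : 2 ^+ k = (Num.sqrt 2 ^+ k) ^+ 2 :> R by rewrite -exprM mulnC exprM sqr_sqrtr.
have ef : k`!%:R = Num.sqrt k`!%:R ^+ 2 :> R by rewrite sqr_sqrtr.
rewrite e2 {1}ef [(- Num.sqrt 2) ^+ k]exprNn.
move: (Num.sqrt D%:R) (Num.sqrt k`!%:R) (Num.sqrt 2 ^+ k) D0 f0 s0 => D' f s D0 f0 s0.
by field; rewrite D0 f0 s0.
Qed.

Lemma UcoefE theta k :
  Ucoef a theta k = re_i (2 * k) * upsilon a theta (2 * k).
Proof.
rewrite /Ucoef mulrAC coef_sqrt_fact ?dfact_gt0// -(fact_dfact k).1.
by rewrite /upsilon mul2n (reim_even k).1 -muln2 exprM; ring.
Qed.

Lemma VcoefE theta k :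
  theta * Vcoef a theta k = im_i (2 * k + 1) * upsilon a theta (2 * k + 1).
Proof.
rewrite /Vcoef mulrAC coef_sqrt_fact ?dfact_gt0// -(fact_dfact k).2.
have -> : im_i (2 * k + 1) = (-1) ^+ k :> R by rewrite addn1 mul2n (reim_odd k).2.
by rewrite /upsilon exprD [(2 * k)%N]mulnC exprM; ring.
Qed.

Lemma sum_Ucoef theta n (s : nat -> R) :
  \sum_(k < n) Ucoef a theta k * ((-1) ^+ (2 * k) * s (2 * k)%N) =
  partial_trans a re_i theta n.*2 s.
Proof.
elim: n => [|n IH]; first by rewrite /partial_trans !big_ord0.
rewrite big_ord_recr IH /partial_trans doubleS !big_ord_recr/=.
by rewrite UcoefE exprM sqrrN expr1n expr1n mul1r mul2n (reim_odd n).1 !mul0r addr0.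
Qed.

Lemma sum_Vcoef theta n (s : nat -> R) :
  theta * \sum_(k < n) Vcoef a theta k * ((-1) ^+ (2 * k + 1) * s (2 * k + 1)%N) =
  - partial_trans a im_i theta n.*2 s.
Proof.
elim: n => [|n IH]; first by rewrite /partial_trans !big_ord0 mulr0 oppr0.
rewrite big_ord_recr mulrDr IH /partial_trans doubleS !big_ord_recr/=.
rewrite mulrA VcoefE exprD exprM sqrrN expr1n expr1n expr1 mul1r.
by rewrite addn1 mul2n (reim_even n).2 !mul0r addr0 opprD mulN1r mulrN.
Qed.

End double_factorials.

(** * Gaussianity, independence and law of the transforms *)

Section processes.
Context {R : realType} {d : measure_display} {T : measurableType d}.
Variable P : probability T R.
Variable z : nat -> T -> R.
Hypothesis hz : iid_std_normal P z.
Variable a : nat -> R.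
Hypothesis a_odd : forall m, a m.*2.+1 ^+ 2 <= a m.*2 ^+ 2.
Hypothesis a_le1 : forall k, `|a k| <= 1.
Variable kappa : R -> T -> R.
Hypothesis mkappa : measurable_fun [set: measurableTypeR R * T] (fun p => kappa p.1 p.2).
Hypothesis hkappa : forall t, ms_sum P z (beta a t) (kappa t).
Notation U := (Uproc kappa).
Notation V := (Vproc kappa).

Lemma ms_sum_ae b (X X' : T -> R) : measurable_fun setT X' ->
  {ae P, forall w, X w = X' w} -> ms_sum P z b X -> ms_sum P z b X'.
Proof.
move=> mX' XX' [mX cX]; split => //.
rewrite (_ : (fun _ => _) = (fun n => sqnorm P (fun w => \sum_(k < n) b k * z k w - X w)%R))//.
apply/funext => n.
have mS := measurable_lincomb hz b.
apply: ae_eq_integral => //.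
- by apply: measurable_sqr; apply: measurable_funB mX'; exact: mS.
- by apply: measurable_sqr; apply: measurable_funB mX; exact: mS.
- by apply: filterS XX' => w -> _.
Qed.

Lemma measurable_intR_mul (h : R -> R) (f : R -> T -> R) : measurable_fun setT h ->
  measurable_fun [set: measurableTypeR R * T] (fun p => f p.1 p.2) ->
  measurable_fun setT (fun w => intR (fun t => h t * f t w)).
Proof.
move=> mh mf.
apply: (@measurable_param_intR _ _ _ (fun p => h p.1 * f p.1 p.2)).
apply: measurable_funM => //.
by apply: (measurableT_comp mh); exact: measurable_fst.
Qed.

Let mkappaN : measurable_fun [set: measurableTypeR R * T] (fun p => kappa (- p.1) p.2).
Proof.
have m : measurable_fun [set: measurableTypeR R * T]
    (fun p => (- p.1, p.2) : measurableTypeR R * T).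
  apply: measurable_fun_pair; last exact: measurable_snd.
  by apply: (measurableT_comp measurable_oppR); exact: measurable_fst.
exact: (measurableT_comp mkappa m).
Qed.

Lemma measurable_even_kappa :
  measurable_fun [set: measurableTypeR R * T] (fun p => even_part (kappa ^~ p.2) p.1).
Proof. by apply: measurable_funM => //; exact: measurable_funD. Qed.

Lemma measurable_odd_kappa :
  measurable_fun [set: measurableTypeR R * T] (fun p => odd_part (kappa ^~ p.2) p.1).
Proof. by apply: measurable_funM => //; exact: measurable_funB. Qed.

Lemma measurable_ReU theta : measurable_fun setT (fun w => complex.Re (U theta w)).
Proof.
under eq_fun do rewrite /Uproc Re_fourier.
apply: (@measurable_intR_mul _ (fun t w => even_part (kappa ^~ w) t)).
  exact: measurable_cosM.
exact: measurable_even_kappa.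
Qed.

Lemma measurable_ReV theta : measurable_fun setT (fun w => complex.Re (V theta w)).
Proof.
under eq_fun do rewrite /Vproc Re_mul_i Im_fourier.
apply: measurableT_comp => //.
apply: (@measurable_intR_mul _ (fun t w => odd_part (kappa ^~ w) t)).
  exact: measurable_sinM.
exact: measurable_odd_kappa.
Qed.

Lemma Re_kappa_hat theta w : complex.Re (kappa_hat kappa theta w) = ctrans kappa theta w.
Proof. exact: Re_fourier. Qed.

Lemma Im_kappa_hat theta w : complex.Im (kappa_hat kappa theta w) = strans kappa theta w.
Proof. exact: Im_fourier. Qed.

(** Parity removes the sine integral of the even part and the cosine integral of
    the odd part. *)
Lemma UV_ae : {ae P, forall w, forall theta,
  U theta w = (ctrans kappa theta w)%:C%C /\ V theta w = (- strans kappa theta w)%:C%C}.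
Proof.
apply: filterS (kappa_path_integrable hz a_odd mkappa hkappa) => w iw theta; split.
  by rewrite /Uproc fourier_even_part.
rewrite /Vproc fourier_odd_part//; apply/eqP; rewrite eq_complex.
by rewrite Re_mul_i Im_mul_i /= !eqxx.
Qed.

Lemma ms_sum_ReU theta :
  ms_sum P z (fun k => re_i k * upsilon a theta k) (fun w => complex.Re (U theta w)).
Proof.
apply: ms_sum_ae (measurable_ReU theta) _ (ms_sum_ctrans hz a_odd mkappa hkappa theta).
by apply: filterS UV_ae => w /(_ theta)[-> _].
Qed.

Lemma ms_sum_ReV theta :
  ms_sum P z (fun k => -1 * (im_i k * upsilon a theta k)) (fun w => complex.Re (V theta w)).
Proof.
have h := ms_sumZ hz (-1) (ms_sum_strans hz a_odd mkappa hkappa theta).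
apply: ms_sum_ae (measurable_ReV theta) _ h.
by apply: filterS UV_ae => w /(_ theta)[_ ->]; rewrite mulN1r.
Qed.

Lemma gaussian_kappa : gaussian_process P kappa.
Proof. exact: ms_sum_gaussian_process hkappa. Qed.

Lemma gaussian_ReU : gaussian_process P (fun theta w => complex.Re (U theta w)).
Proof. exact: ms_sum_gaussian_process ms_sum_ReU. Qed.

Lemma gaussian_ReV : gaussian_process P (fun theta w => complex.Re (V theta w)).
Proof. exact: ms_sum_gaussian_process ms_sum_ReV. Qed.

(** Reduces questions about the laws of [U] and [V] to measurable functions of the
    sequence [z]. *)
Lemma trans_functional : {ae P, forall w, forall theta,
  [/\ complex.Re (U theta w) = sum_trans a re_i theta (z ^~ w),
      complex.Re (V theta w) = - sum_trans a im_i theta (z ^~ w),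
      sum_trans a re_i theta (fun k => (-1) ^+ k * z k w) = sum_trans a re_i theta (z ^~ w) &
      sum_trans a im_i theta (fun k => (-1) ^+ k * z k w) = - sum_trans a im_i theta (z ^~ w)]}.
Proof.
apply: filterS2 UV_ae (trans_series hz a_odd a_le1 mkappa hkappa) => w hUV hs theta.
have [-> ->] := hUV theta; have [hc hsn] := hs theta.
have e1 := sum_transE (hc : partial_trans a re_i theta n (z ^~ w) @[n --> \oo] --> _).
have e2 := sum_transE (hsn : partial_trans a im_i theta n (z ^~ w) @[n --> \oo] --> _).
split => /=; rewrite ?e1 ?e2//.
- rewrite (sum_trans_sign (e := 1) _ (hc : partial_trans a re_i theta n (z ^~ w) @[n --> \oo] --> _)).
    by rewrite mul1r.
  by move=> k; have [] := @reim_i_parity R k.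
- rewrite (sum_trans_sign (e := -1) _ (hsn : partial_trans a im_i theta n (z ^~ w) @[n --> \oo] --> _)).
    by rewrite mulN1r.
  by move=> k; have [] := @reim_i_parity R k.
Qed.

Lemma measurable_forall_ord (d' : measure_display) (T' : measurableType d') n
    (X : 'I_n -> T' -> R) (A : 'I_n -> set R) :
  (forall i, measurable_fun setT (X i)) -> (forall i, measurable (A i)) ->
  measurable [set w | forall i, A i (X i w)].
Proof.
move=> mX mA; rewrite (_ : [set w | _] = \bigcap_(i in [set: 'I_n]) (X i @^-1` A i)); last first.
  by apply/seteqP; split => w /= h i; [move=> _; exact: h|exact: (h i I)].
apply: fin_bigcap_measurable => // i _.
by rewrite -[X in measurable X]setTI; exact: mX.
Qed.

(** [U] is a function of the [z_k] with [k] even and [V] of those with [k] odd. *)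
Lemma independent_UV :
  independent_processes P (fun theta w => complex.Re (U theta w))
                          (fun theta w => complex.Re (V theta w)).
Proof.
move=> m n s t A B mA mB EX EY.
pose FA : set (@seqT R) := [set x | forall i, A i (sum_trans a re_i (s i) x)].
pose FB : set (@seqT R) := [set x | forall j, B j (- sum_trans a im_i (t j) x)].
have mFA : measurable FA.
  by apply: measurable_forall_ord => // i; exact: measurable_sum_trans.
have mFB : measurable FB.
  apply: measurable_forall_ord => // i; apply: measurableT_comp => //.
  exact: measurable_sum_trans.
have mEX : measurable EX by apply: measurable_forall_ord => // i; exact: measurable_ReU.
have mEY : measurable EY by apply: measurable_forall_ord => // i; exact: measurable_ReV.
pose ev : pred nat := fun k => ~~ odd k.
have mz := iid_measurable hz.
pose GA := (fun w => restrict_seq ev (z ^~ w) : @seqT R) @^-1` FA.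
pose GB := (fun w => restrict_seq (predC ev) (z ^~ w) : @seqT R) @^-1` FB.
have mGA : measurable GA.
  rewrite -[X in measurable X]setTI.
  exact: (measurable_restrict_seq ev mz measurableT mFA).
have mGB : measurable GB.
  rewrite -[X in measurable X]setTI.
  exact: (measurable_restrict_seq (predC ev) mz measurableT mFB).
have reE theta x : sum_trans a re_i theta (restrict_seq ev x) = sum_trans a re_i theta x.
  apply: sum_trans_restrict => k; rewrite /ev negbK => k1.
  by have [_ -> //] := @reim_i_parity R k.
have imE theta x : sum_trans a im_i theta (restrict_seq (predC ev) x) = sum_trans a im_i theta x.
  apply: sum_trans_restrict => k; rewrite /ev /= negbK => k1.
  by have [-> //] := @reim_i_parity R k.
have aeX : {ae P, forall w, EX w <-> GA w}.
  apply: filterS trans_functional => w h; split => hw i;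
    by have := hw i; have [-> _ _ _] := h (s i); rewrite reE.
have aeY : {ae P, forall w, EY w <-> GB w}.
  apply: filterS trans_functional => w h; split => hw i;
    by have := hw i; have [_ -> _ _] := h (t i); rewrite imE.
rewrite (ae_prob_eq mEX mGA aeX) (ae_prob_eq mEY mGB aeY) -(iid_blocks hz)//.
apply: ae_prob_eq; [exact: measurableI|exact: measurableI|].
by apply: filterS2 aeX aeY => w h1 h2; split=> -[/h1 ? /h2 ?].
Qed.

Lemma ReDi (x y : R[i]) : complex.Re (x + ('i)%C * y) = complex.Re x - complex.Im y.
Proof. by case: x y => x1 x2 [y1 y2] /=; rewrite mul0r mul1r sub0r. Qed.

Lemma ImDi (x y : R[i]) : complex.Im (x + ('i)%C * y) = complex.Im x + complex.Re y.
Proof. by case: x y => x1 x2 [y1 y2] /=; rewrite mul0r mul1r add0r. Qed.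

(** Changing the sign of the [z_k] with [k] odd preserves the law of the
    sequence and turns [U - i V] into [U + i V]. *)
Lemma same_law_UV :
  same_law P (kappa_hat kappa) (fun theta w => U theta w + ('i)%C * V theta w).
Proof.
move=> n t A B mA mB.
pose S : set (@seqT R) := [set x | forall i, A i (sum_trans a re_i (t i) x)] `&`
  [set x | forall i, B i (sum_trans a im_i (t i) x)].
have mS : measurable S.
  by apply: measurableI; apply: measurable_forall_ord => // i; exact: measurable_sum_trans.
have mz := iid_measurable hz.
have hz' := iid_sign hz.
have mz' := iid_measurable hz'.
have law := iid_same_law hz hz' mS.
have mc theta : measurable_fun setT (ctrans kappa theta).
  by apply: (measurable_intR_mul (measurable_cosM theta)).
have ms theta : measurable_fun setT (strans kappa theta).
  by apply: (measurable_intR_mul (measurable_sinM theta)).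
have mImU theta : measurable_fun setT (fun w => complex.Im (U theta w)).
  under eq_fun do rewrite /Uproc Im_fourier.
  apply: (@measurable_intR_mul _ (fun t w => even_part (kappa ^~ w) t)).
    exact: measurable_sinM.
  exact: measurable_even_kappa.
have mImV theta : measurable_fun setT (fun w => complex.Im (V theta w)).
  under eq_fun do rewrite /Vproc Im_mul_i Re_fourier.
  apply: (@measurable_intR_mul _ (fun t w => odd_part (kappa ^~ w) t)).
    exact: measurable_cosM.
  exact: measurable_odd_kappa.
have split2 (X Y : R -> T -> R) :
    [set w | forall i, A i (X (t i) w) /\ B i (Y (t i) w)] =
    [set w | forall i, A i (X (t i) w)] `&` [set w | forall i, B i (Y (t i) w)].
  apply/seteqP; split => w /=; first by move=> h; split => i; have [] := h i.
  by move=> [h1 h2] i; split; [exact: h1|exact: h2].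
have m2 (X Y : R -> T -> R) : (forall theta, measurable_fun setT (X theta)) ->
    (forall theta, measurable_fun setT (Y theta)) ->
    measurable [set w | forall i, A i (X (t i) w) /\ B i (Y (t i) w)].
  move=> mX mY; rewrite split2.
  by apply: measurableI; apply: measurable_forall_ord.
have mSz (y : nat -> T -> R) : (forall k, measurable_fun setT (y k)) ->
    measurable [set w | S (y ^~ w)].
  by move=> my; rewrite -[X in measurable X]setTI; exact: (measurable_seq my measurableT mS).
transitivity (P [set w | S (z ^~ w)]).
  apply: ae_prob_eq; [|exact: mSz|].
    under [X in measurable X]eq_set do under eq_forall do rewrite Re_kappa_hat Im_kappa_hat.
    exact: m2.
  apply: filterS2 trans_functional UV_ae => w h hUV.
  suff e i : A i (complex.Re (kappa_hat kappa (t i) w)) /\ B i (complex.Im (kappa_hat kappa (t i) w))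
     <-> A i (sum_trans a re_i (t i) (z ^~ w)) /\ B i (sum_trans a im_i (t i) (z ^~ w)).
    split=> [hw|[h1 h2] i]; last by apply/e; split; [exact: h1|exact: h2].
    by split => i; have /e[] := hw i.
  have [e1 e2 _ _] := h (t i); have [u v] := hUV (t i).
  rewrite Re_kappa_hat Im_kappa_hat.
  by move: e1 e2; rewrite u v /= => <- /oppr_inj <-.
rewrite law; apply/esym; apply: ae_prob_eq; [|exact: mSz|].
  rewrite (_ : [set w | _] = [set w | forall i,
      A i (complex.Re (U (t i) w) - complex.Im (V (t i) w)) /\
      B i (complex.Im (U (t i) w) + complex.Re (V (t i) w))]).
    apply: (m2 (fun th w => complex.Re (U th w) - complex.Im (V th w))
      (fun th w => complex.Im (U th w) + complex.Re (V th w))) => theta.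
      by apply: measurable_funB => //; exact: measurable_ReU.
    by apply: measurable_funD => //; exact: measurable_ReV.
  by apply/seteqP; split => w h i; have := h i; rewrite ReDi ImDi.
apply: filterS2 trans_functional UV_ae => w h hUV.
suff e i : A i (complex.Re (U (t i) w + ('i)%C * V (t i) w)) /\
     B i (complex.Im (U (t i) w + ('i)%C * V (t i) w))
   <-> A i (sum_trans a re_i (t i) (fun k => (-1) ^+ k * z k w)) /\
       B i (sum_trans a im_i (t i) (fun k => (-1) ^+ k * z k w)).
  split=> [hw|[h1 h2] i]; last by apply/e; split; [exact: h1|exact: h2].
  by split => i; have /e[] := hw i.
have [e1 e2 -> ->] := h (t i); rewrite -e1 -e2; have [u v] := hUV (t i).
by rewrite ReDi ImDi u v /= subr0 add0r.
Qed.

End processes.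

(** * Inversion in mean square *)

Section windows.
Context {R : realType}.
Notation mu := (@lebesgue_measure R).

Lemma integrable_window (x y : R) : integrableR (\1_(`[x, y]%classic) : R -> R).
Proof.
apply/integrableP; split.
  by apply/measurable_EFinP; apply: measurable_indic; exact: measurable_itv.
rewrite (_ : (\int[mu]_t _)%E = (\int[mu]_t (\1_(`[x, y]%classic) t)%:E)%E); last first.
  by apply: eq_integral => t _; rewrite /= ger0_norm// indicE.
have mi : measurable (`[x, y]%classic : set R) by exact: measurable_itv.
rewrite integral_indic// setIT; apply: le_lt_trans (_ : (lebesgue_measure `[x, y] < +oo)%E) => //.
by rewrite lebesgue_measure_itv/=; case: ifP => _; rewrite ?ltry// -EFinB ltry.
Qed.

Lemma Rintegral_indic (D : set R) (f : R -> R) :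
  (\int[mu]_(t in D) f t)%R = intR (fun t => \1_D t * f t).
Proof.
rewrite /intR /Rintegral integral_mkcond; congr fine; apply: eq_integral => t _.
by rewrite patchE indicE; case: ifP => _; rewrite ?mul1r ?mul0r.
Qed.

Lemma ereal_cvg0 {I : Type} (F : set_system I) {FF : Filter F} (f : I -> \bar R) :
  (forall i, 0 <= f i)%E -> (forall e : R, 0 < e -> \forall i \near F, (f i <= e%:E)%E) ->
  f @ F --> 0%E.
Proof.
move=> f0 fe; apply/fine_cvgP; split.
  apply: filterS (fe 1 ltr01) => i f1.
  by rewrite ge0_fin_numE// (le_lt_trans f1)// ltry.
apply/cvgr0Pnorm_le => e e0; apply: filterS (fe e e0) => i fi.
rewrite /= ger0_norm ?fine_ge0// -lee_fin fineK//.
by rewrite ge0_fin_numE// (le_lt_trans fi)// ltry.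
Qed.

Lemma Re_cintegral (D : set R) (f : R -> R[i]) :
  complex.Re (cintegral D f) = (\int[mu]_(x in D) complex.Re (f x))%R.
Proof. by []. Qed.

Lemma Im_cintegral (D : set R) (f : R -> R[i]) :
  complex.Im (cintegral D f) = (\int[mu]_(x in D) complex.Im (f x))%R.
Proof. by []. Qed.

Lemma Re_scale_cis (r x : R) (c : R[i]) : complex.Re (r%:C%C * (cis x * c)) =
  r * (cos x * complex.Re c - sin x * complex.Im c).
Proof. by case: c => u v /=; rewrite mul0r subr0. Qed.

Lemma Im_scale_cis (r x : R) (c : R[i]) : complex.Im (r%:C%C * (cis x * c)) =
  r * (cos x * complex.Im c + sin x * complex.Re c).
Proof. by case: c => u v /=; rewrite mul0r addr0. Qed.

Lemma normsq_expectation {d : measure_display} {T : measurableType d} (P : probability T R)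
    (X : T -> R[i]) (A B : T -> R) : measurable_fun setT A -> measurable_fun setT B ->
  (forall w, complex.Re (X w) = A w) -> (forall w, complex.Im (X w) = B w) ->
  (\int[P]_w (normsq (X w))%:E = sqnorm P A + sqnorm P B)%E.
Proof.
move=> mA mB eA eB; rewrite /sqnorm -(ge0_integralD P measurableT).
- by apply: eq_integral => w _; rewrite /normsq eA eB.
- by move=> w _; rewrite lee_fin sqr_ge0.
- exact: measurable_sqr.
- by move=> w _; rewrite lee_fin sqr_ge0.
- exact: measurable_sqr.
Qed.

End windows.

Section inversion.
Context {R : realType} {d : measure_display} {T : measurableType d}.
Variable P : probability T R.
Variable z : nat -> T -> R.
Hypothesis hz : iid_std_normal P z.
Variable a : nat -> R.
Hypothesis a_odd : forall m, a m.*2.+1 ^+ 2 <= a m.*2 ^+ 2.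
Variable kappa : R -> T -> R.
Hypothesis mkappa : measurable_fun [set: measurableTypeR R * T] (fun p => kappa p.1 p.2).
Hypothesis hkappa : forall t, ms_sum P z (beta a t) (kappa t).
Notation mu := (@lebesgue_measure R).

Lemma integrable_upsilon k : integrableR (upsilon a ^~ k).
Proof.
rewrite (_ : upsilon a ^~ k = fun t => a k / Num.sqrt (k`!)%:R * ('X^k.[t] * gexp 1 t)).
  by apply: integrableRZ; exact: integrable_gcos0.
by apply/funext => t; rewrite hornerXn /upsilon mulrA.
Qed.

(** The cosine and sine transforms are treated at once: [tr] stands for either
    function and [c k] for the corresponding part of [i ^ k]. *)
Section window_transform.
Variables (tr : R -> R) (c : nat -> R).
Hypothesis ctr : continuous tr.
Hypothesis tr1 : forall t, `|tr t| <= 1.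
Hypothesis htr : forall theta k,
  intR (fun t => tr (theta * t) * beta a t k) = c k * upsilon a theta k.

Let mtr : measurable_fun setT tr.
Proof. exact: continuous_measurable_fun. Qed.

Let trans theta w := intR (fun t => tr (theta * t) * kappa t w).

(** Integrate a measurable function on a triple product over its first variable. *)
Lemma measurable_trans2 :
  measurable_fun [set: measurableTypeR R * T] (fun p => trans p.1 p.2).
Proof.
have m1 : measurable_fun [set: measurableTypeR R * (measurableTypeR R * T)]
    (fun p => p.2.1 * p.1 : measurableTypeR R).
  apply: measurable_funM; last exact: measurable_fst.
  by apply: (measurableT_comp measurable_fst); exact: measurable_snd.
have m2 : measurable_fun [set: measurableTypeR R * (measurableTypeR R * T)]
    (fun p => (p.1, p.2.2) : measurableTypeR R * T).
  apply: measurable_fun_pair; first exact: measurable_fst.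
  by apply: (measurableT_comp measurable_snd); exact: measurable_snd.
apply: (@measurable_param_intR _ _ _ (fun p : measurableTypeR R * (measurableTypeR R * T) =>
   tr (p.2.1 * p.1) * kappa p.1 p.2.2)).
apply: measurable_funM; first exact: (measurableT_comp mtr m1).
exact: (measurableT_comp mkappa m2).
Qed.

Let mscale theta : measurable_fun setT (fun t : R => tr (theta * t)).
Proof. by apply: (measurableT_comp mtr); exact: measurable_funM. Qed.

Variables (x y : R) (p : R -> R).
Hypothesis mp : measurable_fun setT p.
Hypothesis hp : forall theta, `|p theta| <= \1_(`[x, y]%classic) theta.

Let p1 theta : `|p theta| <= 1.
Proof. by apply: le_trans (hp theta) _; rewrite indicE; case: (_ \in _). Qed.

Lemma integrable_window_trans w : integrableR (kappa ^~ w) ->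
  integrableR (fun theta => p theta * trans theta w).
Proof.
move=> ik; set M := intR (fun t => `|kappa t w|).
apply: (@integrableR_le _ _ (fun theta => M * \1_(`[x, y]%classic) theta)).
- apply: measurable_funM => //.
  exact: (measurable_fun_pair1 w measurable_trans2).
- by apply: integrableRZ; exact: integrable_window.
- move=> theta; rewrite normrM mulrC ler_pM//.
  have it := integrable_bounded_mul (mscale theta) (fun t => tr1 (theta * t)) ik.
  apply: le_trans (ler_norm_intR it) _.
  apply: le_intR; [exact: integrableR_norm|exact: integrableR_norm|].
  by move=> t; rewrite normrM ler_piMl.
Qed.

(** The error of the transform is bounded uniformly in the frequency, so its
    integral over a bounded window costs at most the length of the window. *)
Lemma ms_sum_window :
  ms_sum P z (fun k => intR (fun theta => p theta * (c k * upsilon a theta k)))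
    (fun w => intR (fun theta => p theta * trans theta w)).
Proof.
have W0 : 0 <= intR (\1_(`[x, y]%classic)) :> R.
  by apply: intR_ge0 => t; rewrite indicE.
pose W : R := intR (\1_(`[x, y]%classic)) + 1.
have {}W0 : 0 < W by rewrite ltr_wpDl.
apply: (@ms_sum_of_pathnorm _ _ _ P z hz a a_odd kappa mkappa hkappa _ _ (pi * W ^+ 2)).
- apply: (@measurable_param_intR _ _ _ (fun q => p q.1 * trans q.1 q.2)).
  apply: measurable_funM; last exact: measurable_trans2.
  by apply: (measurableT_comp mp); exact: measurable_fst.
- move=> n w; have := pathnorm_ge0 z a kappa n w; case e : (pathnorm _ _ _ n w) => [D| |] // D0.
    have [_ _ ik] := integrable_pathnorm hz mkappa e.
    pose L := Num.sqrt (pi * D).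
    have piD : 0 <= pi * D by rewrite mulr_ge0// pi_ge0.
    have errL theta : `|\sum_(k < n) c k * upsilon a theta k * z k w - trans theta w| <= L.
      have := bounded_functional_error hz a mkappa n w (mscale theta) (fun t => tr1 (theta * t)).
      under eq_bigr do rewrite htr.
      rewrite e -EFinM lee_fin => h.
      by rewrite -sqrtr_sqr ler_sqrt.
    have [iSn eSn] := intR_lincomb (z ^~ w) n
      (fun k => integrable_bounded_mul mp p1 (integrableRZ (c k) (integrable_upsilon k))).
    have diffE : (fun theta => \sum_(k < n) p theta * (c k * upsilon a theta k) * z k w -
        p theta * trans theta w) =
        (fun theta => p theta * (\sum_(k < n) c k * upsilon a theta k * z k w - trans theta w)).
      apply/funext => t; rewrite mulrBr mulr_sumr; congr (_ - _).
      by apply: eq_bigr => k _; rewrite [RHS]mulrA.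
    have iT := integrable_window_trans ik.
    rewrite -EFinM lee_fin -eSn -intR_sub// diffE.
    have -> : pi * W ^+ 2 * D = (L * W) ^+ 2 by rewrite exprMn sqr_sqrtr//; ring.
    have LW : 0 <= L * W by rewrite mulr_ge0 ?sqrtr_ge0// ltW.
    rewrite -(real_normK (num_real (intR _))) lerXn2r ?nnegrE//.
    have iD : integrableR (fun theta => p theta *
        (\sum_(k < n) c k * upsilon a theta k * z k w - trans theta w)).
      by rewrite -diffE; exact: integrableRB.
    apply: le_trans (ler_norm_intR iD) _.
    apply: (@le_trans _ _ (intR (fun theta => L * \1_(`[x, y]%classic) theta))).
      apply: le_intR; [exact: integrableR_norm|by apply: integrableRZ; exact: integrable_window|].
      by move=> theta; rewrite normrM mulrC ler_pM.
    rewrite intR_scale; last exact: integrable_window.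
    by rewrite ler_wpM2l ?sqrtr_ge0// /W lerDl.
  by rewrite gt0_muley ?leey// lte_fin mulr_gt0 ?pi_gt0// exprn_gt0.
- by rewrite mulr_ge0 ?pi_ge0// sqr_ge0.
Qed.

End window_transform.

Definition tail (x y : R) k : R :=
  intR (fun theta => (1 - \1_(`[x, y]%classic) theta) * `|upsilon a theta k|).

Let window_bound (x y theta : R) : 0 <= 1 - (\1_(`[x, y]%classic) theta : R) <= 1.
Proof. by rewrite indicE; case: (_ \in _); rewrite ?subrr ?subr0 lexx ler01. Qed.

Let mwindow x y : measurable_fun setT (\1_(`[x, y]%classic) : R -> R).
Proof. by apply: measurable_indic; exact: measurable_itv. Qed.

Let mcowindow x y : measurable_fun setT (fun theta : R => 1 - \1_(`[x, y]%classic) theta : R).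
Proof. exact: measurable_funB. Qed.

Let integrable_cowindow_mul (x y : R) (f : R -> R) : integrableR f ->
  integrableR (fun theta => (1 - \1_(`[x, y]%classic) theta) * f theta).
Proof.
apply: integrable_bounded_mul => // t.
by have /andP[h1 h2] := window_bound x y t; rewrite ger0_norm.
Qed.

Lemma tail_ge0 x y k : 0 <= tail x y k.
Proof.
apply: intR_ge0 => t; apply: mulr_ge0 => //.
Qed.

Lemma window_error x y (f : R -> R) (r : R) k : measurable_fun setT f ->
  (forall t, `|f t| <= 1) -> `|r| <= 1 ->
  `|intR (fun theta => \1_(`[x, y]%classic) theta * f theta * (r * upsilon a theta k)) -
    intR (fun theta => f theta * (r * upsilon a theta k))| <= tail x y k.
Proof.
move=> mf f1 r1.
have iu := integrableRZ r (integrable_upsilon k).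
have i1 := integrable_bounded_mul mf f1 iu.
have i2 := integrable_cowindow_mul x y i1.
rewrite (_ : (fun theta => \1_(_) theta * f theta * _) = (fun theta => f theta * (r * upsilon a theta k) -
  (1 - \1_(`[x, y]%classic) theta) * (f theta * (r * upsilon a theta k)))); last first.
  by apply/funext => t; ring.
rewrite intR_sub// addrAC subrr sub0r normrN.
apply: le_trans (ler_norm_intR i2) _.
apply: le_intR; [exact: integrableR_norm| |].
  by apply: integrable_cowindow_mul; apply: integrableR_norm; exact: integrable_upsilon.
move=> t; have /andP[h1 h2] := window_bound x y t.
rewrite !normrM ger0_norm// ler_wpM2l// mulrA ler_piMl//.
by rewrite mulr_ile1.
Qed.

Lemma tailE x y k : tail x y k = `|a k / Num.sqrt (k`!)%:R| *
  intR (fun theta => (1 - \1_(`[x, y]%classic) theta) * (`|theta| ^+ k * gexp 1 theta)).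
Proof.
rewrite -intR_scale; last by apply: integrable_cowindow_mul; exact: integrable_absmoment.
congr intR; apply/funext => t.
rewrite /upsilon 2!normrM normrX (ger0_norm (gexp_ge0 _ _)); ring.
Qed.

Lemma tail_le_rho x y k : tail x y k ^+ 2 <= 2 * pi * rho a k.
Proof.
have f0 : 0 < k`!%:R :> R by rewrite ltr0n fact_gt0.
have h : tail x y k <= `|a k / Num.sqrt (k`!)%:R| * absmoment k.
  rewrite tailE ler_wpM2l//; apply: le_intR; [|exact: integrable_absmoment|].
    by apply: integrable_cowindow_mul; exact: integrable_absmoment.
  move=> t; have /andP[h1 h2] := window_bound x y t.
  by rewrite ler_piMl// mulr_ge0 ?exprn_ge0 ?gexp_ge0.
apply: (@le_trans _ _ ((`|a k / Num.sqrt (k`!)%:R| * absmoment k) ^+ 2)).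
  by rewrite lerXn2r ?nnegrE ?tail_ge0// mulr_ge0 ?absmoment_ge0.
rewrite exprMn real_normK ?num_real// exprMn exprVn sqr_sqrtr ?(ltW f0)//.
apply: le_trans (ler_wpM2l _ (absmoment_le k)) _; first by rewrite divr_ge0 ?sqr_ge0// ltW.
rewrite le_eqVlt; apply/orP; left; apply/eqP; rewrite /rho.
by move: (pi) (k`!%:R) f0 => p f f0; field; rewrite gt_eqF.
Qed.

(** Outside of the window [|theta| >= m], so one more power of [|theta|] gains a
    factor [1 / m]. *)
Lemma tail_small (m x y : R) k : 0 < m -> m <= x -> m <= y ->
  tail (- x) y k <= `|a k / Num.sqrt (k`!)%:R| * absmoment k.+1 / m.
Proof.
move=> m0 mx my; rewrite tailE -mulrA ler_wpM2l//.
rewrite mulrC -intR_scale; last exact: integrable_absmoment.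
apply: le_intR.
- by apply: integrable_cowindow_mul; exact: integrable_absmoment.
- by apply: integrableRZ; exact: integrable_absmoment.
move=> t; have g0 : 0 <= `|t| ^+ k * gexp 1 t by rewrite mulr_ge0 ?exprn_ge0 ?gexp_ge0.
rewrite exprS -[_ * _ * gexp 1 t]mulrA mulrA ler_wpM2r// indicE.
case: (boolP (t \in _)) => [_|]; first by rewrite subrr mulr_ge0// invr_ge0 ltW.
rewrite subr0 => /negP tD; rewrite mulrC ler_pdivlMr// mul1r leNgt; apply/negP => tm.
apply: tD; rewrite inE /= in_itv/=; move: tm; rewrite ltr_norml => /andP[t1 t2]; lra.
Qed.

(** Terms beyond some [N] are negligible uniformly in the window, by domination;
    the remaining ones are finitely many and tend to zero. *)
Lemma tail_series_cvg0 :
  (\sum_(0 <= k <oo) (tail (- ST.1) ST.2 k ^+ 2)%:E)%E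
    @[ST --> filter_prod (pinfty_nbhs R) (pinfty_nbhs R)] --> 0%E.
Proof.
apply: ereal_cvg0.
  by move=> ST; apply: nneseries_ge0 => k _ _; rewrite lee_fin sqr_ge0.
move=> e e0.
have e2 : 0 < e / 2 by rewrite divr_gt0.
have pi2 : 0 < 2 * pi :> R by rewrite mulr_gt0// pi_gt0.
have [N hN] : exists N, ((2 * pi)%:E * \sum_(N <= k <oo) (rho a k)%:E <= (e / 2)%:E)%E.
  have cv : (\sum_(N <= k <oo) (rho a k)%:E)%E @[N --> \oo] --> 0%E.
    apply: (nneseries_tail_cvg (rho_summable hz a_odd hkappa)).
    by move=> k _; rewrite lee_fin rho_ge0.
  have /fine_cvgP[fX /cvgr0_norm_le cX] := cv.
  have [N1 _ h1] := fX; have [N2 _ h2] := cX _ (divr_gt0 e2 pi2).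
  pose n := maxn N1 N2.
  have n1 : (N1 <= n)%N by exact: leq_maxl.
  have n2 : (N2 <= n)%N by exact: leq_maxr.
  exists n; rewrite -(fineK (h1 n n1)) -EFinM lee_fin mulrC -ler_pdivlMr//.
  by apply: le_trans (h2 n n2); exact: ler_norm.
pose B : R := \sum_(k < N) (`|a k / Num.sqrt (k`!)%:R| * absmoment k.+1) ^+ 2.
have B0 : 0 <= B by apply: sumr_ge0 => k _; exact: sqr_ge0.
pose m : R := B / (e / 2) + 1.
have m1 : 1 <= m by rewrite /m lerDr divr_ge0// ltW.
have m0 : 0 < m by exact: lt_le_trans ltr01 m1.
exists ([set x | m <= x], [set x | m <= x]).
  by split; exists m; split => //; [exact: num_real|move=> u /= /ltW|exact: num_real|move=> u /= /ltW].
move=> [x y] /= [mx my].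
rewrite (nneseries_split 0 N); last by move=> k _; rewrite lee_fin sqr_ge0.
rewrite add0n [e]splitr EFinD; apply: leeD.
  rewrite big_mkord sumEFin lee_fin.
  apply: (@le_trans _ _ (B / m ^+ 2)).
    rewrite /B mulr_suml; apply: ler_sum => k _.
    rewrite -exprVn -exprMn lerXn2r ?nnegrE ?tail_ge0//.
      by rewrite !mulr_ge0 ?absmoment_ge0 ?invr_ge0// ltW.
    exact: tail_small.
  rewrite ler_pdivrMr ?exprn_gt0//.
  have : B <= e / 2 * m by rewrite /m mulrDr mulrCA divff ?gt_eqF// !mulr1 lerDl ltW.
  move/le_trans; apply; apply: ler_wpM2l; first exact: ltW.
  by rewrite expr2 ler_peMl// ltW.
apply: le_trans hN; rewrite -nneseriesZl; last by move=> k _; rewrite lee_fin rho_ge0.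
apply: lee_nneseries => k _; first by move=> _; rewrite lee_fin sqr_ge0.
by rewrite -EFinM lee_fin tail_le_rho.
Qed.

(** The real and imaginary parts of the truncated inverse integral both combine
    the cosine and sine transforms with bounded weights [p] and [q]. *)
Section truncated_inverse.
Variables (p q : R -> R).
Hypotheses (mp : measurable_fun setT p) (mq : measurable_fun setT q).
Hypotheses (p1 : forall t, `|p t| <= 1) (q1 : forall t, `|q t| <= 1).

Definition truncated_inverse x y w : R := intR (fun theta => \1_(`[x, y]%classic) theta *
  ((2 * pi)^-1 * (p theta * ctrans kappa theta w + q theta * strans kappa theta w))).

Lemma measurable_truncated_inverse x y : measurable_fun setT (truncated_inverse x y).
Proof.
apply: (@measurable_param_intR _ _ _ (fun r => \1_(`[x, y]%classic) r.1 *
  ((2 * pi)^-1 * (p r.1 * ctrans kappa r.1 r.2 + q r.1 * strans kappa r.1 r.2)))).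
have mfst (f : R -> R) : measurable_fun setT f ->
    measurable_fun [set: measurableTypeR R * T] (fun r => f r.1).
  by move=> mf; apply: (measurableT_comp mf); exact: measurable_fst.
apply: measurable_funM; first exact: mfst (mwindow x y).
apply: measurable_funM => //; apply: measurable_funD; apply: measurable_funM; try exact: mfst.
  exact: (measurable_trans2 (@continuous_cos R)).
exact: (measurable_trans2 (@continuous_sin R)).
Qed.

Let masked (x y : R) (f : R -> R) : measurable_fun setT f -> (forall t, `|f t| <= 1) ->
  measurable_fun setT (fun theta => (\1_(`[x, y]%classic) theta : R) * f theta) /\
  forall theta, `|\1_(`[x, y]%classic) theta * f theta| <= \1_(`[x, y]%classic) theta.
Proof.
move=> mf f1; split; first exact: measurable_funM (mwindow x y) mf.
move=> t; rewrite normrM (@ger0_norm _ (\1_(`[x, y]%classic) t)) ?indicE//.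
by rewrite ler_piMr.
Qed.

Lemma ms_sum_truncated_inverse x y : ms_sum P z (fun k => (2 * pi)^-1 *
    (intR (fun theta => \1_(`[x, y]%classic) theta * p theta * (re_i k * upsilon a theta k)) +
     intR (fun theta => \1_(`[x, y]%classic) theta * q theta * (im_i k * upsilon a theta k))))
  (truncated_inverse x y).
Proof.
have [mp' hp'] := masked x y mp p1; have [mq' hq'] := masked x y mq q1.
have hc := fun theta k => (beta_transform a theta k).1.
have hs := fun theta k => (beta_transform a theta k).2.
have c1 (t : R) := cos_le1 t; have s1 (t : R) := sin_le1 t.
have h1 := ms_sum_window (@continuous_cos R) c1 hc mp' hp'.
have h2 := ms_sum_window (@continuous_sin R) s1 hs mq' hq'.
have h := ms_sumZ hz (2 * pi)^-1 (ms_sumD hz h1 h2).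
apply: (ms_sum_ae hz (measurable_truncated_inverse x y) _ h).
apply: filterS (kappa_path_integrable hz a_odd mkappa hkappa) => w iw.
have i1 := integrable_window_trans (@continuous_cos R) c1 mp' hp' iw.
have i2 := integrable_window_trans (@continuous_sin R) s1 mq' hq' iw.
rewrite -intR_add// -intR_scale; last exact: integrableRD.
by congr intR; apply/funext => t; rewrite /ctrans /strans; ring.
Qed.

(** The error is itself a mean square series, whose coefficients are the parts of
    the inversion integrals outside of the window. *)
Lemma truncated_inverse_error X b x y : ms_sum P z b X ->
  (forall k, b k = (2 * pi)^-1 * (intR (fun theta => p theta * (re_i k * upsilon a theta k)) +
     intR (fun theta => q theta * (im_i k * upsilon a theta k)))) ->
  (sqnorm P (fun w => truncated_inverse x y w - X w)%R <=
    2%:E * \sum_(0 <= k <oo) (tail x y k ^+ 2)%:E)%E.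
Proof.
move=> hX hb.
have h := ms_sumD hz (ms_sum_truncated_inverse x y) (ms_sumZ hz (-1) hX).
have := ms_sum_tail hz 0 h.
rewrite (_ : (fun w => _ - _) = (fun w => -1 * (truncated_inverse x y w - X w))); last first.
  by apply/funext => w; rewrite big_ord0 sub0r !mulN1r.
rewrite sqnormZ; last first.
  by apply: measurable_funB; [exact: measurable_truncated_inverse|case: hX].
rewrite sqrrN expr1n mul1e => /le_trans; apply.
apply: lee_wpmul2l; first by rewrite lee_fin.
apply: lee_nneseries => k _; first by move=> _; rewrite lee_fin sqr_ge0.
rewrite lee_fin hb.
have [r1 i1] := @reim_le1 R k.
have e1 := window_error x y k mp p1 r1.
have e2 := window_error x y k mq q1 i1.
move: e1 e2; set A := intR _; set A' := intR _; set B := intR _; set B' := intR _ => e1 e2.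
have -> : (2 * pi)^-1 * (A + B) + -1 * ((2 * pi)^-1 * (A' + B')) =
   (2 * pi)^-1 * ((A - A') + (B - B')) by ring.
have t0 := tail_ge0 x y k.
rewrite -(real_normK (num_real (_ * _))) lerXn2r ?nnegrE// normrM.
have pi2 : 2 <= 2 * pi :> R by rewrite ler_peMr//; have := @pi_ge2 R; lra.
have pi0 : 0 < 2 * pi :> R by apply: lt_le_trans pi2.
rewrite (@ger0_norm _ (2 * pi)^-1) ?invr_ge0 ?(ltW pi0)//.
rewrite ler_pdivrMl//; apply: le_trans (ler_normD _ _) _.
apply: le_trans (lerD e1 e2) _.
apply: (@le_trans _ _ (2 * tail x y k)); first by rewrite mulrDl !mul1r.
by rewrite ler_wpM2r.
Qed.

End truncated_inverse.

(** Fourier inversion for a single Hermite function, with the real and the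
    imaginary part of the integral written out separately. *)
Lemma beta_inverse t k :
  beta a t k = (2 * pi)^-1 * (intR (fun theta => cos (- (theta * t)) * (re_i k * upsilon a theta k)) +
     intR (fun theta => - sin (- (theta * t)) * (im_i k * upsilon a theta k))) /\
  0 = (2 * pi)^-1 * (intR (fun theta => sin (- (theta * t)) * (re_i k * upsilon a theta k)) +
     intR (fun theta => cos (- (theta * t)) * (im_i k * upsilon a theta k))).
Proof.
have [h1 h2] := @hermite_inverse R k t.
set A := a k / Num.sqrt (k`!)%:R.
have ec r : intR (fun theta => cos (- (theta * t)) * (r * upsilon a theta k)) = A * (r * gcos 1 'X^k t).
  rewrite /gcos -[r * intR _]intR_scale ?integrable_gcos// -intR_scale; last first.
    by apply: integrableRZ; exact: integrable_gcos.
  by congr intR; apply/funext => u; rewrite cosN hornerXn /upsilon -/A [t * u]mulrC; ring.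
have es r : intR (fun theta => - sin (- (theta * t)) * (r * upsilon a theta k)) = A * (r * gsin 1 'X^k t).
  rewrite /gsin -[r * intR _]intR_scale ?integrable_gsin// -intR_scale; last first.
    by apply: integrableRZ; exact: integrable_gsin.
  by congr intR; apply/funext => u; rewrite sinN opprK hornerXn /upsilon -/A [t * u]mulrC; ring.
have es' r : intR (fun theta => sin (- (theta * t)) * (r * upsilon a theta k)) = - (A * (r * gsin 1 'X^k t)).
  rewrite -mulrN -mulNr -es; congr intR; apply/funext => u; ring.
rewrite !ec es es' -mulrDr h1 /beta -/A; split.
  have s0 : Num.sqrt (2 * pi) != 0 :> R by rewrite gt_eqF// sqrtr_gt0 mulr_gt0// pi_gt0.
  have -> : 2 * pi = Num.sqrt (2 * pi) ^+ 2 :> R.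
    by rewrite sqr_sqrtr// mulr_ge0// pi_ge0.
  rewrite sqrtr_sqr (@ger0_norm _ (Num.sqrt _)) ?sqrtr_ge0//.
  by move: (Num.sqrt (2 * pi)) s0 ((hermite k).[t]) => s s0 h; field.
by rewrite addrC -mulrBr h2 !mulr0.
Qed.

Lemma inversion_formula t :
  ms_improper_integral P
    (fun theta w => (((2 * pi)^-1)%:C)%C * (cis (- (theta * t)) * kappa_hat kappa theta w))
    (fun w => ((kappa t w)%:C)%C).
Proof.
pose cN theta : R := cos (- (theta * t)).
pose sN theta : R := sin (- (theta * t)).
pose nN theta : R := - sin (- (theta * t)).
have m0 : measurable_fun setT (fun theta : R => - (theta * t)).
  by apply: measurableT_comp => //; exact: measurable_funM.
have mc : measurable_fun setT cN.
  by apply: (measurableT_comp _ m0); apply: continuous_measurable_fun; exact: continuous_cos.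
have ms : measurable_fun setT sN.
  by apply: (measurableT_comp _ m0); apply: continuous_measurable_fun; exact: continuous_sin.
have mn : measurable_fun setT nN by exact: measurableT_comp.
have c1 u : `|cN u| <= 1 by exact: cos_le1.
have s1 u : `|sN u| <= 1 by exact: sin_le1.
have n1 u : `|nN u| <= 1 by rewrite normrN; exact: sin_le1.
have reE x y w : complex.Re (cintegral `[x, y]%classic (fun theta =>
    (((2 * pi)^-1)%:C)%C * (cis (- (theta * t)) * kappa_hat kappa theta w))) =
    truncated_inverse cN nN x y w.
  rewrite Re_cintegral Rintegral_indic; congr intR; apply/funext => u; congr (_ * _).
  by rewrite Re_scale_cis Re_kappa_hat Im_kappa_hat /nN mulNr.
have imE x y w : complex.Im (cintegral `[x, y]%classic (fun theta =>
    (((2 * pi)^-1)%:C)%C * (cis (- (theta * t)) * kappa_hat kappa theta w))) =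
    truncated_inverse sN cN x y w.
  rewrite Im_cintegral Rintegral_indic; congr intR; apply/funext => u; congr (_ * _).
  by rewrite Im_scale_cis Re_kappa_hat Im_kappa_hat addrC.
have mtc x y := measurable_truncated_inverse mc mn x y.
have mts x y := measurable_truncated_inverse ms mc x y.
have mk : measurable_fun setT (kappa t) by case: (hkappa t).
have h4 : (4%:E * \sum_(0 <= k <oo) (tail (- ST.1) ST.2 k ^+ 2)%:E)%E
    @[ST --> filter_prod (pinfty_nbhs R) (pinfty_nbhs R)] --> 0%E.
  rewrite -[X in _ --> X](mule0 4%:E); apply: cvgeZl => //; exact: tail_series_cvg0.
rewrite /ms_improper_integral; apply: squeeze_cvge h4; last exact: cvg_cst.
apply: nearW => -[x y] /=; apply/andP; split.
  by apply: integral_ge0 => w _; rewrite lee_fin /normsq addr_ge0// sqr_ge0.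
have e1 := truncated_inverse_error mc mn c1 n1 (- x) y (hkappa t) (fun k => (beta_inverse t k).1).
have e2 := truncated_inverse_error ms mc s1 c1 (- x) y (ms_sum0 P z) (fun k => (beta_inverse t k).2).
have mr : measurable_fun setT (fun w => truncated_inverse cN nN (- x) y w - kappa t w).
  exact: measurable_funB.
have mi : measurable_fun setT (fun w => truncated_inverse sN cN (- x) y w - 0 : R).
  exact: measurable_funB.
rewrite (normsq_expectation P mr mi).
- apply: le_trans (leeD e1 e2) _.
  rewrite -ge0_muleDl ?lee_fin// -EFinD.
  by rewrite (_ : 2 + 2 = 4 :> R)//; ring.
- by move=> w; rewrite raddfB -reE.
- by move=> w; rewrite raddfB -imE.
Qed.

End inversion.

(** * Moments of the product of the points *)

Section moments.
Context {R : realType}.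

Lemma partial_product_le1 {d : measure_display} {T : measurableType d}
    (present : nat -> T -> bool) (xi : nat -> T -> R) n w :
  point_process present xi -> `|partial_product present xi id n w| <= 1.
Proof.
move=> hxi; rewrite /partial_product; elim/big_rec: _ => [|j x pj x1].
  by rewrite normr1.
rewrite normrM mulr_ile1// ler_norml.
by have := point_itv hxi pj; rewrite in_itv/=.
Qed.

Lemma product_of_points_le1 {d : measure_display} {T : measurableType d} (Q : probability T R)
    (present : nat -> T -> bool) (xi : nat -> T -> R) (Z : T -> R) :
  point_process present xi -> product_of_points Q present xi Z ->
  {ae Q, forall w, `|Z w| <= 1}.
Proof.
move=> hxi; apply: filterS => w cZ.
have /cvg_norm cN := cZ.
rewrite -(cvg_lim _ cN)//; apply: limr_le; first by apply/cvg_ex; eexists; exact: cN.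
by apply: nearW => n; exact: partial_product_le1.
Qed.

Lemma ae_le1_distribution {d1 d2 : measure_display} {T1 : measurableType d1}
    {T2 : measurableType d2} (Q : probability T1 R) (P : probability T2 R)
    (Z : {RV Q >-> R}) (Y : {RV P >-> R}) :
  distribution P Y = distribution Q Z -> {ae Q, forall w, `|Z w| <= 1} ->
  {ae P, forall w, `|Y w| <= 1}.
Proof.
move=> hY hZ.
have mA : measurable (~` `[-1, 1]%classic : set R).
  by apply: measurableC; exact: measurable_itv.
have mpreZ : measurable (Z @^-1` (~` `[-1, 1]%classic)) by exact: measurable_preimage.
have mpreY : measurable (Y @^-1` (~` `[-1, 1]%classic)) by exact: measurable_preimage.
have memE (x : R) : (~` `[-1, 1]%classic) x <-> ~~ (`|x| <= 1).
  by rewrite /= in_itv/= ler_norml; split => /negP.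
have Z0 : Q (Z @^-1` (~` `[-1, 1]%classic)) = 0%E.
  rewrite -(@measure0 _ _ _ Q); apply: ae_prob_eq => //.
  by apply: filterS hZ => w Zw; split => // /memE; rewrite Zw.
have Y0 : P (Y @^-1` (~` `[-1, 1]%classic)) = 0%E.
  rewrite -Z0; exact: (congr1 (fun m : set R -> \bar R => m (~` `[-1, 1]%classic)) hY).
exists (Y @^-1` (~` `[-1, 1]%classic)); split => // w /= Yw.
by apply/memE/negP.
Qed.

Context {d : measure_display} {T : measurableType d} {P : probability T R}.
Variable Y : {RV P >-> R}.
Hypothesis Y1 : {ae P, forall w, `|Y w| <= 1}.

Let mY : measurable_fun setT Y. Proof. exact: measurable_funPT. Qed.

Let mpow k : measurable_fun setT (fun w => (Y w ^+ k)%:E).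
Proof. by apply/measurable_EFinP; exact: measurable_funX. Qed.

Let mnorm k : measurable_fun setT (fun w => (`|Y w| ^+ k)%:E).
Proof.
apply/measurable_EFinP; apply: measurable_funX; exact: measurableT_comp.
Qed.

Lemma abs_power_itv k :
  exists2 r : R, (\int[P]_w (`|Y w| ^+ k)%:E = r%:E)%E & 0 <= r <= 1.
Proof.
have h1 : (\int[P]_w (`|Y w| ^+ k)%:E <= 1%:E)%E.
  apply: (@le_trans _ _ (\int[P]_w 1%:E)%E); last first.
    rewrite integral_cst// mul1e; exact: probability_le1.
  apply: ae_ge0_le_integral => //.
  by apply: filterS Y1 => w Yw _; rewrite lee_fin exprn_ile1.
have h0 : (0 <= \int[P]_w (`|Y w| ^+ k)%:E)%E.
  by apply: integral_ge0 => w _; rewrite lee_fin exprn_ge0.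
exists (fine (\int[P]_w (`|Y w| ^+ k)%:E)).
  by rewrite fineK// ge0_fin_numE// (le_lt_trans h1)// ltry.
have f : (\int[P]_w (`|Y w| ^+ k)%:E)%E \is a fin_num.
  by rewrite ge0_fin_numE// (le_lt_trans h1)// ltry.
by rewrite -!lee_fin fineK// h0 h1.
Qed.

Lemma moment_le k r : (\int[P]_w (`|Y w| ^+ k)%:E = r%:E)%E -> `|moment P Y k| <= r.
Proof.
move=> hr.
have ii : P.-integrable setT (fun w => (Y w ^+ k)%:E).
  apply/integrableP; split => //.
  by under eq_integral do rewrite /= normrX; rewrite hr ltry.
rewrite /moment unlock -lee_fin -abse_EFin fineK ?integrable_fin_num//.
apply: le_trans (le_abse_integral P measurableT (mpow k)) _.
by under eq_integral do rewrite /= normrX; rewrite hr.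
Qed.

Lemma moment_le1 k : `|moment P Y k| <= 1.
Proof. by have [r hr /andP[_ r1]] := abs_power_itv k; apply: le_trans (moment_le hr) r1. Qed.

(** [|Y| ^ (2m+1) <= |Y| ^ (2m)], and even powers need no absolute value. *)
Lemma moment_odd_le m : moment P Y m.*2.+1 ^+ 2 <= moment P Y m.*2 ^+ 2.
Proof.
have [r hr /andP[r0 _]] := abs_power_itv m.*2.
have [s hs /andP[s0 _]] := abs_power_itv m.*2.+1.
have sr : s <= r.
  rewrite -lee_fin -hr -hs; apply: ae_ge0_le_integral => //.
  by apply: filterS Y1 => w Yw _; rewrite lee_fin exprS ler_piMl// exprn_ge0.
have -> : moment P Y m.*2 = r.
  rewrite /moment unlock; transitivity (fine (\int[P]_w (`|Y w| ^+ m.*2)%:E)); last by rewrite hr.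
  congr fine; apply: eq_integral => w _.
  by rewrite -[in RHS]mul2n exprM real_normK ?num_real// -exprM mul2n.
rewrite -(real_normK (num_real (moment _ _ _))) lerXn2r ?nnegrE//.
exact: le_trans (moment_le hs) sr.
Qed.

End moments.

Lemma kappa_ms_sum {R : realType} {d : measure_display} {T : measurableType d}
    (P : probability T R) (a : nat -> R) (H : nat -> {poly R}) (z : nat -> T -> R)
    (kappa : R -> T -> R) : hermite_chebycheff H -> is_kappa P a H z kappa ->
  forall t, ms_sum P z (beta a t) (kappa t).
Proof.
move=> hH [mk hk] t; split; first exact: (@measurable_fun_pair2 _ _ _ _ _ _ _ t mk).
have := hk t; set f := (fun n => _); set g := (fun n => _) => hf.
suff -> : g = f by [].
apply/funext => n; apply: eq_integral => w _.
congr (((_ - _) ^+ 2)%:E); rewrite /kappa_partial mulr_sumr; apply: eq_bigr => k _.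
rewrite (hermite_chebycheffE hH) /beta /gexp mul1r; ring.
Qed.

Lemma cvg_double : n.*2 @[n --> \oo] --> \oo.
Proof. by under eq_fun do rewrite -muln2; exact: cvg_mulnr. Qed.

Theorem corollary7 (R : realType)
  (nu : {measure set (measurableTypeR R) -> \bar R})
  (* the point process with p.g.fl. G^(1/2) and the product Z of its points *)
  (d1 : measure_display) (T1 : measurableType d1) (Q : probability T1 R)
  (present : nat -> T1 -> bool) (xi : nat -> T1 -> R)
  (hxi : point_process present xi)
  (hG : has_pgfl Q present xi (fun f => poweR (Gfun nu f) (2^-1)))
  (Z : {RV Q >-> R}) (hZ : product_of_points Q present xi Z)
  (* Y_{1/2} *)
  (d2 : measure_display) (T2 : measurableType d2) (PY : probability T2 R)
  (Y : {RV PY >-> R}) (hY : distribution PY Y = distribution Q Z)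
  (H : nat -> {poly R}) (hH : hermite_chebycheff H)
  (d : measure_display) (T : measurableType d) (P : probability T R)
  (zeta : nat -> T -> R) (hzeta : iid_std_normal P zeta)
  (kappa : R -> T -> R) (hkappa : is_kappa P (moment PY Y) H zeta kappa) :
  let a := moment PY Y in
  let U := Uproc kappa in
  let V := Vproc kappa in
  let zeta' := fun k w => (-1) ^+ k * zeta k w in
  (* the objects introduced: sample paths integrable, processes Gaussian,
     U and V independent, kappa_hat distributed as U + iV *)
  [/\ {ae P, forall w,
        lebesgue_measure.-integrable setT (fun t : R => (kappa t w)%:E)},
      gaussian_process P kappa,
      gaussian_process P (fun theta w => complex.Re (U theta w)) /\
      gaussian_process P (fun theta w => complex.Re (V theta w)),
      independent_processes P (fun theta w => complex.Re (U theta w))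
                              (fun theta w => complex.Re (V theta w)) &
      same_law P (kappa_hat kappa)
                 (fun theta w => U theta w + ('i)%C * V theta w)] /\
  (* strong representation *)
  [/\ iid_std_normal P zeta',
      {ae P, forall w, forall theta : R,
        complex.Im (U theta w) = 0 /\
        (\sum_(k < n) Ucoef a theta k * zeta' (2 * k)%N w)
          @[n --> \oo] --> complex.Re (U theta w)} &
      {ae P, forall w, forall theta : R,
        complex.Im (V theta w) = 0 /\
        (theta * \sum_(k < n) Vcoef a theta k * zeta' (2 * k + 1)%N w)
          @[n --> \oo] --> complex.Re (V theta w)}] /\
  (* inversion formula *)
  forall t : R,
    ms_improper_integral P
      (fun theta w => (((2 * pi)^-1)%:C)%C *
                      (cis (- (theta * t)) * kappa_hat kappa theta w))
      (fun w => ((kappa t w)%:C)%C).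

Proof.
move=> a U V zeta'.
have Y1 := ae_le1_distribution hY (product_of_points_le1 hxi hZ).
have a1 k : `|a k| <= 1 by exact: moment_le1.
have a2 m : a m.*2.+1 ^+ 2 <= a m.*2 ^+ 2 by exact: moment_odd_le.
have hk := kappa_ms_sum hH hkappa.
have mk := kappa_measurable hkappa.
split; last split.
- split.
  + by apply: filterS (kappa_path_integrable hzeta a2 mk hk) => w.
  + exact: (gaussian_kappa hzeta hk).
  + split; [exact: (gaussian_ReU hzeta a2 mk hk)|exact: (gaussian_ReV hzeta a2 mk hk)].
  + exact: (independent_UV hzeta a2 a1 mk hk).
  + exact: (same_law_UV hzeta a2 a1 mk hk).
- split.
  + exact: iid_sign.
  + apply: filterS2 (UV_ae hzeta a2 mk hk) (trans_series hzeta a2 a1 mk hk) => w hUV hs theta.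
    have [u _] := hUV theta; have [hc _] := hs theta.
    rewrite /U u; split => //.
    under eq_fun do rewrite (sum_Ucoef a theta _ (zeta ^~ w)).
    apply: (cvg_comp _ (fun n => partial_trans a re_i theta n (zeta ^~ w)) _ hc).
    exact: cvg_double.
  + apply: filterS2 (UV_ae hzeta a2 mk hk) (trans_series hzeta a2 a1 mk hk) => w hUV hs theta.
    have [_ v] := hUV theta; have [_ hc] := hs theta.
    rewrite /V v; split => //.
    under eq_fun do rewrite (sum_Vcoef a theta _ (zeta ^~ w)).
    apply: cvgN.
    apply: (cvg_comp _ (fun n => partial_trans a im_i theta n (zeta ^~ w)) _ hc).
    exact: cvg_double.
- move=> t; exact: (inversion_formula hzeta a2 mk hk).
Qed.
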